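(* Let $P$ be a $d$-polytope with $d+3$ vertices, of which at most $d-1$ are nonsimple. Then $P$ is either a $(d-3)$-fold pyramid over a simplicial $3$-prism, a $(d-3)$-fold pyramid over $Q_3^1$, or a $(d-2)$-fold pyramid over a pentagon. As a consequence, the graph of $P$ determines its entire combinatorial structure. These results are best possible in the sense that for any $d\ge 4$ there are nonpyramidal $d$-polytopes with $d+3$ vertices and exactly $d$ nonsimple vertices which are not reconstructible from their graphs.
   Context: A $d$-polytope is a convex polytope of dimension $d$. Its graph ($1$-skeleton) has the vertices and edges of the polytope as vertices and edges. A vertex of a $d$-polytope is simple if its degree in the graph is exactly $d$ (equivalently, it lies in exactly $d$ facets), and nonsimple otherwise. Polytopes are considered up to combinatorial equivalence (isomorphism of face lattices). A $d$-polytope $P$ is reconstructible from its graph (its graph determines its entire combinatorial structure) if, whenever $P'$ is a $d$-polytope and $\varphi$ is an isomorphism from the graph of $P$ to that of $P'$, $\varphi$ is induced by an isomorphism of the face lattices of $P$ and $P'$. A polytope is a pyramid (is pyramidal) if it is the convex hull of a facet (the basis) and one further vertex. A $0$-fold pyramid over $Q$ is $Q$ itself, and an $r$-fold pyramid over $Q$ ($r\ge 1$) is a pyramid whose basis is an $(r-1)$-fold pyramid over $Q$; alternatives requiring $r<0$ do not occur. A simplicial $3$-prism is a prism over a triangle. $Q_3^1$ (the tetragonal antiwedge) is the $3$-polytope with six vertices, six facets and exactly two nonsimple vertices; combinatorially it is obtained from a triangular prism by splitting one quadrilateral facet along a diagonal into two triangular facets. *)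

(* Defs.v *)
From HB Require Import structures.
From mathcomp Require Import all_boot all_order all_algebra.
From mathcomp Require Import boolp classical_sets functions cardinality reals convex.

Set Implicit Arguments.
Unset Strict Implicit.
Unset Printing Implicit Defensive.

Import Order.TTheory GRing.Theory Num.Theory.

Local Open Scope classical_set_scope.
Local Open Scope card_scope.
Local Open Scope ring_scope.

Definition conv_hull (R : realType) (n : nat) (S : set 'rV[R]_n) : set 'rV[R]_n :=
  smallest (@convex_set R 'rV[R]_n) S.

(* U is the linear span of all the differences of points of A, i.e. the
   direction of the affine hull of A when A is nonempty *)
Definition is_direction (R : realType) (n : nat)
    (A : set 'rV[R]_n) (U : {vspace 'rV[R]_n}) : Prop :=
  forall W : {vspace 'rV[R]_n},
    (U <= W)%VS <-> (forall x y, A x -> A y -> x - y \in W).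

(* Affine dimension; the empty set, of dimension -1, has no dimension here. *)
Definition has_dim (R : realType) (n : nat) (A : set 'rV[R]_n) (d : nat) : Prop :=
  A !=set0 /\ exists2 U, is_direction A U & \dim U = d.

Definition dpolytope (R : realType) (n d : nat) (P : set 'rV[R]_n) : Prop :=
  (exists2 S : set 'rV[R]_n, finite_set S & P = conv_hull S) /\ has_dim P d.

(* c = 0 is allowed, so that set0 and P are faces of P: the faces ordered by
   inclusion form the whole face lattice. *)
Definition faces (R : realType) (n : nat) (P : set 'rV[R]_n) : set (set 'rV[R]_n) :=
  [set F | exists (c : 'cV[R]_n) (b : R),
     (forall x, P x -> (x *m c) 0 0 <= b) /\
     F = [set x | P x /\ (x *m c) 0 0 = b]].

Definition vertices (R : realType) (n : nat) (P : set 'rV[R]_n) : set 'rV[R]_n :=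
  [set v | faces P [set v]].

Definition facets (R : realType) (n : nat) (P : set 'rV[R]_n) : set (set 'rV[R]_n) :=
  [set F | faces P F /\ exists2 d, has_dim P d.+1 & has_dim F d].

Definition edges (R : realType) (n : nat) (P : set 'rV[R]_n) : set (set 'rV[R]_n) :=
  [set E | faces P E /\ has_dim E 1].

Definition adjacent (R : realType) (n : nat) (P : set 'rV[R]_n) (u v : 'rV[R]_n) : Prop :=
  [/\ vertices P u, vertices P v, u <> v &
      exists2 E, edges P E & E u /\ E v].

Definition simple_vertex (R : realType) (n d : nat) (P : set 'rV[R]_n) (v : 'rV[R]_n) : Prop :=
  vertices P v /\ [set u | adjacent P v u] #= `I_d.

Definition nonsimple_vertices (R : realType) (n d : nat) (P : set 'rV[R]_n) : set 'rV[R]_n :=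
  [set v | vertices P v /\ ~ simple_vertex d P v].

Definition face_lattice_iso (R : realType) (n m : nat)
    (P : set 'rV[R]_n) (Q : set 'rV[R]_m) (psi : set 'rV[R]_n -> set 'rV[R]_m) : Prop :=
  set_bij (faces P) (faces Q) psi /\
  (forall F G, faces P F -> faces P G -> (psi F `<=` psi G <-> F `<=` G)).

Definition comb_equiv (R : realType) (n m : nat)
    (P : set 'rV[R]_n) (Q : set 'rV[R]_m) : Prop :=
  exists psi, face_lattice_iso P Q psi.

Definition graph_iso (R : realType) (n m : nat)
    (P : set 'rV[R]_n) (Q : set 'rV[R]_m) (phi : 'rV[R]_n -> 'rV[R]_m) : Prop :=
  set_bij (vertices P) (vertices Q) phi /\
  (forall u v, vertices P u -> vertices P v ->
     (adjacent Q (phi u) (phi v) <-> adjacent P u v)).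

Definition reconstructible (R : realType) (n d : nat) (P : set 'rV[R]_n) : Prop :=
  forall (m : nat) (P' : set 'rV[R]_m) (phi : 'rV[R]_n -> 'rV[R]_m),
    dpolytope d P' -> graph_iso P P' phi ->
    exists2 psi, face_lattice_iso P P' psi &
      forall v, vertices P v -> psi [set v] = [set phi v].

Definition pyramid_with_basis (R : realType) (n : nat) (B P : set 'rV[R]_n) : Prop :=
  facets P B /\
  exists2 v, vertices P v /\ ~ B v & P = conv_hull (B `|` [set v]).

Definition pyramidal (R : realType) (n : nat) (P : set 'rV[R]_n) : Prop :=
  exists B, pyramid_with_basis B P.

(* A 0-fold pyramid over Q is Q only up to combinatorial equivalence, and hence
   so is the bottom basis of an r-fold one. *)
Fixpoint fold_pyramid (R : realType) (m n r : nat)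
    (Q : set 'rV[R]_m) (P : set 'rV[R]_n) : Prop :=
  if r is r'.+1 then
    exists2 B, pyramid_with_basis B P & fold_pyramid r' Q B
  else comb_equiv P Q.

Definition pentagon (R : realType) (n : nat) (Q : set 'rV[R]_n) : Prop :=
  dpolytope 2 Q /\ vertices Q #= `I_5.

Definition triangle (R : realType) (n : nat) (T : set 'rV[R]_n) : Prop :=
  dpolytope 2 T /\ vertices T #= `I_3.

Definition simplicial_3prism (R : realType) (n : nat) (Q : set 'rV[R]_n) : Prop :=
  exists (T : set 'rV[R]_n) (U : {vspace 'rV[R]_n}) (w : 'rV[R]_n),
    [/\ triangle T, is_direction T U, w \notin U &
        Q = conv_hull (T `|` [set x + w | x in T])].

(* Q_3^1; these numbers determine the combinatorial type, since the only other
   3-polytope with six vertices and six facets is the pyramid over a pentagon,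
   which has a single nonsimple vertex. *)
Definition tetragonal_antiwedge (R : realType) (n : nat) (Q : set 'rV[R]_n) : Prop :=
  [/\ dpolytope 3 Q, vertices Q #= `I_6, facets Q #= `I_6 &
      nonsimple_vertices 3 Q #= `I_2].

(* Main.v *)
Require Import Defs.
From HB Require Import structures.
From mathcomp Require Import all_boot all_order all_algebra.
From mathcomp Require Import boolp classical_sets functions cardinality reals convex.
From mathcomp Require Import interval_inference ring lra zify.

Set Implicit Arguments.
Unset Strict Implicit.
Unset Printing Implicit Defensive.

Import Order.TTheory GRing.Theory Num.Theory.

Local Open Scope classical_set_scope.
Local Open Scope card_scope.
Local Open Scope ring_scope.

(** Gale duality turns both halves of the theorem into plane geometry.  Let the
    N = d + 3 vertices x_i of P span dimension d.  Their affine dependencies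
    form a plane; a basis (p, q) of it attaches to each vertex the vector
    (p_i, q_i).  By linear algebra alone, the vectors (b - x_i c)_i are the
    solutions y of sum y_i p_i = sum y_i q_i = 0 ([gale_exists]), so a set of
    vertices spans a face if and only if its complement is the support of a
    nonnegative solution, a coface ([gale_face]).  That every x_i is a vertex
    says that every nonzero covector is negative on at least two of the vectors
    ([vert_balanced]); two vertices are nonadjacent if and only if some open
    half-plane contains their two vectors and no other ([coface_pair]).  P is a
    pyramid with apex x_i when the vector of x_i is zero, and x_i is simple if
    and only if it has exactly two non-neighbours.

    Consider the graph of nonadjacent pairs.  Three covectors of a plane are
    linearly dependent; comparing the signs of such a dependency at the cut
    vertices shows that the degrees are at most 2 and that there is no triangle
    and no 4-cycle.  At most d - 1 nonsimple vertices leave at least four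
    vertices of degree 2, and [pentagon_or_path] then finds a 5-cycle or a path
    on six vertices.  In both cases all the other vectors vanish
    ([pentagon_zero], [path_zero]): P is an iterated pyramid over a polytope
    with five or six vertices.  A 5-cycle gives a pentagon.  For a path
    p0 - ... - p5 the signs of the vectors in suitable coordinates are forced
    ([path_frameP]), and the cofaces depend only on whether p0 and p5 are
    nonadjacent as well ([path_cofaceP]): if they are, the core is a prism,
    otherwise a tetragonal antiwedge.  Since the cofaces are read off the graph
    of P, the graph determines the face lattice ([coface_rigid]).

    For the last part, take the vectors (-2,1), (0,1), (d-1,0), (1,-1), (0,-1)
    and d - 2 copies of (-1,0).  The nonadjacent pairs form a path on the first
    five, so three vertices are simple, and reversing this path is an
    automorphism of the graph.  It sends the coface formed by the opposite
    vectors (0,1), (0,-1) to the pair (1,-1), (-2,1), which is not a coface. *)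

(** * Vectors and covectors of the plane *)

Section Plane.
Variables (R : realFieldType) (I : finType) (p q : I -> R).

Definition cval (c : R * R) (i : I) : R := c.1 * p i + c.2 * q i.

Definition zero_vec (i : I) : bool := (p i == 0) && (q i == 0).

Definition balanced : Prop :=
  forall c, (exists i, cval c i != 0) ->
    exists i j, [/\ i != j, cval c i < 0 & cval c j < 0].

(** Under Gale duality these are the pairs of vertices of the polytope that
    span no edge, see [coface_pair]. *)
Definition nonadj (i j : I) : bool :=
  (i != j) && `[< exists c, forall k, (cval c k < 0) = (k == i) || (k == j) >].

Definition cuts (c : R * R) (i j : I) : Prop :=
  [/\ cval c i < 0, cval c j < 0 & forall k, k != i -> k != j -> 0 <= cval c k].

Lemma nonadjP i j : nonadj i j -> i != j /\ exists c, cuts c i j.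
Proof.
move=> /andP[ij /asboolP[c Hc]]; split=> //; exists c.
split; rewrite ?Hc ?eqxx ?orbT // => k ki kj.
by rewrite leNgt Hc (negPf ki) (negPf kj).
Qed.

Lemma cuts_nonadj c i j : i != j -> cuts c i j -> nonadj i j.
Proof.
move=> ij [ci cj ck]; rewrite /nonadj ij; apply/asboolP; exists c => k.
have [->|ki] := eqVneq k i; first by rewrite ci.
have [->|kj] := eqVneq k j; first by rewrite cj.
by apply/negbTE; rewrite -leNgt ck.
Qed.

Lemma nonadj_sym : symmetric nonadj.
Proof.
by move=> i j; apply/idP/idP => /nonadjP[ij [c [ci cj ck]]];
  apply: (@cuts_nonadj c); rewrite 1?eq_sym //; split=> // k ki kj; apply: ck.
Qed.

(** The coefficients are the 2 x 2 minors of the three covectors, unless all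
    of these vanish. *)
Lemma cval_dep c1 c2 c3 : exists a b c : R,
  ~~ [&& a == 0, b == 0 & c == 0] /\
  forall i, a * cval c1 i + b * cval c2 i + c * cval c3 i = 0.
Proof.
case: c1 c2 c3 => [x1 y1] [x2 y2] [x3 y3]; rewrite /cval /=.
set a := x2 * y3 - x3 * y2; set b := x3 * y1 - x1 * y3.
set c := x1 * y2 - x2 * y1.
have [/and3P[/eqP a0 /eqP b0 /eqP c0]|] := boolP [&& a == 0, b == 0 & c == 0];
  last first.
  by exists a, b, c; split=> // k; rewrite /a /b /c; ring.
(* three pairwise parallel covectors: two of them are already dependent *)
have [/eqP x10|x10] := boolP (x1 == 0); last first.
  exists (- x2), x1, 0; rewrite (negPf x10) andbF; split=> // i.
  transitivity (c * q i); last by rewrite c0 mul0r.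
  by rewrite /c; ring.
have [/eqP y10|y10] := boolP (y1 == 0); last first.
  exists (- y2), y1, 0; rewrite (negPf y10) andbF; split=> // i.
  transitivity (- c * p i); last by rewrite c0 oppr0 mul0r.
  by rewrite /c; ring.
by exists 1, 0, 0; rewrite oner_eq0 x10 y10; split=> // i; ring.
Qed.

(** Covectors that vanish at a common nonzero vector are proportional. *)
Lemma cval_minor c1 c2 x : cval c1 x = 0 -> cval c2 x = 0 -> ~~ zero_vec x ->
  forall k l, cval c1 k * cval c2 l = cval c1 l * cval c2 k.
Proof.
case: c1 c2 => [x1 y1] [x2 y2]; rewrite /cval /zero_vec /= negb_and.
move=> e1 e2 nz k l.
have d0 : x1 * y2 - x2 * y1 = 0.
  case/orP: nz => nz; apply: (mulIf nz); rewrite mul0r.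
    have : y2 * (x1 * p x + y1 * q x) - y1 * (x2 * p x + y2 * q x) = 0.
      by rewrite e1 e2; ring.
    by move=> <-; ring.
  have : x1 * (x2 * p x + y2 * q x) - x2 * (x1 * p x + y1 * q x) = 0.
    by rewrite e1 e2; ring.
  by move=> <-; ring.
apply/eqP; rewrite -subr_eq0; apply/eqP.
transitivity ((x1 * y2 - x2 * y1) * (p k * q l - p l * q k)); first by ring.
by rewrite d0 mul0r.
Qed.

Lemma cval_zero c x : zero_vec x -> cval c x = 0.
Proof. by move=> /andP[/eqP px /eqP qx]; rewrite /cval px qx; ring. Qed.

Lemma cval_opp c i : cval (- c.1, - c.2) i = - cval c i.
Proof. by rewrite /cval /=; ring. Qed.

Lemma cval_scale k c i : cval (k * c.1, k * c.2) i = k * cval c i.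
Proof. by rewrite /cval /=; ring. Qed.

Lemma third_coef_ge0 (a b c x y z : R) : a * x + b * y + c * z = 0 ->
  0 <= x -> 0 <= y -> z < 0 -> 0 <= a -> 0 <= b -> 0 <= c.
Proof.
move=> e x0 y0 z0 a0 b0; rewrite leNgt; apply/negP => c0.
have := mulr_ge0 a0 x0; have := mulr_ge0 b0 y0.
have : 0 < c * z by rewrite nmulr_rgt0.
lra.
Qed.

Definition dependency (c1 c2 c3 : R * R) (a b c : R) : Prop :=
  forall i, a * cval c1 i + b * cval c2 i + c * cval c3 i = 0.

(** Two of the three coefficients have the same sign; the hypotheses propagate
    this sign to the third, and the dependency may be negated. *)
Lemma cval_dep_nonneg c1 c2 c3 :
  (forall a b c, dependency c1 c2 c3 a b c -> 0 <= a -> 0 <= b -> 0 <= c) ->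
  (forall a b c, dependency c1 c2 c3 a b c -> 0 <= a -> 0 <= c -> 0 <= b) ->
  (forall a b c, dependency c1 c2 c3 a b c -> 0 <= b -> 0 <= c -> 0 <= a) ->
  exists a b c, [/\ 0 <= a, 0 <= b, 0 <= c,
    ~~ [&& a == 0, b == 0 & c == 0] & dependency c1 c2 c3 a b c].
Proof.
move=> H3 H2 H1; have [a [b [c [nz e]]]] := cval_dep c1 c2 c3.
have e' : dependency c1 c2 c3 (- a) (- b) (- c).
  by move=> i; rewrite !mulNr -!opprD e oppr0.
have Hp := (H3 _ _ _ e, H2 _ _ _ e, H1 _ _ _ e).
have := (H3 _ _ _ e', H2 _ _ _ e', H1 _ _ _ e'); rewrite !oppr_ge0 => Hn.
have [pos|neg] : [&& 0 <= a, 0 <= b & 0 <= c] \/ [&& a <= 0, b <= 0 & c <= 0].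
  have := le_total 0 a; have := le_total 0 b; have := le_total 0 c.
  move=> /orP[] hc /orP[] hb /orP[] ha.
  - by left; rewrite ha hb hc.
  - by left; rewrite hb hc Hp.
  - by left; rewrite ha hc Hp.
  - by right; rewrite ha hb Hn.
  - by left; rewrite ha hb Hp.
  - by right; rewrite ha hc Hn.
  - by right; rewrite hb hc Hn.
  - by right; rewrite ha hb hc.
- by exists a, b, c; case/and3P: pos.
by exists (- a), (- b), (- c); rewrite !oppr_eq0 !oppr_ge0; case/and3P: neg.
Qed.

Lemma cval_dep_nonneg_at c1 c2 c3 x y z :
  cval c1 x < 0 -> cval c2 y < 0 -> cval c3 z < 0 ->
  [/\ 0 <= cval c2 x, 0 <= cval c3 x & 0 <= cval c1 y] ->
  [/\ 0 <= cval c3 y, 0 <= cval c1 z & 0 <= cval c2 z] ->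
  exists a b c, [/\ 0 <= a, 0 <= b, 0 <= c,
    ~~ [&& a == 0, b == 0 & c == 0] & dependency c1 c2 c3 a b c].
Proof.
move=> h1 h2 h3 [h4 h5 h6] [h7 h8 h9]; apply: cval_dep_nonneg => a b c e.
- exact: third_coef_ge0 (e z) h8 h9 h3.
- by move: (e y); rewrite addrAC => ey; exact: third_coef_ge0 ey h6 h7 h2.
- by move: (e x); rewrite -addrA addrC => ey; exact: third_coef_ge0 ey h4 h5 h1.
Qed.

Lemma nonneg_sum_terms0 (a b c x y z : R) : a * x + b * y + c * z = 0 ->
  0 <= a -> 0 <= b -> 0 <= c -> 0 <= x -> 0 <= y -> 0 <= z ->
  [/\ a * x = 0, b * y = 0 & c * z = 0].
Proof.
move=> e a0 b0 c0 x0 y0 z0.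
have := mulr_ge0 a0 x0; have := mulr_ge0 b0 y0; have := mulr_ge0 c0 z0.
by split; lra.
Qed.

(** Each of a, b, c is cut off by one of the three covectors only, so the
    coefficients of a dependency have the same sign; but then the dependency
    fails at v, where all three covectors are negative. *)
Lemma nonadj_deg2 v a b c : a != b -> b != c -> a != c ->
  nonadj v a -> nonadj v b -> nonadj v c -> False.
Proof.
move=> ab bc ac /nonadjP[va [f1 [f1v f1a f1k]]] /nonadjP[vb [f2 [f2v f2b f2k]]].
move=> /nonadjP[vc [f3 [f3v f3c f3k]]].
have [|||||x [y [z [x0 y0 z0 nz e]]]] := @cval_dep_nonneg_at f1 f2 f3 a b c => //.
- by split; [apply: f2k | apply: f3k | apply: f1k]; rewrite // eq_sym.
- by split; [apply: f3k | apply: f1k | apply: f2k]; rewrite // eq_sym.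
have ev : x * - cval f1 v + y * - cval f2 v + z * - cval f3 v = 0.
  by rewrite !mulrN -!opprD e oppr0.
have [||| /eqP h1 /eqP h2 /eqP h3] := nonneg_sum_terms0 ev x0 y0 z0;
  rewrite ?oppr_ge0 ?ltW //.
move: nz h1 h2 h3.
rewrite !mulf_eq0 !oppr_eq0 (lt_eqF f1v) (lt_eqF f2v) (lt_eqF f3v) !orbF.
by move=> nz h1 h2 h3; rewrite h1 h2 h3 in nz.
Qed.

(** The covectors of two nonadjacent pairs that share a vertex are linearly
    independent, since they have the same sign at v and not at u. *)
Lemma cuts_adjacent_zero c1 c2 u v w x : u != v -> u != w ->
  cuts c1 u v -> cuts c2 v w -> cval c1 x = 0 -> cval c2 x = 0 -> zero_vec x.
Proof.
move=> uv uw [c1u c1v _] [c2v _ c2k] e1 e2; apply/negPn/negP => nz.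
have E := cval_minor e1 e2 nz u v.
have lt1 : 0 < cval c1 u * cval c2 v by rewrite nmulr_rgt0.
have : cval c1 v * cval c2 u <= 0.
  by apply: mulr_le0_ge0; [exact: ltW | exact: c2k].
lra.
Qed.

Lemma cuts_sym c i j : cuts c i j -> cuts c j i.
Proof. by move=> [ci cj ck]; split=> // k kj ki; apply: ck. Qed.

(** If the third coefficient were negative, all terms at v would be
    nonpositive, so the first two coefficients would vanish, and so would the
    third one, by evaluation at w. *)
Lemma dependency_between c1 c2 c3 w v : cval c3 w < 0 ->
  cval c1 v < 0 -> cval c2 v < 0 -> 0 <= cval c3 v ->
  forall a b c, dependency c1 c2 c3 a b c -> 0 <= a -> 0 <= b -> 0 <= c.
Proof.
move=> w3 v1 v2 v3 a b c e a0 b0; rewrite leNgt; apply/negP => c0.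
have e' : a * - cval c1 v + b * - cval c2 v + - c * cval c3 v = 0.
  by rewrite !(mulrN, mulNr) -!opprD e oppr0.
have [||||||/eqP h1 /eqP h2 _] := nonneg_sum_terms0 e' => //; rewrite ?oppr_ge0 ?ltW //.
move: h1 h2; rewrite !mulf_eq0 !oppr_eq0 (lt_eqF v1) (lt_eqF v2) !orbF.
move=> /eqP h1 /eqP h2; have := e w; rewrite h1 h2 !mul0r !add0r => /eqP.
by rewrite mulf_eq0 (lt_eqF w3) (lt_eqF c0).
Qed.

Lemma dependency_perm c1 c2 c3 a b c : dependency c1 c2 c3 a b c -> dependency c1 c3 c2 a c b.
Proof. by move=> e i; rewrite addrAC. Qed.

Lemma dependency_rot c1 c2 c3 a b c : dependency c1 c2 c3 a b c -> dependency c2 c3 c1 b c a.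
Proof. by move=> e i; rewrite addrC addrA. Qed.

Hypothesis bal : balanced.

(** The opposite covector would be negative at k only. *)
Lemma cuts_zero_outside_three c i j k : cuts c i j ->
  (forall x, x != i -> x != j -> x != k -> cval c x = 0) -> False.
Proof.
move=> [ci cj _] out.
have [|u [v [uv]]] := bal (c := (- c.1, - c.2)).
  by exists i; rewrite cval_opp oppr_eq0 (lt_eqF ci).
rewrite !cval_opp !oppr_lt0 => cu cv.
have only x : 0 < cval c x -> x = k.
  move=> cx; apply/eqP/negPn/negP => xk; move: cx.
  have [->|xi] := eqVneq x i; first by rewrite ltNge ltW.
  have [->|xj] := eqVneq x j; first by rewrite ltNge ltW.
  by rewrite out // ltxx.
by rewrite (only u cu) (only v cv) eqxx in uv.
Qed.

(** A dependency with nonnegative coefficients makes one of the three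
    covectors vanish outside the triangle. *)
Lemma nonadj_triangle u v w : nonadj u v -> nonadj v w -> nonadj u w -> False.
Proof.
move=> /nonadjP[uv [f1 F1]] /nonadjP[vw [f2 F2]] /nonadjP[uw [f3 F3]].
have [f1u f1v f1k] := F1; have [f2v f2w f2k] := F2; have [f3u f3w f3k] := F3.
have f3v : 0 <= cval f3 v by apply: f3k; rewrite // eq_sym.
have f2u : 0 <= cval f2 u by apply: f2k.
have f1w : 0 <= cval f1 w by apply: f1k; rewrite eq_sym.
have [||| a [b [c [a0 b0 c0 nz e]]]] := @cval_dep_nonneg f1 f2 f3.
- exact: (dependency_between f3u f1v f2v f3v).
- move=> a b c /dependency_perm; exact: (dependency_between f2v f1u f3u f2u).
- move=> a b c /dependency_rot; exact: (dependency_between f1v f2w f3w f1w).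
have out x : x != u -> x != v -> x != w ->
    [/\ a * cval f1 x = 0, b * cval f2 x = 0 & c * cval f3 x = 0].
  by move=> xu xv xw; apply: nonneg_sum_terms0 => //; auto.
have [z|a1] := eqVneq a 0; last first.
  apply: (cuts_zero_outside_three F1 (k := w)) => x xu xv xw.
  by have [/eqP + _ _] := out x xu xv xw; rewrite mulf_eq0 (negPf a1) => /eqP.
have [z'|b1] := eqVneq b 0; last first.
  apply: (cuts_zero_outside_three F2 (k := u)) => x xv xw xu.
  by have [_ /eqP + _] := out x xu xv xw; rewrite mulf_eq0 (negPf b1) => /eqP.
apply: (cuts_zero_outside_three F3 (k := v)) => x xu xw xv.
have [_ _ /eqP] := out x xu xv xw; rewrite mulf_eq0.
by move: nz; rewrite z z' eqxx /= => /negPf -> /eqP.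
Qed.

(** The dependency between the covectors of the edges 12, 34 and 51 has
    nonnegative coefficients, and the one of the edge 34 cannot vanish because
    the other two covectors are both negative at v1. *)
Lemma pentagon_cval c12 c34 c51 v1 v2 v3 v4 v5 x :
  uniq [:: v1; v2; v3; v4; v5] -> x \notin [:: v1; v2; v3; v4; v5] ->
  cuts c12 v1 v2 -> cuts c34 v3 v4 -> cuts c51 v5 v1 -> cval c34 x = 0.
Proof.
rewrite /= !inE !negb_or andbT -!andbA.
move=> /and5P[n12 n13 n14 n15 /and5P[n23 n24 n25 n34 /andP[n35 n45]]].
move=> /and5P[x1 x2 x3 x4 x5] [f1 f2 fk] [g3 g4 gk] [h5 h1 hk].
have [||| a [b [c [a0 b0 c0 nz e]]]] := @cval_dep_nonneg c12 c34 c51.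
- move=> a b c e; apply: third_coef_ge0 (e v5) _ _ h5.
    by apply: fk; rewrite eq_sym.
  by apply: gk; rewrite eq_sym.
- move=> a b c /dependency_perm; apply: (dependency_between g3 f1 h1); exact: gk.
- move=> a b c /dependency_rot e; apply: third_coef_ge0 (e v2) _ _ f2; first exact: gk.
  by apply: hk; rewrite // eq_sym.
have [_ gx _] : [/\ a * cval c12 x = 0, b * cval c34 x = 0 & c * cval c51 x = 0].
  by apply: nonneg_sum_terms0 => //; auto.
have [b1|b1] := eqVneq b 0; last by move/eqP: gx; rewrite mulf_eq0 (negPf b1) => /eqP.
have := e v1; rewrite b1 mul0r addr0.
have := mulr_ge0_le0 a0 (ltW f1); have := mulr_ge0_le0 c0 (ltW h1) => l1 l2 E.
have /eqP : a * cval c12 v1 = 0 by lra.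
have /eqP : c * cval c51 v1 = 0 by lra.
rewrite !mulf_eq0 (lt_eqF f1) (lt_eqF h1) !orbF => c1 a1.
by rewrite a1 b1 c1 eqxx in nz.
Qed.

Lemma pentagon_zero v1 v2 v3 v4 v5 x : uniq [:: v1; v2; v3; v4; v5] ->
  nonadj v1 v2 -> nonadj v2 v3 -> nonadj v3 v4 -> nonadj v4 v5 ->
  nonadj v5 v1 -> x \notin [:: v1; v2; v3; v4; v5] -> zero_vec x.
Proof.
move=> U /nonadjP[_ [f1 F1]] /nonadjP[n23 [f2 F2]] /nonadjP[n34 [f3 F3]].
move=> /nonadjP[n45 [f4 F4]] /nonadjP[n51 [f5 F5]] xo.
have e3 : cval f3 x = 0 by exact: (pentagon_cval U xo F1 F3 F5).
have e4 : cval f4 x = 0.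
  have U' : uniq (rot 1 [:: v1; v2; v3; v4; v5]) by rewrite rot_uniq.
  have xo' : x \notin rot 1 [:: v1; v2; v3; v4; v5] by rewrite mem_rot.
  exact: (pentagon_cval U' xo' F2 F4 F1).
apply: (cuts_adjacent_zero n34 _ F3 F4 e3 e4).
by move: U; rewrite /= !inE !negb_or -!andbA => /and5P[_ _ _ _ /and5P[_ _ _ _ /and3P[]]].
Qed.

(** The sign of a is free: it is negative when c12 lies between c23 and c41
    in the pencil of covectors. *)
Lemma square_dependency c12 c23 c41 v1 v2 v3 v4 : uniq [:: v1; v2; v3; v4] ->
  cuts c12 v1 v2 -> cuts c23 v2 v3 -> cuts c41 v4 v1 ->
  exists a b c, [/\ 0 < b, 0 < c & dependency c12 c23 c41 a b c].
Proof.
rewrite /= !inE !negb_or andbT -!andbA => /and5P[n12 n13 n14 n23 /andP[n24 n34]].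
move=> [f1 f2 fk] [g2 g3 gk] [h4 h1 hk].
have g1 : 0 <= cval c23 v1 by apply: gk.
have h2 : 0 <= cval c41 v2 by apply: hk; rewrite // eq_sym.
have h3 : 0 <= cval c41 v3 by apply: hk; rewrite // eq_sym.
have f3 : 0 <= cval c12 v3 by apply: fk; rewrite eq_sym.
have f4 : 0 <= cval c12 v4 by apply: fk; rewrite eq_sym.
have [a [b [c [nz e]]]] := cval_dep c12 c23 c41.
wlog b0 : a b c nz e / 0 <= b.
  move=> W; have [b0|b0] := leP 0 b; first exact: (W a b c).
  apply: (W (- a) (- b) (- c)); rewrite ?oppr_eq0 ?oppr_ge0 ?ltW //.
  by move=> i; rewrite !mulNr -!opprD e oppr0.
have e1 := e v1; have e2 := e v2; have e4 := e v4.
have c0 : 0 <= c.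
  rewrite leNgt; apply/negP => c0.
  have hc1 : 0 < c * cval c41 v1 by rewrite nmulr_rgt0.
  have hb1 := mulr_ge0 b0 g1.
  have [a0|a0] := leP a 0.
    by have := mulr_le0 a0 (ltW f1); lra.
  have ha2 : a * cval c12 v2 < 0 by rewrite pmulr_rlt0.
  have := mulr_ge0_le0 b0 (ltW g2); have := mulr_le0_ge0 (ltW c0) h2; lra.
have [a0|a0] := leP 0 a.
  have pos0 : 0 < b -> 0 < c -> exists a b c, [/\ 0 < b, 0 < c & dependency c12 c23 c41 a b c].
    by move=> b1 c1; exists a, b, c.
  have la1 := mulr_ge0_le0 a0 (ltW f1); have la2 := mulr_ge0_le0 a0 (ltW f2).
  have lb1 := mulr_ge0 b0 g1; have lb2 := mulr_ge0_le0 b0 (ltW g2).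
  have lc1 := mulr_ge0_le0 c0 (ltW h1); have lc2 := mulr_ge0 c0 h2.
  have [b1|] := eqVneq b 0.
    rewrite b1 !mul0r in e1 lb1.
    have /eqP : a * cval c12 v1 = 0 by lra.
    have /eqP : c * cval c41 v1 = 0 by lra.
    rewrite !mulf_eq0 (lt_eqF f1) (lt_eqF h1) !orbF => c1 a1.
    by rewrite a1 b1 c1 eqxx in nz.
  have [c1|] := eqVneq c 0.
    rewrite c1 !mul0r in e2 lc2.
    have /eqP : a * cval c12 v2 = 0 by lra.
    have /eqP : b * cval c23 v2 = 0 by lra.
    rewrite !mulf_eq0 (lt_eqF f2) (lt_eqF g2) !orbF => b1 a1.
    by rewrite a1 b1 c1 eqxx in nz.
  by move=> c1 b1; apply: pos0; rewrite lt_neqAle eq_sym ?c1 ?b1.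
have la1 : 0 < a * cval c12 v1 by rewrite nmulr_rgt0.
have la2 : 0 < a * cval c12 v2 by rewrite nmulr_rgt0.
exists a, b, c; split=> //; rewrite lt_neqAle eq_sym ?b0 ?c0 andbT;
  apply/eqP => z; rewrite z !mul0r in e1 e2.
  have := mulr_ge0 c0 h2; lra.
have := mulr_ge0 b0 g1; lra.
Qed.

(** Unless c12 and c34, the covectors of two opposite edges, both lie strictly
    inside the cone spanned by c23 and c41, one of the dependencies of
    [square_dependency] has nonnegative coefficients.  They cannot both lie
    there, because of their signs at v1 and v2. *)
Lemma square_cval c12 c23 c34 c41 v1 v2 v3 v4 x : uniq [:: v1; v2; v3; v4] ->
  cuts c12 v1 v2 -> cuts c23 v2 v3 -> cuts c34 v3 v4 -> cuts c41 v4 v1 ->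
  x \notin [:: v1; v2; v3; v4] -> cval c23 x = 0.
Proof.
move=> U F1 F2 F3 F4.
have [a [b [c [b0 c0 e]]]] := square_dependency U F1 F2 F4.
have [a' [b' [c' [b0' c0' e']]]] : exists a b c,
    [/\ 0 < b, 0 < c & dependency c34 c23 c41 a b c].
  apply: (@square_dependency c34 c23 c41 v4 v3 v2 v1); last exact: cuts_sym.
  - by rewrite -rev_uniq.
  - exact: cuts_sym.
  - exact: cuts_sym.
move: U; rewrite /= !inE !negb_or andbT -!andbA.
move=> /and5P[n12 n13 n14 n23 /andP[n24 n34]] /and4P[x1 x2 x3 x4].
have [[f1 f2 fk] [g2 g3 gk]] := (F1, F2).
have [[k3 k4 kk] [h4 h1 hk]] := (F3, F4).
have fx : 0 <= cval c12 x by apply: fk.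
have gx : 0 <= cval c23 x by apply: gk.
have kx : 0 <= cval c34 x by apply: kk.
have hx : 0 <= cval c41 x by apply: hk.
have conc a1 b1 c1 y : 0 <= a1 -> 0 < b1 -> 0 < c1 -> 0 <= y ->
    a1 * y + b1 * cval c23 x + c1 * cval c41 x = 0 -> cval c23 x = 0.
  move=> a1p b1p c1p yp E.
  have [//|//||//|//|//|_ /eqP + _] := nonneg_sum_terms0 E; try exact: ltW.
  by rewrite mulf_eq0 (gt_eqF b1p) => /eqP.
have [a0|a0] := leP 0 a; first exact: conc a0 b0 c0 fx (e x).
have [a0'|a0'] := leP 0 a'; first exact: conc a0' b0' c0' kx (e' x).
(* both dependencies have a negative first coefficient *)
exfalso.
have g1 : 0 <= cval c23 v1 by apply: gk.
have h2 : 0 <= cval c41 v2 by apply: hk; rewrite // eq_sym.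
have k1 : 0 <= cval c34 v1 by apply: kk.
have k2 : 0 <= cval c34 v2 by apply: kk.
have E1 := e v1; have E2 := e v2; have E1' := e' v1; have E2' := e' v2.
have P1 : 0 < a * cval c12 v1 by rewrite nmulr_rgt0.
have P2 : 0 < a * cval c12 v2 by rewrite nmulr_rgt0.
have P1' : a' * cval c34 v1 <= 0 by rewrite mulr_le0_ge0 // ltW.
have P2' : a' * cval c34 v2 <= 0 by rewrite mulr_le0_ge0 // ltW.
have Q1 : b * cval c23 v1 < c * - cval c41 v1 by lra.
have Q2 : c * cval c41 v2 < b * - cval c23 v2 by lra.
have Q1' : c' * - cval c41 v1 <= b' * cval c23 v1 by lra.
have Q2' : b' * - cval c23 v2 <= c' * cval c41 v2 by lra.
have S1 : b * c' < b' * c.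
  rewrite -(ltr_pM2r (x := - cval c41 v1)) ?oppr_gt0 //.
  rewrite -!mulrA; apply: le_lt_trans (_ : b * (b' * cval c23 v1) < _).
    by rewrite ler_pM2l.
  by rewrite mulrCA ltr_pM2l.
have S2 : c * b' < c' * b.
  rewrite -(ltr_pM2r (x := - cval c23 v2)) ?oppr_gt0 //.
  rewrite -!mulrA; apply: le_lt_trans (_ : c * (c' * cval c41 v2) < _).
    by rewrite ler_pM2l.
  by rewrite mulrCA ltr_pM2l.
lra.
Qed.

(** All vectors outside the 4-cycle vanish, so too few vectors are left for a
    line through one of them to have two on either side. *)
Lemma nonadj_square v1 v2 v3 v4 : uniq [:: v1; v2; v3; v4] ->
  nonadj v1 v2 -> nonadj v2 v3 -> nonadj v3 v4 -> nonadj v4 v1 -> False.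
Proof.
move=> U /nonadjP[_ [f1 F1]] /nonadjP[n23 [f2 F2]] /nonadjP[n34 [f3 F3]].
move=> /nonadjP[n41 [f4 F4]].
have out x : x \notin [:: v1; v2; v3; v4] -> zero_vec x.
  move=> xo; have n24 : v2 != v4.
    by move: U; rewrite /= !inE !negb_or -!andbA => /and5P[_ _ _ _ /andP[]].
  apply: (cuts_adjacent_zero n23 n24 F2 F3).
    exact: (square_cval U F1 F2 F3 F4 xo).
  have U' : uniq (rot 1 [:: v1; v2; v3; v4]) by rewrite rot_uniq.
  have xo' : x \notin rot 1 [:: v1; v2; v3; v4] by rewrite mem_rot.
  exact: (square_cval U' F2 F3 F4 F1 xo').
(* a covector vanishing at v1 sees only three vectors off its line *)
pose c := (q v1, - p v1).
have c1 : cval c v1 = 0 by rewrite /cval /c /=; ring.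
have sup x : cval c x != 0 -> x \in [:: v2; v3; v4].
  move=> cx; have : x \in [:: v1; v2; v3; v4].
    by apply/negPn/negP => /out/(cval_zero c)/eqP; rewrite (negPf cx).
  by rewrite inE; case/orP => // /eqP xv; rewrite xv c1 eqxx in cx.
have nzc : exists i, cval c i != 0.
  exists v2; apply/eqP => E.
  have [[f11 f12 _] [g2 _ gk]] := (F1, F2).
  have [n12 n13] : v1 != v2 /\ v1 != v3.
    by move: U; rewrite /= !inE !negb_or -!andbA => /and3P[].
  have g1 : 0 <= cval f2 v1 by apply: gk.
  have : cval f1 v1 * cval f2 v2 - cval f1 v2 * cval f2 v1
      = (f1.2 * f2.1 - f1.1 * f2.2) * cval c v2.
    by rewrite /cval /c /=; ring.
  rewrite E mulr0; have : 0 < cval f1 v1 * cval f2 v2 by rewrite nmulr_rgt0.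
  have := mulr_le0_ge0 (ltW f12) g1; lra.
have nzc' : exists i, cval (- c.1, - c.2) i != 0.
  by have [i ci] := nzc; exists i; rewrite cval_opp oppr_eq0.
have [i1 [i2 [i12 l1 l2]]] := bal nzc.
have [i3 [i4 [i34]]] := bal nzc'.
rewrite !cval_opp !oppr_lt0 => l3 l4.
have U4 : uniq [:: i1; i2; i3; i4].
  rewrite /= !inE !negb_or i12 i34 !andbT /=.
  have ne i j : cval c i < 0 -> 0 < cval c j -> i != j.
    by move=> li lj; apply: contraTneq li => ->; rewrite -leNgt ltW.
  by rewrite !ne.
have sub : {subset [:: i1; i2; i3; i4] <= [:: v2; v3; v4]}.
  move=> i i4in; apply: sup; move: i4in; rewrite !inE => /or4P[] /eqP ->;
    by rewrite ?(lt_eqF l1) ?(lt_eqF l2) ?(gt_eqF l3) ?(gt_eqF l4).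
by have := uniq_leq_size U4 sub.
Qed.

(** Excludes pairs of parallel vectors, which are nonadjacent to each other
    and to nothing else. *)
Definition extendable (u v : I) : Prop :=
  exists x y, [/\ (x == u) && (y != v) || (x == v) && (y != u) & nonadj x y].

(** If w = 0, the covector f vanishes at c1 and c2.  The vectors of c1 and c2
    are then parallel, and no half-plane separates one from the other. *)
Lemma matching_gt0 a1 a2 b1 b2 c1 c2 f g h u v w :
  uniq [:: a1; a2; b1; b2; c1; c2] -> extendable c1 c2 ->
  cuts f a1 a2 -> cuts g b1 b2 -> cuts h c1 c2 ->
  0 <= u -> 0 <= v -> 0 <= w -> ~~ [&& u == 0, v == 0 & w == 0] ->
  dependency f g h u v w -> 0 < w.
Proof.
move=> U [s [t [sc st]]] F G K u0 v0 w0 nz e.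
rewrite lt_neqAle eq_sym w0 andbT; apply/eqP => w1.
move: U; rewrite /= !inE !negb_or andbT -!andbA.
move=> /and5P[n1 n2 n3 n4 /and5P[n5 n6 n7 n8 /and5P[n9 n10 n11 n12 /and3P[n13 n14 n15]]]].
have [[f1 f2 fk] [g1 g2 gk] [h1 h2 hk]] := And3 F G K.
have u1 : u != 0.
  apply/eqP => u1; have := e b1; rewrite u1 w1 !mul0r addr0 add0r => /eqP.
  rewrite mulf_eq0 (lt_eqF g1) orbF => v1.
  by rewrite u1 w1 v1 eqxx in nz.
have fz x : x \in [:: c1; c2] -> cval f x = 0.
  move=> xc; have E := e x.
  have [ha1 ha2 hb1 hb2] : [/\ x != a1, x != a2, x != b1 & x != b2].
    by move: xc; rewrite !inE => /orP[] /eqP ->; split; rewrite eq_sym.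
  have [] := nonneg_sum_terms0 (z := 0) (c := 0) _ u0 v0 _ (fk x ha1 ha2) (gk x hb1 hb2) _ => //.
    by rewrite mulr0 -[RHS]E w1 mul0r.
  by move=> /eqP; rewrite mulf_eq0 (negPf u1) => /eqP.
have [nst [k [ks kt kk]]] := nonadjP st.
(* restricted to c1 and c2, where f vanishes, k is a multiple of h *)
have [x [y [z [nz' e']]]] := cval_dep f h k.
have E1 := e' c1; have E2 := e' c2.
rewrite (fz c1) ?inE ?eqxx // in E1; rewrite (fz c2) ?inE ?eqxx ?orbT // in E2.
rewrite !mulr0 !add0r in E1 E2.
have key kc kd hc hd : y * hc + z * kc = 0 -> y * hd + z * kd = 0 ->
    hc < 0 -> hd < 0 -> kc < 0 -> 0 <= kd -> False.
  move=> e1 e2 hc0 hd0 kc0 kd0.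
  have d0 : z * (kc * hd - kd * hc) = 0.
    transitivity (hd * (y * hc + z * kc) - hc * (y * hd + z * kd)); first by ring.
    by rewrite e1 e2; ring.
  have p1 : 0 < kc * hd by rewrite nmulr_rgt0.
  have p2 : kd * hc <= 0 by rewrite mulr_ge0_le0 // ltW.
  have z0 : z = 0.
    by move/eqP: d0; rewrite mulf_eq0 => /orP[/eqP //|/eqP]; lra.
  have y0 : y = 0.
    move/eqP: e1; rewrite z0 mul0r addr0 mulf_eq0 (lt_eqF hc0) orbF.
    by move/eqP.
  have /eqP := e' a1; rewrite z0 y0 !mul0r !addr0 mulf_eq0 (lt_eqF f1) orbF.
  by move=> x0; rewrite x0 y0 z0 eqxx in nz'.
case/orP: sc => /andP[/eqP es ts].
  subst s; apply: (key _ _ _ _ E1 E2) => //.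
  by apply: kk; rewrite eq_sym //.
subst s; apply: (key _ _ _ _ E2 E1) => //.
by apply: kk; rewrite // eq_sym.
Qed.

Lemma matching_dependency a1 a2 b1 b2 c1 c2 f g h :
  uniq [:: a1; a2; b1; b2; c1; c2] ->
  extendable a1 a2 -> extendable b1 b2 -> extendable c1 c2 ->
  cuts f a1 a2 -> cuts g b1 b2 -> cuts h c1 c2 ->
  exists u v w, [/\ 0 < u, 0 < v, 0 < w & dependency f g h u v w].
Proof.
move=> U ea eb ec F G K.
have [[f1 f2 fk] [g1 g2 gk] [h1 h2 hk]] := And3 F G K.
have := U; rewrite /= !inE !negb_or andbT -!andbA.
move=> /and5P[n1 n2 n3 n4 /and5P[n5 n6 n7 n8 /and5P[n9 n10 n11 n12 /and3P[n13 n14 n15]]]].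
have [|||||u [v [w [u0 v0 w0 nz e]]]] := @cval_dep_nonneg_at f g h a1 b1 c1 => //.
- by split; [apply: gk | apply: hk | apply: fk]; rewrite // eq_sym.
- by split; [apply: hk | apply: fk | apply: gk]; rewrite // eq_sym.
exists u, v, w; split=> //.
- have U' : uniq (rot 2 [:: a1; a2; b1; b2; c1; c2]) by rewrite rot_uniq.
  apply: (matching_gt0 U' ea G K F v0 w0 u0 _ (dependency_rot e)).
  by apply: contra nz => /and3P[-> -> ->].
- have U' : uniq (rot 4 [:: a1; a2; b1; b2; c1; c2]) by rewrite rot_uniq.
  apply: (matching_gt0 U' eb K F G w0 u0 v0 _ (dependency_rot (dependency_rot e))).
  by apply: contra nz => /and3P[-> -> ->].
- exact: (matching_gt0 U ec F G K u0 v0 w0 nz e).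
Qed.

Lemma matching_zero a1 a2 b1 b2 c1 c2 x :
  uniq [:: a1; a2; b1; b2; c1; c2] ->
  extendable a1 a2 -> extendable b1 b2 -> extendable c1 c2 ->
  nonadj a1 a2 -> nonadj b1 b2 -> nonadj c1 c2 ->
  x \notin [:: a1; a2; b1; b2; c1; c2] -> zero_vec x.
Proof.
move=> U ea eb ec /nonadjP[n12 [f F]] /nonadjP[_ [g G]] /nonadjP[_ [h K]] xo.
have [u [v [w [u0 v0 w0 e]]]] := matching_dependency U ea eb ec F G K.
move: xo; rewrite !inE !negb_or => /and5P[xa1 xa2 xb1 xb2 /andP[xc1 xc2]].
have [[f1 f2 fk] [g1 g2 gk] [h1 h2 hk]] := And3 F G K.
have [/eqP + /eqP + _] := nonneg_sum_terms0 (e x) (ltW u0) (ltW v0) (ltW w0)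
  (fk x xa1 xa2) (gk x xb1 xb2) (hk x xc1 xc2).
rewrite !mulf_eq0 (gt_eqF u0) (gt_eqF v0) /= => /eqP fx /eqP gx.
apply/negPn/negP => nz.
(* f and g vanish together, so they are proportional, with a negative ratio;
   the dependency then forces h to vanish at c1 *)
have M := cval_minor fx gx nz.
move: U; rewrite /= !inE !negb_or andbT -!andbA.
move=> /and5P[_ n2 n3 n4 /and5P[n5 n6 n7 n8 /and5P[n9 n10 n11 n12' /and3P[n13 n14 n15]]]].
have fc : 0 <= cval f c1 by apply: fk; rewrite eq_sym.
have gc : 0 <= cval g c1 by apply: gk; rewrite eq_sym.
have := M a1 c1; have ga : 0 <= cval g a1 by apply: gk.
have l1 : cval f a1 * cval g c1 <= 0 by rewrite mulr_le0_ge0 // ltW.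
have l2 := mulr_ge0 fc ga => E.
have /eqP : cval f a1 * cval g c1 = 0 by lra.
rewrite mulf_eq0 (lt_eqF f1) /= => /eqP gc0.
have fb : 0 <= cval f b1 by apply: fk; rewrite eq_sym.
have := M b1 c1; rewrite gc0 mulr0 => /esym/eqP.
rewrite mulf_eq0 (lt_eqF g1) orbF => /eqP fc0.
have := e c1; rewrite fc0 gc0 !mulr0 !add0r => /eqP.
by rewrite mulf_eq0 (gt_eqF w0) (lt_eqF h1).
Qed.

End Plane.

(** Here u_k and w_k are the values at the k-th vertex of a path of the
    covectors of its first and last edge, and a u + b w is the covector of its
    second edge.  The signs force a = 0 and b < 0: the second edge and the last
    one are cut off by opposite half-planes. *)
Lemma path_step_signs (R : realFieldType) (a b : R) (u0 w0 u1 w1 u2 w2 u3 w3 u4 w4 : R) :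
  u0 < 0 -> 0 <= w0 -> u1 < 0 -> 0 <= w1 -> 0 <= u2 -> 0 <= w2 ->
  0 <= u3 -> 0 <= w3 -> 0 < u3 + w3 -> 0 <= u4 -> w4 < 0 ->
  0 <= a * u0 + b * w0 -> a * u1 + b * w1 < 0 -> a * u2 + b * w2 < 0 ->
  0 <= a * u3 + b * w3 -> 0 <= a * u4 + b * w4 ->
  [/\ w0 = 0, w3 = 0, 0 < w1 & 0 < w2].
Proof.
move=> u0n w0p u1n w1p u2p w2p u3p w3p s3 u4p w4n e0 e1 e2 e3 e4.
have [a0|a0|a0] := ltgtP a 0.
- exfalso; have h4 : a * u4 <= 0 by rewrite mulr_le0_ge0 // ltW.
  have b0 : b <= 0.
    rewrite leNgt; apply/negP => b0.
    have : b * w4 < 0 by rewrite pmulr_rlt0.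
    lra.
  have h1 : 0 < a * u1 by rewrite nmulr_rgt0.
  have b1 : b < 0.
    rewrite lt_neqAle b0 andbT; apply/eqP => bz; rewrite bz mul0r in e1; lra.
  have h3 : a * u3 <= 0 by rewrite mulr_le0_ge0 // ltW.
  have h3' : b * w3 <= 0 by rewrite mulr_le0_ge0.
  have /eqP : a * u3 = 0 by lra.
  have /eqP : b * w3 = 0 by lra.
  rewrite !mulf_eq0 (lt_eqF a0) (lt_eqF b1) /= => /eqP z /eqP z'.
  lra.
- exfalso; have h2 : 0 <= a * u2 by rewrite mulr_ge0 // ltW.
  have h0 : a * u0 < 0 by rewrite pmulr_rlt0.
  have [b0|b0] := leP 0 b.
    have := mulr_ge0 b0 w2p; lra.
  have : b * w0 <= 0 by rewrite mulr_le0_ge0 // ltW.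
  lra.
rewrite a0 !mul0r !add0r in e0 e1 e2 e3 e4.
have b0 : b < 0.
  rewrite ltNge; apply/negP => b0; have := mulr_ge0 b0 w2p; lra.
split.
- by apply/eqP; rewrite eq_le w0p andbT; rewrite nmulr_rge0 in e0.
- by apply/eqP; rewrite eq_le w3p andbT; rewrite nmulr_rge0 in e3.
- by rewrite nmulr_rlt0 in e1.
- by rewrite nmulr_rlt0 in e2.
Qed.

Section Path.
Variables (R : realFieldType) (I : finType) (p q : I -> R).
Local Notation cval := (cval p q).
Local Notation nonadj := (nonadj p q).
Local Notation cuts := (cuts p q).

Variables (p0 p1 p2 p3 p4 p5 : I).
Let pp := [:: p0; p1; p2; p3; p4; p5].
Hypothesis Upp : uniq pp.
Hypotheses (H01 : nonadj p0 p1) (H12 : nonadj p1 p2) (H23 : nonadj p2 p3)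
  (H34 : nonadj p3 p4) (H45 : nonadj p4 p5).

(** Signs of the six vectors in the coordinates (u, w): two opposite pairs on
    the axes, (p0, p3) and (p2, p5), and one vector in each of two opposite
    open quadrants, p1 and p4. *)
Record path_frame (u w : I -> R) : Prop := PathFrame {
  pf_u0 : u p0 < 0; pf_u1 : u p1 < 0; pf_u2 : u p2 = 0;
  pf_u3 : 0 < u p3; pf_u4 : 0 < u p4; pf_u5 : u p5 = 0;
  pf_w0 : w p0 = 0; pf_w1 : 0 < w p1; pf_w2 : 0 < w p2;
  pf_w3 : w p3 = 0; pf_w4 : w p4 < 0; pf_w5 : w p5 < 0;
  pf_s1 : u p1 + w p1 <= 0; pf_s4 : u p4 + w p4 <= 0;
  pf_out : forall x, x \notin pp -> u x = 0 /\ w x = 0 }.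

Lemma path_extendable : [/\ extendable p q p0 p1, extendable p q p2 p3 &
  extendable p q p4 p5].
Proof.
move: Upp; rewrite /= !inE !negb_or andbT -!andbA.
move=> /and5P[n1 n2 n3 n4 /and5P[n5 n6 n7 n8 /and5P[n9 n10 n11 n12 /and3P[n13 n14 n15]]]].
split.
- by exists p1, p2; split; rewrite // eqxx (eq_sym p2 p0) n2 orbT.
- by exists p2, p1; split; rewrite 1?nonadj_sym // eqxx n7.
- by exists p4, p3; split; rewrite 1?nonadj_sym // eqxx n14.
Qed.

Lemma path_zero x : x \notin pp -> zero_vec p q x.
Proof. by have [e1 e2 e3] := path_extendable; apply: matching_zero. Qed.

(** The coordinates are the covectors of the first and the last edge, scaled
    by the coefficients of the dependency of the matching p0p1, p2p3, p4p5, so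
    that the covector of p2p3 is a negative multiple of u + w. *)
Lemma path_frameP : exists cu cw, path_frame (cval cu) (cval cw).
Proof.
have [e1 e2 e3] := path_extendable.
have [_ [f F]] := nonadjP H01; have [_ [g G]] := nonadjP H23.
have [_ [h K]] := nonadjP H45.
have [a [b [c [a0 b0 c0 e]]]] := matching_dependency Upp e1 e2 e3 F G K.
have [_ [k1 L1]] := nonadjP H12; have [_ [k2 L2]] := nonadjP H34.
have := Upp; rewrite /= !inE !negb_or andbT -!andbA.
move=> /and5P[n01 n02 n03 n04 /and5P[n05 n12 n13 n14 /and5P[n15 n23 n24 n25 /and3P[n34 n35 n45]]]].
pose cu := (a * f.1, a * f.2); pose cw := (c * h.1, c * h.2).
have us i : cval cu i = a * cval f i by exact: cval_scale.
have ws i : cval cw i = c * cval h i by exact: cval_scale.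
have ge0u i : (0 <= cval cu i) = (0 <= cval f i) by rewrite us pmulr_rge0.
have ge0w i : (0 <= cval cw i) = (0 <= cval h i) by rewrite ws pmulr_rge0.
have lt0u i : (cval cu i < 0) = (cval f i < 0) by rewrite us pmulr_rlt0.
have lt0w i : (cval cw i < 0) = (cval h i < 0) by rewrite ws pmulr_rlt0.
have [f0 f1 fk] := F; have [g2 g3 gk] := G; have [h4 h5 hk] := K.
have [k11 k12 k1k] := L1; have [k23 k24 k2k] := L2.
have sg i : cval cu i + cval cw i = - (b * cval g i).
  by have := e i; rewrite us ws; lra.
have sle i : 0 <= cval g i -> cval cu i + cval cw i <= 0.
  by move=> gi; rewrite sg oppr_le0 mulr_ge0 // ltW.
have sgt i : cval g i < 0 -> 0 < cval cu i + cval cw i.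
  by move=> gi; rewrite sg oppr_gt0 pmulr_rlt0.
have comb k : exists x y, forall i, cval k i = x * cval cu i + y * cval cw i.
  have [x [y [z [nz E]]]] := cval_dep p q cu cw k.
  have [z0|z0] := eqVneq z 0; last first.
    exists (- x / z), (- y / z) => i; apply: (mulfI z0).
    transitivity (- (x * cval cu i + y * cval cw i)); last by field.
    by have := E i; lra.
  exfalso; move: nz; rewrite z0 eqxx andbT negb_and.
  have E' i : x * cval cu i + y * cval cw i = 0.
    by rewrite -[RHS](E i) z0 mul0r addr0.
  have u2 : 0 <= cval cu p2 by rewrite ge0u fk // eq_sym.
  have w2 : 0 <= cval cw p2 by rewrite ge0w hk.
  have u0 : cval cu p0 < 0 by rewrite lt0u.
  have w0 : 0 <= cval cw p0 by rewrite ge0w hk.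
  have w4 : cval cw p4 < 0 by rewrite lt0w.
  have u4 : 0 <= cval cu p4 by rewrite ge0u fk // eq_sym.
  have s2 := sgt p2 g2.
  have D : (cval cu p0 * cval cw p2 - cval cu p2 * cval cw p0) * x = 0.
    transitivity (cval cw p2 * (x * cval cu p0 + y * cval cw p0)
      - cval cw p0 * (x * cval cu p2 + y * cval cw p2)); first by ring.
    by rewrite !E'; ring.
  have x0 : x = 0.
    have [w20|w20] := eqVneq (cval cw p2) 0.
      have /eqP := E' p2; rewrite w20 mulr0 addr0 mulf_eq0 => /orP[/eqP //|/eqP u20].
      by rewrite w20 u20 addr0 ltxx in s2.
    apply/eqP; move/eqP: D; rewrite mulf_eq0 => /orP[/eqP D|//]; exfalso.
    have : cval cu p0 * cval cw p2 < 0 by rewrite nmulr_rlt0 // lt_neqAle eq_sym w20.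
    have := mulr_ge0 u2 w0; lra.
  have /eqP := E' p4; rewrite x0 mul0r add0r mulf_eq0 (lt_eqF w4) orbF.
  by move=> y0; rewrite eqxx y0.
have [x [y kE]] := comb k1; have [x' [y' kE']] := comb k2.
have [w0 w3 w1 w2] : [/\ cval cw p0 = 0, cval cw p3 = 0, 0 < cval cw p1 & 0 < cval cw p2].
  apply: (@path_step_signs _ x y (cval cu p0) _ (cval cu p1) _ (cval cu p2) _ (cval cu p3) _ (cval cu p4) (cval cw p4));
    rewrite -?kE ?ge0u ?ge0w ?lt0u ?lt0w //; try exact: sgt;
    try (by apply: fk; rewrite // eq_sym); try (by apply: hk; rewrite // eq_sym);
    try (by apply: k1k; rewrite // eq_sym).
have [u5 u2 u4 u3] : [/\ cval cu p5 = 0, cval cu p2 = 0, 0 < cval cu p4 & 0 < cval cu p3].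
  apply: (@path_step_signs _ y' x' (cval cw p5) _ (cval cw p4) _ (cval cw p3) _ (cval cw p2) _ (cval cw p1) (cval cu p1));
    rewrite 1?[y' * _ + _]addrC -?kE' ?ge0u ?ge0w ?lt0u ?lt0w //; try (by rewrite addrC; apply: sgt);
    try (by apply: fk; rewrite // eq_sym); try (by apply: hk; rewrite // eq_sym);
    try (by apply: k2k; rewrite // eq_sym).
exists cu, cw; split; rewrite ?lt0u ?lt0w //.
- by apply: sle; apply: gk.
- by apply: sle; apply: gk; rewrite eq_sym.
- by move=> i /path_zero iz; rewrite !cval_zero.
Qed.

End Path.

(** * The Farkas lemma *)

Section Farkas.
Variables (R : realFieldType) (n : nat).
Implicit Types (s : seq 'rV[R]_n) (b : 'rV[R]_n) (c : 'cV[R]_n).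

Fixpoint in_cone s b : Prop :=
  if s is a :: s' then exists2 t, 0 <= t & in_cone s' (b - t *: a) else b = 0.

Definition eval b c : R := (b *m c) 0 0.

Lemma evalD b b' c : eval (b + b') c = eval b c + eval b' c.
Proof. by rewrite /eval mulmxDl mxE. Qed.

Lemma evalZ k b c : eval (k *: b) c = k * eval b c.
Proof. by rewrite /eval -scalemxAl mxE. Qed.

Lemma evalB b b' c : eval (b - b') c = eval b c - eval b' c.
Proof. by rewrite /eval mulmxBl !mxE. Qed.

Lemma evalBr b c c' k : eval b (c - k *: c') = eval b c - k * eval b c'.
Proof. by rewrite /eval mulmxBr -scalemxAr !mxE. Qed.

Lemma eval_sum (J : finType) (P : pred J) (F : J -> 'rV[R]_n) c :
  eval (\sum_(j | P j) F j) c = \sum_(j | P j) eval (F j) c.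
Proof. by rewrite /eval mulmx_suml summxE. Qed.

(** Adding nonnegative multiples of a to the generators does not leave the
    cone spanned by them and a. *)
Lemma in_cone_shift s a (l : 'rV[R]_n -> R) b : (forall x, x \in s -> 0 <= l x) ->
  in_cone [seq x + l x *: a | x <- s] b ->
  exists2 t, 0 <= t & in_cone s (b - t *: a).
Proof.
elim: s b => [|x s IH] b l0 /=; first by exists 0; rewrite // scale0r subr0.
move=> [t t0 /IH[y ys|r r0 Hr]]; first by apply: l0; rewrite inE ys orbT.
have lx : 0 <= l x by apply: l0; rewrite inE eqxx.
exists (r + t * l x); first by rewrite addr_ge0 // mulr_ge0.
exists t => //.
have <- : b - t *: (x + l x *: a) - r *: a = b - (r + t * l x) *: a - t *: x.
  by apply/rowP => i; rewrite !mxE; ring.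
exact: Hr.
Qed.

Lemma farkas_seq s b : in_cone s b \/
  exists c, (forall a, a \in s -> 0 <= eval a c) /\ eval b c < 0.
Proof.
have [m] := ubnP (size s); elim: m s b => // m IH [|a s] b /= sm.
  have [->|b0] := eqVneq b 0; first by left.
  right; exists (- b^T); split=> //; rewrite /eval mulmxN mxE oppr_lt0.
  have [i bi] : exists i, b 0 i != 0 by apply/rV0Pn.
  rewrite mxE (bigD1 i) //= mxE; apply: ltr_wpDr.
    by apply: sumr_ge0 => j _; rewrite mxE -expr2 sqr_ge0.
  by rewrite lt_neqAle eq_sym mulf_neq0 //= -expr2 sqr_ge0.
have [cb|[c [cs cb]]] := IH s b sm.
  by left; exists 0; rewrite // scale0r subr0.
have [ca|ca] := leP 0 (eval a c).
  by right; exists c; split=> // x; rewrite inE => /orP[/eqP -> //|/cs].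
(* project the other vectors and b along a onto the hyperplane c = 0 *)
pose l x := - (eval x c / eval a c).
have l0 x : x \in s -> 0 <= l x.
  by move=> /cs xs; rewrite oppr_ge0 mulr_ge0_le0 // invr_le0 ltW.
have [|cone|[c' [cs' cb']]] := IH [seq x + l x *: a | x <- s] (b + l b *: a).
- by rewrite size_map.
- have [t t0 Ht] := in_cone_shift l0 cone; left; exists (t - l b).
    by rewrite addr_ge0 // opprK mulr_le0 // ?invr_le0 ltW.
  by have <- : b + l b *: a - t *: a = b - (t - l b) *: a
    by apply/rowP => i; rewrite !mxE; ring.
have ca0 : eval a c != 0 by rewrite lt_eqF.
have E x : eval (x + l x *: a) c' = eval x (c' - (eval a c' / eval a c) *: c).
  by rewrite evalD evalZ evalBr /l; field.
right; exists (c' - (eval a c' / eval a c) *: c); rewrite -E; split=> // x.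
rewrite inE => /orP[/eqP ->|xs]; last by rewrite -E; apply/cs'/mapP; exists x.
by rewrite evalBr divfK // subrr.
Qed.

Lemma in_cone_sum (J : eqType) (a : J -> 'rV[R]_n) (r : seq J) b : uniq r ->
  in_cone (map a r) b ->
  exists2 k : J -> R, (forall j, 0 <= k j) & b = \sum_(j <- r) k j *: a j.
Proof.
elim: r b => [|j r IH] b /=; first by move=> _ ->; exists (fun=> 0); rewrite ?big_nil.
move=> /andP[jr Ur] [t t0 /(IH _ Ur)[k k0 E]].
exists (fun i => if i == j then t else k i) => [i|]; first by case: ifP.
rewrite big_cons eqxx -(subrK (t *: a j) b) E addrC; congr (_ + _).
by apply: eq_big_seq => i ir; case: eqP => // ij; rewrite -ij ir in jr.
Qed.

Theorem farkas (J : finType) (C : {set J}) (a : J -> 'rV[R]_n) b :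
  (exists2 k : J -> R, (forall j, 0 <= k j) & b = \sum_(j in C) k j *: a j) \/
  exists2 c, (forall j, j \in C -> 0 <= eval (a j) c) & eval b c < 0.
Proof.
have [|[c [cs cb]]] := farkas_seq (map a (enum C)) b.
  move=> /(in_cone_sum (enum_uniq _))[k k0 E]; left; exists k => //.
  by rewrite E big_enum.
by right; exists c => // j jC; apply: cs; rewrite map_f // mem_enum.
Qed.

End Farkas.

(** * Cofaces *)

Section Coface.
Variables (R : realFieldType) (I : finType).
Implicit Types (p q : I -> R) (C : {set I}).

Definition coface p q C : Prop := exists y : I -> R,
  [/\ forall i, 0 <= y i, forall i, (0 < y i) = (i \in C),
      \sum_i y i * p i = 0 & \sum_i y i * q i = 0].

Lemma coface_val p q y c : \sum_i y i * p i = 0 -> \sum_i y i * q i = 0 ->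
  \sum_i y i * cval p q c i = 0.
Proof.
move=> Ep Eq.
transitivity (c.1 * \sum_i y i * p i + c.2 * \sum_i y i * q i).
  rewrite !mulr_sumr -big_split; apply: eq_bigr => i _; rewrite /cval /=; ring.
by rewrite Ep Eq; ring.
Qed.

Lemma cofaceU p q C C' : coface p q C -> coface p q C' -> coface p q (C :|: C').
Proof.
move=> [y [y0 yC yp yq]] [z [z0 zC zp zq]]; exists (fun i => y i + z i); split.
- by move=> i; apply: addr_ge0.
- move=> i; rewrite inE -yC -zC; apply/idP/orP => [|[h|h]].
  + rewrite !lt_neqAle !y0 !z0 addr_ge0 // !andbT ![0 == _]eq_sym.
    by rewrite paddr_eq0 // negb_and => /orP.
  + exact: ltr_wpDr.
  + exact: ltr_wpDl.
- by under eq_bigr do rewrite mulrDl; rewrite big_split /= yp zp addr0.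
- by under eq_bigr do rewrite mulrDl; rewrite big_split /= yq zq addr0.
Qed.

Lemma coface_zero_vec p q C C' :
  (forall i, ~~ zero_vec p q i -> (i \in C) = (i \in C')) ->
  coface p q C -> coface p q C'.
Proof.
move=> CC [y [y0 yC yp yq]].
pose z i := if zero_vec p q i then (i \in C')%:R else y i.
have E (f : I -> R) : (forall i, zero_vec p q i -> f i = 0) ->
    \sum_i z i * f i = \sum_i y i * f i.
  move=> f0; apply: eq_bigr => i _; rewrite /z; case: ifP => // zi.
  by rewrite f0 // !mulr0.
exists z; split.
- by move=> i; rewrite /z; case: ifP => // _; rewrite ler0n.
- move=> i; rewrite /z; case: ifP => zi; first by rewrite ltr0n lt0b.
  by rewrite yC CC // zi.
- by rewrite E // => i /andP[/eqP].
- by rewrite E // => i /andP[_ /eqP].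
Qed.

(** By the Farkas lemma, if there is no such covector then the opposite of
    every vector of C lies in the cone of C; the sum of these expressions is a
    dependency that is positive on all of C. *)
Lemma not_cofaceP p q C : ~ coface p q C ->
  exists c, (forall i, i \in C -> 0 <= cval p q c i) /\
            exists2 i, i \in C & 0 < cval p q c i.
Proof.
move=> nC; apply: contrapT => nc; apply: nC.
pose a i : 'rV[R]_2 := \row_(k < 2) (if k == 0 then p i else q i).
have evE i (c : 'cV[R]_2) : eval (a i) c = cval p q (c 0 0, c 1 0) i.
  by rewrite /eval mxE !big_ord_recl big_ord0 !mxE /cval /= addr0
    ![_ * c _ _]mulrC; congr (c _ _ * _ + c _ _ * _); apply/val_inj.
have neg i : i \in C -> exists2 k : I -> R, (forall j, 0 <= k j) &
    - a i = \sum_(j in C) k j *: a j.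
  move=> iC; case: (farkas C a (- a i)) => // -[c cC].
  rewrite -scaleN1r evalZ mulN1r oppr_lt0 evE => ci; exfalso; apply: nc.
  exists (c 0 0, c 1 0); split; last by exists i.
  by move=> j /cC; rewrite evE.
pose k i := if pselect (i \in C) is left iC then projT1 (cid2 (neg i iC)) else fun=> 0.
have k0 i j : 0 <= k i j.
  by rewrite /k; case: pselect => // iC; case: (cid2 _) => /= ? + _; apply.
have kE i : i \in C -> - a i = \sum_(j in C) k i j *: a j.
  by move=> iC; rewrite /k; case: pselect => // iC'; case: (cid2 _).
pose y i := if i \in C then 1 + \sum_(j in C) k j i else 0.
have y1 i : i \in C -> 0 < y i.
  by move=> iC; rewrite /y iC ltr_wpDr // sumr_ge0.
have sum0 : \sum_i y i *: a i = 0.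
  rewrite (bigID [in C]) /= [X in _ + X]big1 ?addr0; last first.
    by move=> i iC; rewrite /y (negPf iC) scale0r.
  transitivity (\sum_(i in C) (a i + \sum_(j in C) k j i *: a i)).
    by apply: eq_bigr => i iC; rewrite /y iC scalerDl scale1r scaler_suml.
  rewrite big_split /= exchange_big /= -big_split big1 //= => i iC.
  by rewrite -kE // subrr.
exists y; split.
- by move=> i; have [/y1/ltW //|iC] := boolP (i \in C); rewrite /y (negPf iC).
- move=> i; have [/y1 //|iC] := boolP (i \in C).
  by rewrite /y (negPf iC) ltxx.
- transitivity ((\sum_i y i *: a i) 0 0); last by rewrite sum0 mxE.
  by rewrite summxE; apply: eq_bigr => i _; rewrite !mxE.
- transitivity ((\sum_i y i *: a i) 0 1); last by rewrite sum0 mxE.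
  by rewrite summxE; apply: eq_bigr => i _; rewrite !mxE.
Qed.

Section Position.
Variables p q : I -> R.
Hypothesis vert : forall i, coface p q (~: [set i]).
Hypothesis I2 : forall i : I, exists j, j != i.

(** A covector that is negative at most at k vanishes outside k by [vert k],
    and then also at k by [vert l] for another l. *)
Lemma vert_balanced : balanced p q.
Proof.
move=> c [i ci].
have other k : exists2 j, j != k & cval p q c j < 0.
  apply: contrapT => nj.
  have ge0 j : j != k -> 0 <= cval p q c j.
    by move=> jk; rewrite leNgt; apply/negP => lt; apply: nj; exists j.
  have [y [y0 yC yp yq]] := vert k.
  have yk : y k = 0.
    by apply/eqP; rewrite eq_le y0 leNgt yC !inE eqxx.
  have zero j : j != k -> cval p q c j = 0.
    move=> jk; have /eqP := coface_val c yp yq.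
    rewrite (bigD1 k) //= yk mul0r add0r psumr_eq0; last first.
      by move=> l lk; rewrite mulr_ge0 // ge0.
    move=> /allP/(_ j (mem_index_enum _)); rewrite jk /= mulf_eq0.
    by rewrite gt_eqF ?yC ?inE //= => /eqP.
  have [l lk] := I2 k.
  have [z [z0 zC zp zq]] := vert l.
  have := coface_val c zp zq.
  rewrite (bigD1 k) //= big1 ?addr0; last by move=> j /zero ->; rewrite mulr0.
  move=> /eqP; rewrite mulf_eq0 gt_eqF /=; last by rewrite zC !inE eq_sym.
  move=> ck; have [ik|ik] := eqVneq i k; first by rewrite ik ck in ci.
  by rewrite (zero i ik) eqxx in ci.
have [j _ jn] := other i; have [k kj kn] := other j.
by exists k, j.
Qed.

Lemma coface_pair i j : i != j -> coface p q (~: [set i; j]) <-> ~~ nonadj p q i j.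
Proof.
move=> ij; split.
  move=> [y [y0 yC yp yq]]; apply/negP => /nonadjP[_ [c [ci cj ck]]].
  have := coface_val c yp yq; have yi k : k \in [set i; j]%SET -> y k = 0.
    by move=> kij; apply/eqP; rewrite eq_le y0 leNgt yC finset.in_setC kij.
  move=> /eqP; rewrite (bigD1 i) //= yi ?inE ?eqxx // mul0r add0r.
  rewrite psumr_eq0 => [/allP z|k ki]; last first.
    have [->|kj] := eqVneq k j; first by rewrite yi ?inE ?eqxx ?orbT // mul0r.
    by rewrite mulr_ge0 // ck.
  have [|u [v [uv]]] := vert_balanced (c := (- c.1, - c.2)).
    by exists i; rewrite cval_opp oppr_eq0 lt_eqF.
  rewrite !cval_opp !oppr_lt0 => cu _.
  have ui : u != i by apply: contraTneq cu => ->; rewrite -leNgt ltW.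
  have uj : u != j by apply: contraTneq cu => ->; rewrite -leNgt ltW.
  have := z u (mem_index_enum _); rewrite ui /= mulf_eq0 !gt_eqF // yC.
  by rewrite !inE negb_or ui uj.
move=> nij; apply: contrapT => /not_cofaceP[c [cC [k kC ck]]].
move/negP: nij; apply; have [|u [v [uv cu cv]]] := vert_balanced (c := c).
  by exists k; rewrite gt_eqF.
have inij l : cval p q c l < 0 -> (l == i) || (l == j).
  by apply: contraTT => lij; rewrite -leNgt cC // !inE.
have ge k' : k' != i -> k' != j -> 0 <= cval p q c k'.
  by move=> ki kj; apply: cC; rewrite !inE negb_or ki kj.
apply: (cuts_nonadj ij (c := c)).
case/orP: (inij u cu) => /eqP ui; case/orP: (inij v cv) => /eqP vi;
  by subst u v; rewrite ?eqxx in uv; split.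
Qed.

Lemma coface_setT (i : I) : coface p q [set: I]%SET.
Proof.
have [j ji] := I2 i.
suff -> : [set: I]%SET = ~: [set i] :|: ~: [set j] by apply: cofaceU.
apply/setP => k; rewrite !inE; case: eqVneq => //= ->; by rewrite eq_sym.
Qed.

End Position.
End Coface.

(** * Cofaces of a path of nonadjacent pairs *)

(** The supports (b, b') of the nonnegative solutions of an equation
    al y - be y' = r, with positive coefficients, depend on the sign of r
    only. *)
Definition sign_ok (R : realFieldType) (r : R) (b b' : bool) : bool :=
  if 0 < r then b else if r < 0 then b' else b == b'.

Lemma two_termP (R : realFieldType) (al be r : R) (b b' : bool) : 0 < al -> 0 < be ->
  (exists y y', [/\ 0 <= y, 0 <= y', (0 < y) = b, (0 < y') = b' &
      al * y - be * y' = r]) <-> sign_ok r b b'.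
Proof.
move=> al0 be0; rewrite /sign_ok; split.
  move=> [y [y' [y0 y0' <- <- <-]]].
  have [h|h|h] := ltgtP 0 (al * y - be * y').
  - rewrite -(pmulr_rgt0 _ al0); apply: lt_le_trans h _.
    by rewrite gerDl oppr_le0 mulr_ge0 // ltW.
  - rewrite -(pmulr_rgt0 _ be0); rewrite subr_lt0 in h; apply: le_lt_trans h.
    by rewrite mulr_ge0 // ltW.
  - rewrite -(pmulr_rgt0 y al0) -(pmulr_rgt0 y' be0); apply/eqP.
    by move/eqP: h; rewrite eq_sym subr_eq0 => /eqP ->.
have al1 : al != 0 by rewrite gt_eqF.
have be1 : be != 0 by rewrite gt_eqF.
have bn (c : bool) : (0 : R) <= c%:R by rewrite ler0n.
have bp (c : bool) : ((0 : R) < c%:R) = c by rewrite ltr0n lt0b.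
have [r0 bt|r0 bt|r0 /eqP bt] := ltgtP 0 r.
- have y0 : 0 < (r + be * b'%:R) / al.
    by rewrite divr_gt0 // ltr_wpDr // mulr_ge0 // ltW.
  exists ((r + be * b'%:R) / al), b'%:R; split; rewrite ?bn ?bp ?y0 ?bt ?ltW //.
  by rewrite mulrC divfK // addrK.
- have y0 : 0 < (al * b%:R - r) / be.
    by rewrite divr_gt0 // ltr_wpDl ?oppr_gt0 // mulr_ge0 // ltW.
  exists b%:R, ((al * b%:R - r) / be); split; rewrite ?bn ?bp ?y0 ?bt ?ltW //.
  by rewrite [be * _]mulrC divfK // opprB addrC subrK.
- exists (b%:R / al), (b%:R / be); rewrite -bt; split.
  + by rewrite divr_ge0 // ltW.
  + by rewrite divr_ge0 // ltW.
  + by rewrite pmulr_lgt0 ?invr_gt0.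
  + by rewrite pmulr_lgt0 ?invr_gt0.
  + by rewrite -r0 ![_ * (_ / _)]mulrC !divfK // subrr.
Qed.

(** The coface rule of a path p0, ..., p5, where b_k stands for membership of
    p_k and closed for the nonadjacency of p0 and p5. *)
Definition path_rule (closed b0 b1 b2 b3 b4 b5 : bool) : bool :=
  if b1 then
    if b4 then
      [|| b0 && b2, b3 && b5 |
          if closed then (b0 == b3) && (b2 == b5)
          else [|| (b0 == b3) && b2, b3 && b2 | b3 && (b2 == b5)]]
    else b3 && b5
  else if b4 then b0 && b2 else (b0 == b3) && (b2 == b5).

(** With y1 and y4 fixed, the two equations of a coface in the coordinates of
    [path_frame] decouple into one for the pair (p3, p0) and one for the pair
    (p2, p5). *)
Lemma path_ruleP (R : realFieldType) (u1 u4 w1 w4 : R) (closed b0 b1 b2 b3 b4 b5 : bool) :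
  0 < u1 -> 0 < u4 -> 0 < w1 -> 0 < w4 ->
  (if closed then u1 * w4 == w1 * u4 else w1 * u4 < u1 * w4) ->
  (exists y1 y4, [/\ 0 <= y1, 0 <= y4, (0 < y1) = b1, (0 < y4) = b4 &
     sign_ok (u1 * y1 - u4 * y4) b3 b0 /\ sign_ok (w4 * y4 - w1 * y1) b2 b5])
  <-> path_rule closed b0 b1 b2 b3 b4 b5.
Proof.
move=> u1p u4p w1p w4p cl.
have clE : if closed then u1 / u4 = w1 / w4 else w1 / w4 < u1 / u4.
  move: cl; case: closed => [/eqP E|lt].
    by apply/eqP; rewrite eqr_div ?lt0r_neq0 // E.
  by rewrite ltr_pdivrMr // mulrAC ltr_pdivlMr.
have [b1t|b1f] := boolP b1; last first.
  rewrite /path_rule.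
  have [b4t|b4f] := boolP b4.
    split.
      move=> [y1 [y4 [y10 y40 h1 h4]]].
      have -> : y1 = 0 by apply/eqP; rewrite eq_le y10 leNgt h1.
      rewrite !mulr0 sub0r subr0 /sign_ok oppr_gt0 oppr_lt0 ltNge.
      by rewrite !pmulr_rgt0 // h4 pmulr_rge0 // y40 /= => -[-> ->].
    move=> /andP[b0t b2t]; exists 0, 1; rewrite ltxx ltr01 ler01 lexx; split=> //.
    rewrite !mulr0 !mulr1 sub0r subr0 /sign_ok oppr_gt0 oppr_lt0 u4p w4p ltNge.
    by rewrite ltW.
  split.
    move=> [y1 [y4 [y10 y40 h1 h4]]].
    have -> : y1 = 0 by apply/eqP; rewrite eq_le y10 leNgt h1.
    have -> : y4 = 0 by apply/eqP; rewrite eq_le y40 leNgt h4.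
    by rewrite !mulr0 subrr /sign_ok ltxx eq_sym => -[-> ->].
  move=> /andP[e1 e2]; exists 0, 0; rewrite ltxx lexx; split=> //.
  by rewrite !mulr0 subrr /sign_ok ltxx eq_sym.
have [b4t|b4f] := boolP b4; last first.
  rewrite /path_rule; split.
    move=> [y1 [y4 [y10 y40 h1 h4]]].
    have -> : y4 = 0 by apply/eqP; rewrite eq_le y40 leNgt h4.
    rewrite !mulr0 sub0r subr0 /sign_ok oppr_gt0 oppr_lt0 !pmulr_rgt0 // h1.
    by rewrite ltNge pmulr_rge0 // y10 /= => -[-> ->].
  move=> /andP[b0t b2t]; exists 1, 0; rewrite ltxx ltr01 ler01 lexx; split=> //.
  rewrite !mulr0 !mulr1 sub0r subr0 /sign_ok oppr_gt0 oppr_lt0 u1p w1p ltNge.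
  by rewrite ltW.
(* y1 = 1, y4 = t: two thresholds u1 / u4 and w1 / w4 *)
have red : (exists y1 y4, [/\ 0 <= y1, 0 <= y4, (0 < y1) = true, (0 < y4) = true &
     sign_ok (u1 * y1 - u4 * y4) b3 b0 /\ sign_ok (w4 * y4 - w1 * y1) b2 b5])
  <-> exists2 t : R, 0 < t & sign_ok (u1 / u4 - t) b3 b0 /\ sign_ok (t - w1 / w4) b2 b5.
  have sc (k r : R) b b' : 0 < k -> sign_ok (k * r) b b' = sign_ok r b b'.
    by move=> k0; rewrite /sign_ok pmulr_rgt0 // pmulr_rlt0.
  have E1 t y : 0 < y -> sign_ok (u1 * y - u4 * (t * y)) b3 b0 = sign_ok (u1 / u4 - t) b3 b0.
    move=> y0; rewrite -[RHS](@sc (u4 * y)) ?mulr_gt0 //; congr (sign_ok _ _ _).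
    by field; rewrite gt_eqF.
  have E2 t y : 0 < y -> sign_ok (w4 * (t * y) - w1 * y) b2 b5 = sign_ok (t - w1 / w4) b2 b5.
    move=> y0; rewrite -[RHS](@sc (w4 * y)) ?mulr_gt0 //; congr (sign_ok _ _ _).
    by field; rewrite gt_eqF.
  split=> [[y1 [y4 [_ _ h1 h4]]]|[t t0 ss]].
    rewrite -{1 2}(divfK (lt0r_neq0 h1) y4) E1 // E2 // => ss.
    by exists (y4 / y1); rewrite // divr_gt0.
  by exists 1, t; rewrite -[t]mulr1 E1 ?E2 // mulr1 ltr01 t0 !ltW.
rewrite red /path_rule {red}.
have A0 : 0 < u1 / u4 by rewrite divr_gt0.
have B0 : 0 < w1 / w4 by rewrite divr_gt0.
move: (u1 / u4) (w1 / w4) clE A0 B0 => A B {cl} clE A0 B0.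
have rew t : sign_ok (A - t) b3 b0 && sign_ok (t - B) b2 b5 =
  (if t < A then b3 else if A < t then b0 else b3 == b0) &&
  (if B < t then b2 else if t < B then b5 else b2 == b5).
  by rewrite /sign_ok !subr_gt0 !subr_lt0.
split.
  move=> [t t0 /andP]; rewrite rew.
  case: closed clE => E; rewrite ?E.
    by case: (ltgtP t B) => _ {rew}; move: b0 b2 b3 b5 => [] [] [] [].
  case: (ltgtP t A) => hA; case: (ltgtP t B) => hB //; try lra;
    by clear rew; move: b0 b2 b3 b5 => [] [] [] [].
have ex t : 0 < t -> (if t < A then b3 else if A < t then b0 else b3 == b0) &&
  (if B < t then b2 else if t < B then b5 else b2 == b5) ->
  exists2 t, 0 < t & sign_ok (A - t) b3 b0 /\ sign_ok (t - B) b2 b5.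
  by move=> t0 h; exists t => //; apply/andP; rewrite rew.
have BA : B <= A by case: closed clE => [->|/ltW].
case/or3P => [/andP[b0t b2t]|/andP[b3t b5t]|].
- apply: (ex (A + 1)); first lra.
  have -> : (A + 1 < A) = false by lra.
  have -> : (A < A + 1) = true by lra.
  have -> : (B < A + 1) = true by lra.
  by rewrite b0t b2t.
- apply: (ex (B / 2)); first lra.
  have -> : (B / 2 < A) = true by lra.
  have -> : (B < B / 2) = false by lra.
  have -> : (B / 2 < B) = true by lra.
  by rewrite b3t b5t.
case: closed clE => [E /andP[e1 e2]|lt].
  by apply: (ex A) => //; rewrite E !ltxx eq_sym e1 e2.
case/or3P => /andP[h1 h2].
- by apply: (ex A) => //; rewrite ltxx lt eq_sym h1 h2.
- apply: (ex ((A + B) / 2)); first lra.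
  have -> : ((A + B) / 2 < A) = true by lra.
  have -> : (B < (A + B) / 2) = true by lra.
  by rewrite h1 h2.
- by apply: (ex B) => //; rewrite ltxx lt h1 h2.
Qed.

Section PathCoface.
Variables (R : realFieldType) (I : finType) (p q : I -> R).
Local Notation nonadj := (nonadj p q).
Variables (p0 p1 p2 p3 p4 p5 : I).
Let pp := [:: p0; p1; p2; p3; p4; p5].
Hypothesis Upp : uniq pp.
Hypotheses (H01 : nonadj p0 p1) (H12 : nonadj p1 p2) (H23 : nonadj p2 p3)
  (H34 : nonadj p3 p4) (H45 : nonadj p4 p5).
Variables cu cw : R * R.
Local Notation u := (cval p q cu).
Local Notation w := (cval p q cw).
Hypothesis fr : path_frame p0 p1 p2 p3 p4 p5 u w.

Let det := cu.1 * cw.2 - cu.2 * cw.1.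

Lemma frame_det : det != 0.
Proof.
case: fr => u0 _ _ _ _ _ w0 w1 _ _ _ _ _ _ _; apply/eqP => d0.
have : u p0 * w p1 - u p1 * w p0 = det * (p p0 * q p1 - p p1 * q p0).
  by rewrite /cval /det; ring.
rewrite d0 mul0r w0 mulr0 subr0 => /eqP.
by rewrite mulf_eq0 (lt_eqF u0) (gt_eqF w1).
Qed.

Lemma frame_p i : p i = (cw.2 * u i - cu.2 * w i) / det.
Proof.
apply: (mulIf frame_det); rewrite divfK ?frame_det //.
by rewrite /det /cval; ring.
Qed.

Lemma frame_q i : q i = (cu.1 * w i - cw.1 * u i) / det.
Proof.
apply: (mulIf frame_det); rewrite divfK ?frame_det //.
by rewrite /det /cval; ring.
Qed.

Lemma coface_frame C : coface p q C <-> coface u w C.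
Proof.
split=> -[y [y0 yC yp yq]]; exists y; split=> //; try exact: coface_val.
- transitivity ((cw.2 * \sum_i y i * u i - cu.2 * \sum_i y i * w i) / det).
    rewrite !mulr_sumr -sumrB mulr_suml; apply: eq_bigr => i _.
    by rewrite [p i]frame_p; ring.
  by rewrite yp yq !mulr0 subrr mul0r.
- transitivity ((cu.1 * \sum_i y i * w i - cw.1 * \sum_i y i * u i) / det).
    rewrite !mulr_sumr -sumrB mulr_suml; apply: eq_bigr => i _.
    by rewrite [q i]frame_q; ring.
  by rewrite yp yq !mulr0 subrr mul0r.
Qed.

(** The vectors of p1 and p4 are opposite if and only if p0 and p5 are
    nonadjacent: a covector that is negative at p0 and p5 only must be
    nonnegative at both p1 and p4. *)
Lemma frame_closed : if nonadj p0 p5 then - u p1 * - w p4 == w p1 * u p4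
  else w p1 * u p4 < - u p1 * - w p4.
Proof.
case: fr => u0 u1 u2 u3 u4 u5 w0 w1 w2 w3 w4 w5 s1 s4 out.
have le : w p1 * u p4 <= - u p1 * - w p4.
  by apply: ler_pM; [exact: ltW | exact: ltW | lra | lra].
have [/nonadjP[_ [c [c0 c5 ck]]]|nc] := boolP (nonadj p0 p5); last first.
  rewrite lt_neqAle le andbT; apply: contra nc => /eqP E.
  pose c := (w p1 * cu.1 - u p1 * cw.1, w p1 * cu.2 - u p1 * cw.2).
  have cE i : cval p q c i = w p1 * u i - u p1 * w i.
    by rewrite /c /cval /=; ring.
  have nu1 : 0 < - u p1 by rewrite oppr_gt0.
  apply: (@cuts_nonadj _ _ _ _ c).
    by move: Upp; rewrite /= !inE !negb_or -!andbA => /and5P[_ _ _ _ /andP[]].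
  split; rewrite ?cE.
  - by rewrite w0 mulr0 subr0 pmulr_rlt0.
  - by rewrite u5 mulr0 sub0r -mulNr pmulr_rlt0.
  - move=> i i0 i5; rewrite cE -mulNr; have [ip|/out[-> ->]] := boolP (i \in pp); last first.
      by rewrite !mulr0 addr0.
    move: ip; rewrite !inE (negPf i0) (negPf i5) orbF /=.
    case/or4P => /eqP ->.
    + by have -> : w p1 * u p1 + - u p1 * w p1 = 0 by ring.
    + by rewrite u2 mulr0 add0r mulr_ge0 // ltW.
    + by rewrite w3 mulr0 addr0 mulr_ge0 // ltW.
    + by rewrite E mulrN addNr.
(* the covector of the closing edge is a positive combination of u and w *)
rewrite eq_le le andbT.
pose x := (c.1 * cw.2 - c.2 * cw.1) / det.
pose y := (c.2 * cu.1 - c.1 * cu.2) / det.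
have cE i : cval p q c i = x * u i + y * w i.
  have xd : x * det = c.1 * cw.2 - c.2 * cw.1 by rewrite divfK ?frame_det.
  have yd : y * det = c.2 * cu.1 - c.1 * cu.2 by rewrite divfK ?frame_det.
  apply: (mulIf frame_det).
  transitivity ((x * det) * u i + (y * det) * w i); last by ring.
  by rewrite xd yd /cval /det; ring.
move: Upp; rewrite /= !inE !negb_or andbT -!andbA.
move=> /and5P[n01 n02 n03 n04 /and5P[n05 n12 n13 n14 /and5P[n15 n23 n24 n25 /and3P[n34 n35 n45]]]].
have x0 : 0 < x by move: c0; rewrite cE w0 mulr0 addr0 nmulr_llt0.
have y0 : 0 < y by move: c5; rewrite cE u5 mulr0 add0r nmulr_llt0.
have E1 : 0 <= x * u p1 + y * w p1 by rewrite -cE ck // eq_sym.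
have E4 : 0 <= x * u p4 + y * w p4 by rewrite -cE ck // eq_sym.
rewrite -(ler_pM2l (mulr_gt0 x0 y0)).
have -> : x * y * (- u p1 * - w p4) = (x * - u p1) * (y * - w p4) by ring.
have -> : x * y * (w p1 * u p4) = (y * w p1) * (x * u p4) by ring.
by apply: ler_pM; [apply: mulr_ge0; lra | apply: mulr_ge0; lra | lra | lra].
Qed.

Lemma sum_pp (f : I -> R) : (forall i, i \notin pp -> f i = 0) ->
  \sum_i f i = f p0 + (f p1 + (f p2 + (f p3 + (f p4 + f p5)))).
Proof.
move=> f0; transitivity (\sum_(i <- pp) f i); last first.
  by rewrite !big_cons big_nil addr0.
rewrite (bigID [in pp]) /= [X in _ + X]big1 ?addr0; last by move=> i /f0.
by rewrite -big_uniq.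
Qed.

Lemma path_coface C : coface p q C <->
  path_rule (nonadj p0 p5) (p0 \in C) (p1 \in C) (p2 \in C) (p3 \in C)
    (p4 \in C) (p5 \in C).
Proof.
rewrite coface_frame.
have [u0 u1 u2 u3 u4 u5 w0 w1 w2 w3 w4 w5 _ _ out] := fr.
rewrite -(path_ruleP (u1 := - u p1) (u4 := u p4) (w1 := w p1) (w4 := - w p4))
  ?oppr_gt0 //; last exact: frame_closed.
have su y : \sum_i y i * u i =
    (u p3 * y p3 - - u p0 * y p0) - (- u p1 * y p1 - u p4 * y p4).
  rewrite sum_pp; first by rewrite u2 u5; ring.
  by move=> i /out[-> _]; rewrite mulr0.
have sw y : \sum_i y i * w i =
    (w p2 * y p2 - - w p5 * y p5) - (- w p4 * y p4 - w p1 * y p1).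
  rewrite sum_pp; first by rewrite w0 w3; ring.
  by move=> i /out[_ ->]; rewrite mulr0.
split.
  move=> [y [y0 yC]]; rewrite su sw => /eqP + /eqP.
  rewrite !subr_eq0 => /eqP eu /eqP ew.
  exists (y p1), (y p4); split=> //; rewrite -eu -ew; split.
    by apply/(two_termP _ _ _ (al := u p3) (be := - u p0)); rewrite ?oppr_gt0 //;
      exists (y p3), (y p0).
  by apply/(two_termP _ _ _ (al := w p2) (be := - w p5)); rewrite ?oppr_gt0 //;
    exists (y p2), (y p5).
move=> [y1 [y4 [y10 y40 h1 h4 []]]].
move=> /(two_termP _ _ _ u3 (_ : 0 < - u p0))[|y3 [y0 [y30 y00 h3 h0 eu]]].
  by rewrite oppr_gt0.
move=> /(two_termP _ _ _ w2 (_ : 0 < - w p5))[|y2 [y5 [y20 y50 h2 h5 ew]]].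
  by rewrite oppr_gt0.
pose ys := [:: y0; y1; y2; y3; y4; y5].
pose y i := if i \in pp then nth 0 ys (index i pp) else (i \in C)%:R.
have yk k : (k < 6)%N -> y (nth p0 pp k) = nth 0 ys k.
  by move=> k6; rewrite /y mem_nth // index_uniq.
have Y0 : y p0 = y0 := yk 0 isT; have Y1 : y p1 = y1 := yk 1 isT.
have Y2 : y p2 = y2 := yk 2 isT; have Y3 : y p3 = y3 := yk 3 isT.
have Y4 : y p4 = y4 := yk 4 isT; have Y5 : y p5 = y5 := yk 5 isT.
exists y; split.
- move=> i; have [|ip] := boolP (i \in pp); last by rewrite /y (negPf ip) ler0n.
  rewrite !inE => /orP[/eqP ->|/or4P[/eqP ->|/eqP ->|/eqP ->|/orP[] /eqP ->]];
    by rewrite ?Y0 ?Y1 ?Y2 ?Y3 ?Y4 ?Y5.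
- move=> i; have [|ip] := boolP (i \in pp); last by rewrite /y (negPf ip) ltr0n lt0b.
  rewrite !inE => /orP[/eqP ->|/or4P[/eqP ->|/eqP ->|/eqP ->|/orP[] /eqP ->]];
    by rewrite ?Y0 ?Y1 ?Y2 ?Y3 ?Y4 ?Y5.
- by rewrite su Y0 Y1 Y3 Y4 eu subrr.
- by rewrite sw Y1 Y2 Y4 Y5 ew subrr.
Qed.

End PathCoface.

Section PathRigid.
Variables (R : realFieldType) (I : finType) (p q : I -> R).

Lemma path_cofaceP (p0 p1 p2 p3 p4 p5 : I) :
  uniq [:: p0; p1; p2; p3; p4; p5] ->
  nonadj p q p0 p1 -> nonadj p q p1 p2 -> nonadj p q p2 p3 -> nonadj p q p3 p4 ->
  nonadj p q p4 p5 -> forall C, coface p q C <->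
    path_rule (nonadj p q p0 p5) (p0 \in C) (p1 \in C) (p2 \in C) (p3 \in C)
      (p4 \in C) (p5 \in C).
Proof.
move=> U h1 h2 h3 h4 h5 C.
have [cu [cw fr]] := path_frameP U h1 h2 h3 h4 h5.
exact: (path_coface U fr C).
Qed.

(** * Cofaces of a pentagon of nonadjacent pairs *)

Lemma cuts_span c1 c2 u v w : u != v -> u != w ->
  cuts p q c1 u v -> cuts p q c2 v w -> p u * q v - p v * q u != 0.
Proof.
move=> uv uw [c1u c1v _] [c2v _ c2k]; apply/eqP => E.
have : cval p q c1 u * cval p q c2 v - cval p q c1 v * cval p q c2 u
    = (c1.1 * c2.2 - c1.2 * c2.1) * (p u * q v - p v * q u).
  by rewrite /cval; ring.
rewrite E mulr0; have : 0 < cval p q c1 u * cval p q c2 v by rewrite nmulr_rgt0.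
have := mulr_le0_ge0 (ltW c1v) (c2k u uv uw); lra.
Qed.

Lemma zero_vecP i : reflect (forall c, cval p q c i = 0) (zero_vec p q i).
Proof.
apply: (iffP idP) => [z c|z]; first exact: cval_zero.
by have := z (1, 0); have := z (0, 1); rewrite /zero_vec /cval /= !mul1r !mul0r
  addr0 add0r => -> ->; rewrite eqxx.
Qed.

Lemma nonadj_nz i j : nonadj p q i j -> ~~ zero_vec p q i.
Proof.
by move=> /nonadjP[_ [c [ci _ _]]]; apply: contraTN ci => /cval_zero ->; rewrite ltxx.
Qed.

(** The two vectors of such a coface would be opposite, or i would be zero, and
    their line would leave at most three vectors for its two sides. *)
Lemma coface_two_false C (T : seq I) i j u v w : balanced p q -> uniq T -> (size T <= 5)%N ->
  (forall x, x \notin T -> zero_vec p q x) ->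
  nonadj p q u v -> nonadj p q v w -> u != w ->
  coface p q C -> i \in T -> i \in C -> j \in T -> i != j -> 
  ~~ zero_vec p q i -> ~ (forall x, x \in T -> x \in C -> (x == i) || (x == j)).
Proof.
move=> bal UT T5 Tz uv vw nuw [y [y0 yC yp yq]] iT iC jT ij nz only.
pose c := (q i, - p i).
have ci : cval p q c i = 0 by rewrite /cval /c /=; ring.
have yx x : x \in T -> x != i -> x != j -> y x = 0.
  move=> xT xi xj; apply/eqP; rewrite eq_le y0 leNgt yC andbT; apply/negP => xC.
  by have := only x xT xC; rewrite (negPf xi) (negPf xj).
have sumij d : y i * cval p q d i + y j * cval p q d j = 0.
  rewrite -[RHS](coface_val d yp yq) (bigD1 i) //= (bigD1 j) 1?eq_sym //=.
  rewrite big1 ?addr0 // => x /andP[xi xj].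
  have [xT|/Tz/cval_zero ->] := boolP (x \in T); last by rewrite mulr0.
  by rewrite yx // mul0r.
have yi : 0 < y i by rewrite yC.
have yj : y j != 0.
  apply/eqP => yj; move/negP: nz; apply; apply/zero_vecP => d.
  by have /eqP := sumij d; rewrite yj mul0r addr0 mulf_eq0 gt_eqF //= => /eqP.
have cj : cval p q c j = 0.
  by have /eqP := sumij c; rewrite ci mulr0 add0r mulf_eq0 (negPf yj) => /eqP.
have nzc : exists k, cval p q c k != 0.
  have [nuv [c1 F1]] := nonadjP uv; have [_ [c2 F2]] := nonadjP vw.
  have := cuts_span nuv nuw F1 F2 => D.
  have [cu|?] := eqVneq (cval p q c u) 0; last by exists u.
  exists v; apply: contra nz => /eqP cv.
  have z1 : p i * (p u * q v - p v * q u) = 0.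
    transitivity (p v * cval p q c u - p u * cval p q c v).
      by rewrite /cval /c /=; ring.
    by rewrite cu cv !mulr0 subrr.
  have z2 : q i * (p u * q v - p v * q u) = 0.
    transitivity (q v * cval p q c u - q u * cval p q c v).
      by rewrite /cval /c /=; ring.
    by rewrite cu cv !mulr0 subrr.
  move/eqP: z1; move/eqP: z2; rewrite !mulf_eq0 (negPf D) !orbF.
  by rewrite /zero_vec => -> ->.
have nzc' : exists k, cval p q (- c.1, - c.2) k != 0.
  by have [k ck] := nzc; exists k; rewrite cval_opp oppr_eq0.
have [i1 [i2 [i12 l1 l2]]] := bal _ nzc.
have [i3 [i4 [i34]]] := bal _ nzc'.
rewrite !cval_opp !oppr_lt0 => l3 l4.
have off x : cval p q c x != 0 -> [/\ x \in T, i != x & j != x].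
  move=> cx; split.
  - by apply/negPn/negP => /Tz/(cval_zero c)/eqP; rewrite (negPf cx).
  - by apply: contraNneq cx => <-; rewrite ci.
  - by apply: contraNneq cx => <-; rewrite cj.
have [[t1 a1 b1] [t2 a2 b2]] := (off i1 (negbT (lt_eqF l1)), off i2 (negbT (lt_eqF l2))).
have [[t3 a3 b3] [t4 a4 b4]] := (off i3 (lt0r_neq0 l3), off i4 (lt0r_neq0 l4)).
have ne x z : cval p q c x < 0 -> 0 < cval p q c z -> x != z.
  by move=> lx lz; apply: contraTneq lx => ->; rewrite -leNgt ltW.
have : (size [:: i; j; i1; i2; i3; i4] <= size T)%N.
  apply: uniq_leq_size.
    by rewrite /= !inE !negb_or ij a1 a2 a3 a4 b1 b2 b3 b4 i12 i34 !ne.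
  by move=> x; rewrite !inE => /orP[|/or4P[| | |/orP[]]] /eqP ->.
by move=> /leq_trans/(_ T5).
Qed.

End PathRigid.

Section PentagonRigid.
Variables (R : realFieldType) (I : finType) (v1 v2 v3 v4 v5 : I).
Let vv := [:: v1; v2; v3; v4; v5].
Hypothesis Uvv : uniq vv.

Definition pentagon_in (p q : I -> R) : Prop :=
  [/\ nonadj p q v1 v2, nonadj p q v2 v3, nonadj p q v3 v4, nonadj p q v4 v5 &
      nonadj p q v5 v1].

Lemma pentagon_zeroE (p q : I -> R) : pentagon_in p q ->
  forall x, zero_vec p q x = (x \notin vv).
Proof.
move=> [h1 h2 h3 h4 h5] x; apply/idP/idP; last first.
  exact: (pentagon_zero Uvv h1 h2 h3 h4 h5).
apply: contraTN; rewrite !inE => /orP[/eqP ->|/or4P[] /eqP ->].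
- exact: nonadj_nz h1.
- exact: nonadj_nz h2.
- exact: nonadj_nz h3.
- exact: nonadj_nz h4.
- exact: nonadj_nz h5.
Qed.

(** A coface contains none, or at least three, of the five nonzero vectors,
    and when it misses at most two of them it is determined by
    nonadjacency. *)
Lemma pentagon_coface (p q p' q' : I -> R) C :
  (forall i, coface p q (~: [set i])) -> (forall i, coface p' q' (~: [set i])) ->
  nonadj p q =2 nonadj p' q' -> pentagon_in p q -> coface p q C -> coface p' q' C.
Proof.
move=> vert vert' nn pin Ccf.
have pin' : pentagon_in p' q' by case: pin => *; split; rewrite -nn.
have [n12 n13] : v1 != v2 /\ v1 != v3.
  by move: Uvv; rewrite /= !inE !negb_or -!andbA => /and3P[].
have I2 (i : I) : exists j, j != i.
  have [<-|h] := eqVneq v1 i; last by exists v1.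
  by exists v2; rewrite eq_sym.
have bal := vert_balanced vert I2; have bal' := vert_balanced vert' I2.
have zE' := pentagon_zeroE pin'; have zE := pentagon_zeroE pin.
pose D := [set x in vv | x \notin C].
have agree C' : C' = (~: D)%SET -> coface p' q' C' -> coface p' q' C.
  move=> ->; apply: coface_zero_vec => i; rewrite zE' negbK !inE => ->.
  by rewrite negbK.
have memD k : (k \in D) = (k \in vv) && (k \notin C) by rewrite inE.
have coD k : (k \in ~: D)%SET = ~~ ((k \in vv) && (k \notin C)).
  by rewrite finset.in_setC memD.
have [D0|[x xD]] := set_0Vmem D.
  apply: (agree _ erefl); rewrite D0 finset.setC0.
  exact: (coface_setT vert' I2 v1).
have [D1|[y]] := set_0Vmem (D :\ x)%SET.
  apply: (agree _ erefl); rewrite -(finset.setD1K xD) D1 finset.setU0.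
  exact: vert'.
rewrite in_setD1 => /andP[yx yD].
have [D2|[z]] := set_0Vmem (D :\ x :\ y)%SET.
  apply: (agree _ erefl).
  have DE : D = [set x; y]%SET.
    apply/setP => k; have := congr1 (fun A : {set I} => k \in A) D2.
    rewrite !in_setD1 finset.in_set0 finset.in_set2.
    have [->|kx] := eqVneq k x; first by rewrite xD.
    by have [->|ky] := eqVneq k y; first by rewrite yD.
  rewrite DE; apply/coface_pair => //; first by rewrite eq_sym.
  rewrite -nn; apply/(coface_pair vert I2); first by rewrite eq_sym.
  apply: coface_zero_vec Ccf => i; rewrite zE negbK => iv.
  by rewrite -DE coD iv negbK.
rewrite !in_setD1 => /and3P[zy zx zD].
have [vC|[i]] := set_0Vmem ([set k in vv] :&: C)%SET.
  apply: (coface_zero_vec (C := finset.set0)).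
    move=> i; rewrite zE' negbK finset.in_set0 => iv.
    have := congr1 (fun A : {set I} => i \in A) vC.
    by rewrite !inE => /esym; move: iv; rewrite !inE => ->.
  exists (fun=> 0); split=> //.
  - by move=> i; rewrite finset.in_set0 ltxx.
  - by rewrite big1 // => i _; rewrite mul0r.
  - by rewrite big1 // => i _; rewrite mul0r.
rewrite inE => /andP[iv iC]; rewrite inE in iv; exfalso.
move: xD yD zD; rewrite !memD => /andP[xv xC] /andP[yv yC] /andP[zv zC].
have neC a b : a \in C -> b \notin C -> a != b.
  by move=> aC; apply: contraNneq => <-.
have [h1 h2 _ _ _] := pin.
have small j : j \in vv -> i != j ->
    (forall k, k \in vv -> k \in C -> (k == i) || (k == j)) -> False.
  move=> jv ij; apply: (coface_two_false bal Uvv _ _ h1 h2 n13 Ccf iv iC jv ij) => //.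
    by move=> k; rewrite zE.
  by rewrite zE negbK.
have [j0|[j]] := set_0Vmem (([set k in vv] :&: C) :\ i)%SET.
  apply: (small x xv (neC _ _ iC xC)) => k kv kC.
  have := congr1 (fun A : {set I} => k \in A) j0.
  by rewrite in_setD1 finset.in_setI inE kv kC finset.in_set0 !andbT => /negbFE ->.
rewrite in_setD1 finset.in_setI inE => /and3P[ji jv jC].
apply: (small j jv); first by rewrite eq_sym.
move=> k kv kC; apply/negPn/negP; rewrite negb_or => /andP[ki kj].
have : (size [:: i; j; k; x; y; z] <= size vv)%N.
  apply: uniq_leq_size; last first.
    by move=> l; rewrite !in_cons in_nil orbF
      => /orP[|/or4P[| | |/orP[]]] /eqP ->.
  rewrite /= !inE !negb_or (eq_sym i) ji (eq_sym i) ki (eq_sym j) kj.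
  rewrite (eq_sym x) yx (eq_sym x) zx (eq_sym y) zy.
  by rewrite (neC i x) // (neC i y) // (neC i z) // (neC j x) // (neC j y) //
    (neC j z) // (neC k x) // (neC k y) // (neC k z).
by [].
Qed.

End PentagonRigid.

(** * Graphs with four vertices of degree two *)

Section Graph.
Variables (I : finType) (H : rel I).
Hypothesis Hsym : symmetric H.
Hypothesis Hirr : forall i, ~~ H i i.
Hypothesis Hdeg : forall v a b c, a != b -> b != c -> a != c ->
  H v a -> H v b -> H v c -> False.
Hypothesis Htri : forall u v w, H u v -> H v w -> H u w -> False.
Hypothesis Hsq : forall a b c d, uniq [:: a; b; c; d] ->
  H a b -> H b c -> H c d -> H d a -> False.

Definition branching (v : I) : bool := #|[set j | H v j]%SET| == 2.

Hypothesis Hmat : forall a b c d e f, uniq [:: a; b; c; d; e; f] ->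
  H a b -> H c d -> H e f -> branching a -> branching c -> branching e ->
  forall x y, H x y -> x \in [:: a; b; c; d; e; f].

Let D := [set v | branching v]%SET.
Hypothesis D4 : (4 <= #|D|)%N.

Lemma branchingP v : branching v -> exists a b, [/\ a != b, H v a & H v b].
Proof.
move=> /cards2P[a [b [ab E]]]; exists a, b; split=> //.
  by have := set21 a b; rewrite -E inE.
by have := set22 a b; rewrite -E inE.
Qed.

Lemma branching_other v x : branching v -> exists2 y, y != x & H v y.
Proof.
move=> /branchingP[a [b [ab va vb]]].
have [ax|] := eqVneq a x; last by exists a.
by exists b; rewrite // -ax eq_sym.
Qed.

Lemma H_neq i j : H i j -> i != j.
Proof. by apply: contraTneq => ->. Qed.

Lemma branching_nbr v a b x : a != b -> H v a -> H v b -> H v x -> (x == a) || (x == b).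
Proof.
move=> ab va vb vx; apply/negPn/negP; rewrite negb_or => /andP[xa xb].
by apply: (@Hdeg v a b x); rewrite // eq_sym.
Qed.

Lemma branching_avoid (s : seq I) : (size s < 4)%N ->
  exists2 v, branching v & v \notin s.
Proof.
move=> s4; apply: contrapT => no.
have sub : {subset enum D <= s}.
  move=> v; rewrite mem_enum inE => bv; apply/negPn/negP => vs.
  by apply: no; exists v.
have := uniq_leq_size (enum_uniq _) sub; rewrite -cardE => le.
by have := leq_trans D4 le; rewrite leqNgt s4.
Qed.

(** Two vertices v and u of degree 2 that are not joined to each other provide
    two paths of length 2; a third vertex w of degree 2 with a neighbour s
    outside them leaves a neighbour of v and one of u that are distinct and
    different from w and s, unless the two paths share an end and their other
    ends are joined, which makes a pentagon. *)
Lemma matching_or_pentagon :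
  (exists a b c d e, uniq [:: a; b; c; d; e] /\
    [/\ H a b, H b c, H c d, H d e & H e a]) \/
  (exists a b c d e f, [/\ uniq [:: a; b; c; d; e; f], H a b, H c d, H e f &
    [/\ branching a, branching c & branching e]]).
Proof.
have [v bv _] := @branching_avoid [::] isT.
have [a [b [ab va vb]]] := branchingP bv.
have [u bu] := @branching_avoid [:: v; a; b] isT.
rewrite !inE !negb_or => /and3P[uv ua ub].
have [c [d [cd uc ud]]] := branchingP bu.
have nuv : ~~ H v u.
  by apply/negP => vu; have := branching_nbr ab va vb vu; rewrite (negPf ua) (negPf ub).
have mk w s v' u' : branching w -> H w s -> H v v' -> H u u' ->
    w != v -> w != u -> s != v -> s != u -> v' != w -> v' != s -> u' != w ->
    u' != s -> v' != u' -> exists a b c d e f,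
    [/\ uniq [:: a; b; c; d; e; f], H a b, H c d, H e f &
    [/\ branching a, branching c & branching e]].
  move=> bw ws vv uu wv wu sv su vw vs uw us vu.
  exists w, s, v, v', u, u'; split=> //; rewrite /= !inE !negb_or.
  rewrite (H_neq ws) wv wu sv su (H_neq vv) (H_neq uu).
  rewrite (eq_sym w) vw (eq_sym w) uw (eq_sym s) vs (eq_sym s) us.
  rewrite (eq_sym v u) uv vu.
  have -> : v != u' by apply: contraNneq nuv => ->; rewrite Hsym.
  by have -> : v' != u by apply: contraNneq nuv => <-.
have share a' b' d' : a' != b' -> b' != d' -> H v a' -> H v b' -> H u b' -> H u d' ->
    (exists a b c d e, uniq [:: a; b; c; d; e] /\
    [/\ H a b, H b c, H c d, H d e & H e a]) \/
  (exists a b c d e f, [/\ uniq [:: a; b; c; d; e; f], H a b, H c d, H e f &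
    [/\ branching a, branching c & branching e]]).
  move=> ab' bd' va' vb' ub' ud'.
  have ua' : u != a' by apply: contraNneq nuv => ->.
  have ad' : a' != d'.
    apply/eqP => E; rewrite -E in ud'; apply: (@Hsq v b' u a').
    + rewrite /= !inE !negb_or (H_neq vb') (eq_sym v u) uv (H_neq va').
      by rewrite (eq_sym b' u) (H_neq ub') (eq_sym b' a') ab' ua'.
    + by [].
    + by rewrite Hsym.
    + by [].
    + by rewrite Hsym.
  have vd' : v != d' by apply: contraNneq nuv => ->; rewrite Hsym.
  have [had|nad] := boolP (H a' d').
    left; exists a', v, b', u, d'; split; last first.
      by split; rewrite // Hsym.
    rewrite /= !inE !negb_or (eq_sym a' v) (H_neq va') ab' (eq_sym a' u) ua' ad'.
    by rewrite (H_neq vb') (eq_sym v u) uv vd' (eq_sym b' u) (H_neq ub') bd' (H_neq ud').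
  right; have [w bw] := @branching_avoid [:: v; b'; u] isT.
  rewrite !inE !negb_or => /and3P[wv wb wu].
  have nb s : H w s -> s != b'.
    move=> ws; apply/eqP => sb; rewrite sb Hsym in ws.
    have := @branching_nbr b' v u w; rewrite ws (negPf wv) (negPf wu) (eq_sym v u) uv.
    by rewrite Hsym vb' Hsym ub' => /(_ isT isT isT isT).
  have [s [ws sv su]] : exists s, [/\ H w s, s != v & s != u].
    have [s1 [s2 [s12 w1 w2]]] := branchingP bw.
    have [e1|n1] := eqVneq s1 v.
      exists s2; split=> //; first by rewrite -e1 eq_sym.
      apply/eqP => e2; rewrite e1 Hsym in w1; rewrite e2 Hsym in w2.
      have := branching_nbr ab' va' vb' w1; rewrite (negPf wb) orbF => /eqP wa.
      have := branching_nbr bd' ub' ud' w2; rewrite (negPf wb) /= => /eqP wd.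
      by rewrite -wa wd eqxx in ad'.
    have [e1'|n1'] := eqVneq s1 u; last by exists s1.
    exists s2; split=> //; last by rewrite -e1' eq_sym.
    apply/eqP => e2; rewrite e1' Hsym in w1; rewrite e2 Hsym in w2.
    have := branching_nbr ab' va' vb' w2; rewrite (negPf wb) orbF => /eqP wa.
    have := branching_nbr bd' ub' ud' w1; rewrite (negPf wb) /= => /eqP wd.
    by rewrite -wa wd eqxx in ad'.
  have sb := nb s ws.
  have [aws|] := boolP (a' \in [:: w; s]).
    apply: (mk w s b' d'); rewrite // 1?eq_sym //.
      apply: contraNneq nad => dw; move: aws ws; rewrite dw !inE.
      move=> /orP[/eqP E|/eqP ->] ws'; by [rewrite E eqxx in ad' | rewrite Hsym].
    apply: contraNneq nad => ds; move: aws ws; rewrite ds !inE.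
    by move=> /orP[/eqP ->|/eqP E] ws'; [| rewrite E eqxx in ad'].
  rewrite !inE negb_or => /andP[aw as_].
  by apply: (mk w s a' b'); rewrite // eq_sym.
have [cab|cnab] := boolP (c \in [:: a; b]).
  move: cab; rewrite !inE => /orP[] /eqP cE; subst c.
    by apply: (share b a d); rewrite // eq_sym.
  exact: (share a b d).
have [dab|dnab] := boolP (d \in [:: a; b]).
  move: dab; rewrite !inE => /orP[] /eqP dE; subst d.
    by apply: (share b a c); rewrite // eq_sym.
  by apply: (share a b c); rewrite // eq_sym.
move: cnab dnab; rewrite !inE !negb_or => /andP[ca cb] /andP[da db]; right.
have [w bw] := @branching_avoid [:: v; u] isT.
rewrite !inE !negb_or => /andP[wv wu].
have common x : H v x -> H u x -> False.
  move=> /(branching_nbr ab va vb) + /(branching_nbr cd uc ud).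
  by case/orP=> /eqP ->; rewrite ![_ == c]eq_sym ![_ == d]eq_sym
    ?(negPf ca) ?(negPf cb) ?(negPf da) ?(negPf db).
have [s [ws sv su]] : exists s, [/\ H w s, s != v & s != u].
  have [s1 [s2 [s12 w1 w2]]] := branchingP bw.
  have [e1|n1] := eqVneq s1 v.
    exists s2; split=> //; first by rewrite -e1 eq_sym.
    apply/eqP => e2; rewrite e1 Hsym in w1; rewrite e2 Hsym in w2.
    exact: common w1 w2.
  have [e1'|n1'] := eqVneq s1 u; last by exists s1.
  exists s2; split=> //; last by rewrite -e1' eq_sym.
  apply/eqP => e2; rewrite e1' Hsym in w1; rewrite e2 Hsym in w2.
  exact: common w2 w1.
have pick x y z : H z x -> H z y -> x != y -> exists z', [/\ H z z', z' != w & z' != s].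
  move=> zx zy xy.
  have [/andP[h1 h2]|] := boolP ((x != w) && (x != s)); first by exists x.
  rewrite negb_and !negbK => xws; exists y; split=> //.
    apply/eqP => yw; case/orP: xws => /eqP E; first by rewrite E yw eqxx in xy.
    by subst y x; apply: (Htri zy ws zx).
  apply/eqP => ys; case/orP: xws => /eqP E; last by rewrite E ys eqxx in xy.
  by subst y x; apply: (Htri zx ws zy).
have [v' [vv vw vs]] := pick a b v va vb ab.
have [u' [uu uw us]] := pick c d u uc ud cd.
apply: (mk w s v' u') => //.
by apply/eqP => E; apply: (common v'); rewrite // E.
Qed.

(** The further neighbours of b1 and b2 are endpoints of the two other edges,
    one of each since there is no triangle and no 4-cycle, so the three edges are joined
    into one path. *)
Lemma path_of_matching a1 a2 b1 b2 c1 c2 :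
  uniq [:: a1; a2; b1; b2; c1; c2] -> H a1 a2 -> H b1 b2 -> H c1 c2 ->
  branching b1 -> branching b2 ->
  (forall x y, H x y -> x \in [:: a1; a2; b1; b2; c1; c2]) ->
  exists p0 p1 p2 p3 p4 p5, uniq [:: p0; p1; p2; p3; p4; p5] /\
   [/\ H p0 p1, H p1 p2, H p2 p3, H p3 p4 & H p4 p5].
Proof.
move=> U Ha Hb Hc br1 br2 six.
have [s sb2 b1s] := branching_other b2 br1.
have [t tb1 b2t] := branching_other b1 br2.
have sb1 : s != b1 by rewrite eq_sym H_neq.
have tb2 : t != b2 by rewrite eq_sym H_neq.
have st : s != t by apply/eqP => E; apply: (Htri Hb b2t); rewrite -E.
have nst : ~~ H s t.
  apply/negP => hst; apply: (@Hsq b1 s t b2) => //; rewrite 1?Hsym //.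
  by rewrite /= !inE !negb_or st sb2 tb2 (H_neq b1s) (H_neq Hb) eq_sym tb1.
have := six s b1; rewrite Hsym => /(_ b1s).
have := six t b2; rewrite Hsym => /(_ b2t).
rewrite !inE (negPf sb1) (negPf sb2) (negPf tb1) (negPf tb2) /= => tin sin.
have Ua := U; move: Ua; rewrite /= !inE !negb_or andbT -!andbA.
move=> /and5P[n1 n2 n3 n4 /and5P[n5 n6 n7 n8 /and5P[n9 n10 n11 n12 /and3P[n13 n14 n15]]]].
have build s' t' : H s' s -> H t t' ->
    {subset [:: a1; a2; b1; b2; c1; c2] <= [:: s'; s; b1; b2; t; t']} ->
  exists p0 p1 p2 p3 p4 p5, uniq [:: p0; p1; p2; p3; p4; p5] /\
   [/\ H p0 p1, H p1 p2, H p2 p3, H p3 p4 & H p4 p5].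
  move=> hs ht sub; exists s', s, b1, b2, t, t'; split.
    exact: (leq_size_uniq U sub).
  by split; rewrite // Hsym.
have sub6 (x1 x2 x3 x4 x5 x6 : I) (l : seq I) :
    all [in l] [:: x1; x2; x3; x4; x5; x6] -> {subset [:: x1; x2; x3; x4; x5; x6] <= l}.
  by move=> /allP.
case/or4P: sin => /eqP sE; case/or4P: tin => /eqP tE; subst s t;
  try (by rewrite eqxx in st); try (by rewrite Ha in nst);
  try (by rewrite Hc in nst); try (by rewrite Hsym Ha in nst);
  try (by rewrite Hsym Hc in nst).
- by apply: (build a2 c2); rewrite // 1?Hsym //; apply: sub6; rewrite /= !inE !eqxx !orbT.
- by apply: (build a2 c1); rewrite // 1?Hsym //; apply: sub6; rewrite /= !inE !eqxx !orbT.
- by apply: (build a1 c2); rewrite // 1?Hsym //; apply: sub6; rewrite /= !inE !eqxx !orbT.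
- by apply: (build a1 c1); rewrite // 1?Hsym //; apply: sub6; rewrite /= !inE !eqxx !orbT.
- by apply: (build c2 a2); rewrite // 1?Hsym //; apply: sub6; rewrite /= !inE !eqxx !orbT.
- by apply: (build c2 a1); rewrite // 1?Hsym //; apply: sub6; rewrite /= !inE !eqxx !orbT.
- by apply: (build c1 a2); rewrite // 1?Hsym //; apply: sub6; rewrite /= !inE !eqxx !orbT.
- by apply: (build c1 a1); rewrite // 1?Hsym //; apply: sub6; rewrite /= !inE !eqxx !orbT.
Qed.

(** Three edges cover all the vertices of positive degree, hence at least
    four of degree 2, and one of the edges has two of these as endpoints. *)
Lemma pentagon_or_path :
  (exists a b c d e, uniq [:: a; b; c; d; e] /\
    [/\ H a b, H b c, H c d, H d e & H e a]) \/
  (exists p0 p1 p2 p3 p4 p5, uniq [:: p0; p1; p2; p3; p4; p5] /\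
    [/\ H p0 p1, H p1 p2, H p2 p3, H p3 p4 & H p4 p5]).
Proof.
have [?|] := matching_or_pentagon; first by left.
move=> [a [b [c [d [e [f [U ab cd ef [ba bc be]]]]]]]]; right.
have six := Hmat U ab cd ef ba bc be.
have six' : forall x y, H x y -> x \in [:: a; b; c; d; e; f] by [].
have [bb|nb] := boolP (branching b).
  have U' : uniq (rot 4 [:: a; b; c; d; e; f]) by rewrite rot_uniq.
  apply: (path_of_matching U') => // x y /six'.
  by rewrite -(mem_rot 4).
have [bd|nd] := boolP (branching d).
  exact: (path_of_matching U).
have [bf|nf] := boolP (branching f).
  have U' : uniq (rot 2 [:: a; b; c; d; e; f]) by rewrite rot_uniq.
  apply: (path_of_matching U') => // x y /six'.
  by rewrite -(mem_rot 2).
have [v bv] := @branching_avoid [:: a; c; e] isT; rewrite !inE !negb_or.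
move=> /and3P[va vc ve]; have [w [_ [_ vw _]]] := branchingP bv.
have := six v w vw; rewrite !inE (negPf va) (negPf vc) (negPf ve) /=.
by case/or3P => /eqP E; rewrite E ?(negPf nb) ?(negPf nd) ?(negPf nf) in bv.
Qed.

End Graph.

(** * Convex hulls of finite families and their faces *)

Section Hull.
Variables (R : realType) (n : nat).

Lemma convex_setE (A : set 'rV[R]_n) : convex_set A <->
  forall x y t, 0 <= t -> t <= 1 -> A x -> A y -> A (t *: x + (1 - t) *: y).
Proof.
split=> [cA x y t t0 t1 Ax Ay|cA x y t /set_mem Ax /set_mem Ay].
  have := cA x y (Itv01 t0 t1) (mem_set Ax) (mem_set Ay).
  by move/set_mem.
apply/mem_set; exact: (cA x y _ (ge0 t) (le1 t)).
Qed.

Lemma conv_hull_min (S A : set 'rV[R]_n) :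
  convex_set A -> S `<=` A -> conv_hull S `<=` A.
Proof. exact: smallest_sub. Qed.

Lemma sub_conv_hull (S : set 'rV[R]_n) : S `<=` conv_hull S.
Proof. exact: sub_gen_smallest. Qed.

Lemma conv_hull_convex (S : set 'rV[R]_n) : convex_set (conv_hull S).
Proof.
apply/convex_setE => x y t t0 t1 hx hy A [cA SA].
have /convex_setE cA' := cA; apply: cA' => //; first exact: hx.
exact: hy.
Qed.

Lemma convex_halfspace (c : 'cV[R]_n) b : convex_set [set z | eval z c <= b].
Proof.
apply/convex_setE => x y t t0 t1 /= hx hy; rewrite evalD !evalZ.
have -> : b = t * b + (1 - t) * b by ring.
by apply: lerD; rewrite ler_wpM2l // subr_ge0.
Qed.

Lemma convex_hyperplane (c : 'cV[R]_n) b : convex_set [set z | eval z c = b].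
Proof.
by apply/convex_setE => x y t t0 t1 /= hx hy; rewrite evalD !evalZ hx hy; ring.
Qed.

Variables (I : finType) (x : I -> 'rV[R]_n).
Implicit Types (S T : {set I}).

Definition hull T : set 'rV[R]_n := conv_hull [set x i | i in [set` T]].

Lemma mem_hull T i : i \in T -> hull T (x i).
Proof. by move=> iT; apply: sub_conv_hull; exists i. Qed.

Lemma hull_min T (A : set 'rV[R]_n) : convex_set A -> (forall i, i \in T -> A (x i)) ->
  hull T `<=` A.
Proof. by move=> cA h; apply: conv_hull_min => // _ [i iT <-]; apply: h. Qed.

Lemma hull_mono S T : (forall i, i \in S -> i \in T) -> hull S `<=` hull T.
Proof.
move=> ST; apply: hull_min; first exact: conv_hull_convex.
by move=> i /ST; apply: mem_hull.
Qed.

Lemma convex_combination (A : set 'rV[R]_n) T k : convex_set A -> (forall i, i \in T -> A (x i)) ->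
  (forall i, 0 <= k i) -> (forall i, i \notin T -> k i = 0) -> \sum_i k i = 1 ->
  A (\sum_i k i *: x i).
Proof.
move=> cA AT; have [m] := ubnP #|[set i | k i != 0]%SET|.
elim: m k => // m IH k km k0 kT k1.
have [i ki] : exists i, k i != 0.
  apply: contrapT => no; have : (1 : R) = 0; last by move/eqP; rewrite oner_eq0.
  rewrite -k1 big1 // => i _; apply/eqP/negPn/negP => ki.
  by apply: no; exists i.
have iT : i \in T by apply: contraNT ki => /kT ->.
have rest : \sum_(j | j != i) k j = 1 - k i.
  by have := k1; rewrite (bigD1 i) //= => <-; rewrite addrAC subrr add0r.
have ki1 : k i <= 1.
  by rewrite -subr_ge0 -rest sumr_ge0.
have [kiE|ki1'] := eqVneq (k i) 1.
  rewrite (bigD1 i) //= big1 ?addr0 ?kiE ?scale1r; first exact: AT.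
  move=> j ji; have /eqP := rest; rewrite kiE subrr psumr_eq0 // => /allP.
  by move=> /(_ j (mem_index_enum _)); rewrite ji => /eqP ->; rewrite scale0r.
have r0 : 1 - k i != 0 by rewrite subr_eq0 eq_sym.
pose k' j := if j == i then 0 else k j / (1 - k i).
have k'T j : j \notin T -> k' j = 0.
  by move=> jT; rewrite /k'; case: ifP => // _; rewrite kT // mul0r.
have -> : \sum_j k j *: x j = k i *: x i + (1 - k i) *: \sum_j k' j *: x j.
  rewrite (bigD1 i) //= scaler_sumr; congr (_ + _).
  rewrite [RHS](bigD1 i) //= /k' eqxx scale0r scaler0 add0r.
  by apply: eq_bigr => j ji; rewrite (negPf ji) scalerA mulrC divfK.
have /convex_setE cA' := cA; apply: cA' => //; first exact: AT.
apply: IH => //.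
- rewrite -ltnS; apply: leq_trans km; rewrite ltnS; apply: proper_card.
  apply/properP; split.
    apply/fintype.subsetP => j; rewrite !inE /k'; case: ifP; rewrite ?eqxx //.
    by move=> _; apply: contraNneq => ->; rewrite mul0r.
  by exists i; rewrite ?inE // /k' !eqxx.
- move=> j; rewrite /k'; case: ifP => // _.
  by rewrite divr_ge0 // subr_ge0.
- rewrite (bigD1 i) //= {1}/k' eqxx add0r.
  transitivity (\sum_(j | j != i) k j / (1 - k i)).
    by apply: eq_bigr => j ji; rewrite /k' (negPf ji).
  by rewrite -mulr_suml rest divff.
Qed.

Lemma hullP T z : hull T z <-> exists k, [/\ forall i, 0 <= k i,
  forall i, i \notin T -> k i = 0, \sum_i k i = 1 & z = \sum_i k i *: x i].
Proof.
split; last first.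
  move=> [k [k0 kT k1 ->]]; apply: (@convex_combination (hull T) T); [|by move=> i; apply: mem_hull|done..].
  exact: conv_hull_convex.
pose A := [set z | exists k, [/\ forall i, 0 <= k i,
  forall i, i \notin T -> k i = 0, \sum_i k i = 1 & z = \sum_i k i *: x i]].
apply: (@hull_min T A).
  apply/convex_setE => _ _ t t0 t1 [k [k0 kT k1 ->]] [l [l0 lT l1 ->]].
  exists (fun i => t * k i + (1 - t) * l i); split.
  - by move=> i; rewrite addr_ge0 // mulr_ge0 // subr_ge0.
  - by move=> i iT; rewrite kT // lT // !mulr0 addr0.
  - by rewrite big_split -!mulr_sumr k1 l1 /=; ring.
  - rewrite !scaler_sumr -big_split; apply: eq_bigr => i _ /=.
    by rewrite [RHS]scalerDl !scalerA.
move=> i iT; exists (fun j => (j == i)%:R); split.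
- by move=> j; rewrite ler0n.
- by move=> j; apply: contraNeq; rewrite pnatr_eq0 eqb0 negbK => /eqP ->.
- by rewrite (bigD1 i) //= eqxx big1 ?addr0 // => j /negPf ->.
- rewrite (bigD1 i) //= eqxx scale1r big1 ?addr0 // => j /negPf ->.
  by rewrite scale0r.
Qed.

Lemma hull_le T c b z : (forall i, i \in T -> eval (x i) c <= b) ->
  hull T z -> eval z c <= b.
Proof. by move=> h hz; exact: (hull_min (@convex_halfspace c b) h hz). Qed.

Lemma hull_eq T c b z : (forall i, i \in T -> eval (x i) c = b) ->
  hull T z -> eval z c = b.
Proof. by move=> h hz; exact: (hull_min (@convex_hyperplane c b) h hz). Qed.

(** A point of the hull where the bound is attained puts no weight on the
    points where it is not. *)
Lemma hull_face T c b z : (forall i, i \in T -> eval (x i) c <= b) ->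
  hull T z -> eval z c = b -> hull [set i in T | eval (x i) c == b]%SET z.
Proof.
move=> h /hullP[k [k0 kT k1 ->]]; rewrite eval_sum => E.
apply/hullP; exists k; split=> // i; rewrite inE negb_and.
case/orP => [/kT //|ib]; apply/eqP/negPn/negP => ki.
have iT : i \in T by apply: contraNT ki => /kT ->.
have : \sum_i k i * (b - eval (x i) c) = 0.
  under eq_bigr do rewrite mulrBr; rewrite big_split sumrN -mulr_suml k1 mul1r /=.
  by apply/eqP; rewrite subr_eq0 -E; apply/eqP/eq_bigr => j _; rewrite evalZ.
move/eqP; rewrite psumr_eq0 => [/allP/(_ i (mem_index_enum _))|j _].
  by rewrite /= mulf_eq0 (negPf ki) subr_eq0 eq_sym (negPf ib).
have [jT|/kT ->] := boolP (j \in T); last by rewrite mul0r.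
by rewrite mulr_ge0 // subr_ge0 h.
Qed.

Lemma hull_nonempty T : hull T !=set0 -> exists i, i \in T.
Proof.
move=> [z /hullP[k [_ kT k1 _]]]; apply: contrapT => no.
have : (1 : R) = 0; last by move/eqP; rewrite oner_eq0.
rewrite -k1 big1 // => i _; apply: kT; apply/negP => iT; apply: no; by exists i.
Qed.

(** The faces of the hull, described by the indices of the points on them. *)
Definition face_set T S : Prop := (forall i, i \in S -> i \in T) /\
  exists c b, forall i, i \in T -> eval (x i) c <= b /\ (eval (x i) c == b) = (i \in S).

Lemma face_set_hull T S c b :
  (forall i, i \in T -> eval (x i) c <= b /\ (eval (x i) c == b) = (i \in S)) ->
  (forall i, i \in S -> i \in T) ->
  hull S = [set z | hull T z /\ eval z c = b].
Proof.
move=> h ST; apply/seteqP; split=> z /=.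
  move=> Sz; split; first exact: hull_mono Sz.
  apply: hull_eq Sz => i iS; have iT := ST i iS.
  by apply/eqP; have [_ ->] := h i iT.
move=> [Tz zb]; have := hull_face (fun i iT => proj1 (h i iT)) Tz zb.
apply: hull_mono => i; rewrite inE => /andP[iT].
by have [_ ->] := h i iT.
Qed.

Lemma faces_hull T F : faces (hull T) F <-> exists2 S, face_set T S & F = hull S.
Proof.
split; last first.
  move=> [S [ST [c [b h]]] ->]; exists c, b; split.
    by move=> z; apply: hull_le => i /h[].
  exact: face_set_hull.
move=> [c [b [hb ->]]].
have ST : forall i, i \in [set i in T | eval (x i) c == b]%SET -> i \in T.
  by move=> i; rewrite inE => /andP[].
have h : forall i, i \in T -> eval (x i) c <= b /\
    (eval (x i) c == b) = (i \in [set i in T | eval (x i) c == b]%SET).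
  by move=> i iT; rewrite inE iT; split=> //; apply: hb; apply: mem_hull.
exists [set i in T | eval (x i) c == b]%SET; first by split=> //; exists c, b.
by rewrite (face_set_hull h ST).
Qed.

Lemma hull_face_mem T S i : face_set T S -> i \in T -> hull S (x i) -> i \in S.
Proof.
move=> [ST [c [b h]]] iT Si; have [_ <-] := h i iT.
by apply/eqP; apply: hull_eq Si => j jS; apply/eqP; have [_ ->] := h j (ST j jS).
Qed.

Lemma hull_set1 i : hull [set i]%SET = [set x i].
Proof.
apply/seteqP; split=> [z|_ /= ->]; last by apply: mem_hull; rewrite inE.
apply: hull_min => [|j]; last by rewrite inE => /eqP ->.
apply/convex_setE => _ _ t t0 t1 /= -> ->.
by rewrite -scalerDl addrC subrK scale1r.
Qed.

Definition vertex_position T : Prop := forall i, i \in T -> face_set T [set i]%SET.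

Section Position.
Variable T : {set I}.
Hypothesis pos : vertex_position T.

Lemma position_inj i j : i \in T -> j \in T -> x i = x j -> i = j.
Proof.
move=> iT jT E; have [_ [c [b h]]] := pos iT.
have [_ hi] := h i iT; have [_] := h j jT.
by rewrite -E hi !inE eqxx => /esym/eqP ->.
Qed.

Lemma vertices_hull : vertices (hull T) = [set x i | i in [set` T]].
Proof.
apply/seteqP; split=> [v|_ [i iT <-]]; last first.
  by apply/faces_hull; exists [set i]%SET; [exact: pos | rewrite hull_set1].
move=> /faces_hull[S [ST _] E].
have [i iS] : exists i, i \in S by apply: hull_nonempty; rewrite -E; exists v.
by exists i; [exact: ST | have := mem_hull iS; rewrite -E].
Qed.

Lemma face_set_le S S' : face_set T S -> face_set T S' ->
  (hull S `<=` hull S' <-> forall i, i \in S -> i \in S').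
Proof.
move=> fS fS'; split=> [sub i iS|]; last exact: hull_mono.
apply: (hull_face_mem fS'); first by case: fS => ST _; apply: ST.
by apply: sub; apply: mem_hull.
Qed.

Lemma face_set_inj S S' : face_set T S -> face_set T S' -> hull S = hull S' -> S = S'.
Proof.
move=> fS fS' E; apply/setP => i; apply/idP/idP.
  by apply/face_set_le: i => //; rewrite E.
by apply/face_set_le: i => //; rewrite E.
Qed.

End Position.
End Hull.

(** * Dimension and edges *)

Section Direction.
Variables (R : realType) (n : nat) (I : finType) (x : I -> 'rV[R]_n).
Implicit Types (S T : {set I}) (W : {vspace 'rV[R]_n}).
Local Notation hull := (hull x).

Definition direction T : {vspace 'rV[R]_n} :=
  <<[seq x i - x j | i <- enum T, j <- enum T]>>%VS.

Lemma direction_subP T W :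
  (direction T <= W)%VS <-> forall i j, i \in T -> j \in T -> x i - x j \in W.
Proof.
split=> [/span_subvP h i j iT jT|h].
  by apply: h; apply/allpairsP; exists (i, j); rewrite /= !mem_enum.
apply/span_subvP => _ /allpairsP[[i j] /= [+ + ->]]; rewrite !mem_enum.
exact: h.
Qed.

Lemma mem_direction T i j : i \in T -> j \in T -> x i - x j \in direction T.
Proof. by move=> iT jT; have /direction_subP := subvv (direction T); apply. Qed.

Lemma convex_coset z0 W : convex_set [set z | z - z0 \in W].
Proof.
apply/convex_setE => u v t t0 t1 /= hu hv.
have -> : t *: u + (1 - t) *: v - z0 = t *: (u - z0) + (1 - t) *: (v - z0).
  by rewrite !scalerBr addrACA -opprD -scalerDl addrC [t + _]addrC subrK scale1r addrC.
by rewrite memvD // memvZ.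
Qed.

(** The points whose difference with a fixed point lies in a given subspace
    form a convex set. *)
Lemma direction_hull T : is_direction (hull T) (direction T).
Proof.
move=> W; rewrite direction_subP; split=> [h u v hu hv|h i j iT jT]; last first.
  by apply: h; apply: mem_hull.
have step j : j \in T -> u - x j \in W.
  by move=> jT; apply: (hull_min (@convex_coset (x j) W) _ hu) => i iT; apply: h.
rewrite -opprB memvN; apply: (hull_min (@convex_coset u W) _ hv) => j jT /=.
by rewrite -opprB memvN step.
Qed.

Lemma is_direction_inj (A : set 'rV[R]_n) U U' :
  is_direction A U -> is_direction A U' -> U = U'.
Proof.
move=> h h'; apply/eqP; rewrite eqEsubv; apply/andP; split.
  by apply/h/h'; rewrite subvv.
by apply/h'/h; rewrite subvv.
Qed.

Lemma has_dim_hull T d : has_dim (hull T) d <->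
  (exists i, i \in T) /\ \dim (direction T) = d.
Proof.
split=> [[/hull_nonempty ne [U hU <-]]|[[i iT] <-]].
  by split=> //; rewrite (is_direction_inj hU (direction_hull T)).
split; first by exists (x i); apply: mem_hull.
by exists (direction T) => //; apply: direction_hull.
Qed.

Lemma dimv_add_line (U : {vspace 'rV[R]_n}) w : w \notin U ->
  \dim (U + <[w]>) = (\dim U).+1.
Proof.
move=> wU; rewrite dimv_disjoint_sum ?dim_vline.
  by case: eqP wU => [->|_ _]; rewrite ?mem0v // addn1.
apply/eqP; rewrite -subv0; apply/subvP => v; rewrite memv_cap => /andP[vU].
move=> /vlineP[k E]; rewrite memv0 E.
have [->|k0] := eqVneq k 0; first by rewrite scale0r.
by case/negP: wU; rewrite -(scalerK k0 w) -E memvZ.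
Qed.

Lemma face_direction S c b : (forall i, i \in S -> eval (x i) c = b) ->
  forall v, v \in direction S -> eval v c = 0.
Proof.
move=> h v; pose f := linfun (mulmxr c : 'rV[R]_n -> 'rV[R]_1).
have sub : (direction S <= lker f)%VS.
  apply/direction_subP => i j iS jS; rewrite memv_ker lfunE /=; apply/eqP/rowP => k.
  rewrite ord1 [RHS]mxE; have := evalB (x i) (x j) c.
  by rewrite !h // subrr.
by move=> /(subvP sub); rewrite memv_ker lfunE /= => /eqP E; rewrite /eval E mxE.
Qed.

(** The linear functional c vanishes on the direction of S and not on the
    vector from x k to x i. *)
Lemma direction_cone S c b i k : (forall j, j \in S -> eval (x j) c = b) ->
  eval (x i) c != b -> k \in S ->
  \dim (direction (i |: S)) = (\dim (direction S)).+1.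
Proof.
move=> h ib kS; rewrite -(@dimv_add_line _ (x i - x k)); last first.
  apply/negP => /(face_direction h); rewrite evalB (h k kS) => /eqP.
  by rewrite subr_eq0 (negPf ib).
congr (\dim _); apply/eqP; rewrite eqEsubv; apply/andP; split.
  apply/direction_subP.
  have mem j : j \in i |: S -> x j - x k \in (direction S + <[x i - x k]>)%VS.
    rewrite !inE => /orP[/eqP ->|jS].
      by apply: (subvP (addvSr _ _)); apply: memv_line.
    by apply: (subvP (addvSl _ _)); apply: mem_direction.
  move=> j l jS lS; have -> : x j - x l = (x j - x k) - (x l - x k).
    by rewrite opprB addrA subrK.
  by rewrite memvB // mem.
rewrite subv_add; apply/andP; split.
  apply/direction_subP => j l jS lS; apply: mem_direction;
    by rewrite !inE ?jS ?lS orbT.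
by rewrite -memvE mem_direction // !inE ?eqxx // kS orbT.
Qed.

Lemma direction_mono S T : (forall i, i \in S -> i \in T) ->
  (direction S <= direction T)%VS.
Proof.
by move=> ST; apply/direction_subP => i j iS jS; apply: mem_direction; apply: ST.
Qed.

Lemma face_dim_lt T S : face_set x T S -> (exists i, i \in S) ->
  (exists2 i, i \in T & i \notin S) -> (\dim (direction S) < \dim (direction T))%N.
Proof.
move=> [ST [c [b h]]] [k kS] [i iT iS].
have hS j : j \in S -> eval (x j) c = b.
  by move=> jS; apply/eqP; have [_ ->] := h j (ST j jS).
have ib : eval (x i) c != b by have [_ ->] := h i iT.
rewrite -(direction_cone hS ib kS); apply/dimvS/direction_mono => j.
by rewrite !inE => /orP[/eqP ->|/ST].
Qed.

Lemma position_between T i j k t : vertex_position x T -> i \in T -> j \in T ->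
  k \in T -> k != i -> k != j -> 0 <= t -> t <= 1 ->
  x k = t *: x i + (1 - t) *: x j -> False.
Proof.
move=> pos iT jT kT ki kj t0 t1 E; have [_ [c [b h]]] := pos k kT.
have [_ hk] := h k kT; have [li hi] := h i iT; have [lj hj] := h j jT.
move: hk hi hj; rewrite !inE eqxx (eq_sym i) (negPf ki) (eq_sym j) (negPf kj).
move=> /eqP hk hi hj.
have li' : eval (x i) c < b by rewrite lt_neqAle hi.
have lj' : eval (x j) c < b by rewrite lt_neqAle hj.
have : t * (b - eval (x i) c) + (1 - t) * (b - eval (x j) c) = 0.
  have := congr1 (fun z => eval z c) E; rewrite evalD !evalZ hk => E'.
  transitivity (b - (t * eval (x i) c + (1 - t) * eval (x j) c)); first by ring.
  by rewrite -E' subrr.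
have p1 : 0 <= t * (b - eval (x i) c) by rewrite mulr_ge0 // subr_ge0 ltW.
have p2 : 0 <= (1 - t) * (b - eval (x j) c) by rewrite mulr_ge0 ?subr_ge0 // ltW.
move=> s0; have /eqP z1 : t * (b - eval (x i) c) = 0 by lra.
have /eqP z2 : (1 - t) * (b - eval (x j) c) = 0 by lra.
move: z1 z2; rewrite !mulf_eq0 ![b - _ == 0]gt_eqF ?subr_gt0 // !orbF.
by move=> /eqP ->; rewrite subr0 oner_eq0.
Qed.

(** The middle one of three collinear points is not exposed. *)
Lemma position_not_collinear T i j k t : vertex_position x T -> i \in T -> j \in T ->
  k \in T -> i != j -> k != i -> k != j -> x k - x j = t *: (x i - x j) -> False.
Proof.
move=> pos iT jT kT ij ki kj E.
have Ek : x k = t *: x i + (1 - t) *: x j.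
  by rewrite -(subrK (x j) (x k)) E scalerBr scalerBl scale1r addrAC addrA.
have [t0|t0] := leP 0 t; last first.
  apply: (@position_between T k i j (1 / (1 - t)) pos kT iT jT); rewrite 1?eq_sym //.
  - by apply: divr_ge0; lra.
  - by rewrite ler_pdivrMr; lra.
  - have t1 : 1 - t != 0 by apply/eqP; lra.
    by apply/rowP => l; rewrite Ek !mxE; field.
have [t1|t1] := leP t 1; first exact: (position_between pos iT jT kT ki kj t0 t1 Ek).
have ik : i != k by rewrite eq_sym.
apply: (@position_between T k j i (1 / t) pos kT jT iT ik ij).
- by apply: divr_ge0; lra.
- by rewrite ler_pdivrMr; lra.
- have t1' : t != 0 by apply/eqP; lra.
  by apply/rowP => l; rewrite Ek !mxE; field.
Qed.

Lemma adjacent_hull T i j : vertex_position x T -> i \in T -> j \in T ->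
  adjacent (hull T) (x i) (x j) <-> i != j /\ face_set x T [set i; j]%SET.
Proof.
move=> pos iT jT; split.
  move=> [_ _ xij [E [fE dE] [Ei Ej]]].
  have ij : i != j by apply/eqP => ij; apply: xij; rewrite ij.
  split=> //; have [S fS ES] := proj1 (faces_hull _ _ _) fE.
  have iS : i \in S by apply: (hull_face_mem fS) => //; rewrite -ES.
  have jS : j \in S by apply: (hull_face_mem fS) => //; rewrite -ES.
  suff -> : [set i; j]%SET = S by [].
  apply/setP => k; rewrite !inE; apply/idP/idP => [/orP[] /eqP -> //|kS].
  apply/negPn/negP; rewrite negb_or => /andP[ki kj].
  have [ST _] := fS; have kT := ST k kS.
  rewrite ES in dE; have [_ dS] := proj1 (has_dim_hull _ _) dE.
  have sub : (<[x i - x j]> <= direction S)%VS by rewrite -memvE mem_direction.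
  have nz : x i - x j != 0 by rewrite subr_eq0; apply/eqP.
  have := eqEdim <[x i - x j]>%VS (direction S).
  rewrite sub dim_vline nz dS leqnn => /eqP Eq.
  have := mem_direction kS jS; rewrite -Eq => /vlineP[t Et].
  exact: (position_not_collinear pos iT jT kT ij ki kj Et).
move=> [ij fE]; have vi k : k \in T -> vertices (hull T) (x k).
  by move=> kT; rewrite vertices_hull //; exists k.
have xij : x i <> x j by move=> /(position_inj pos iT jT) E; rewrite E eqxx in ij.
split=> //; try exact: vi.
exists (hull [set i; j]%SET); last first.
  by split; apply: mem_hull; rewrite !inE eqxx ?orbT.
split; first by apply/faces_hull; exists [set i; j]%SET.
apply/has_dim_hull; split; first by exists i; rewrite !inE eqxx.
have -> : direction [set i; j]%SET = <[x i - x j]>%VS.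
  apply/eqP; rewrite eqEsubv -memvE mem_direction ?inE ?eqxx ?orbT // andbT.
  apply/direction_subP => k l; rewrite !inE.
  move=> /orP[] /eqP -> /orP[] /eqP ->; rewrite ?subrr ?mem0v ?memv_line //.
  by rewrite -opprB memvN memv_line.
by rewrite dim_vline subr_eq0; case: eqP.
Qed.

End Direction.

(** * Polytopes as hulls of their vertices *)

Section Reindex.
Variables (R : realType) (n : nat) (I J : finType) (x : I -> 'rV[R]_n) (h : J -> I).
Hypothesis hinj : injective h.
Implicit Types (S T : {set J}).

Lemma hull_comp T : hull (x \o h) T = hull x (h @: T).
Proof.
apply/seteqP; split; apply: hull_min; try exact: conv_hull_convex.
  by move=> j jT; apply: mem_hull; apply: imset_f.
by move=> _ /imsetP[j jT ->]; exact: (@mem_hull _ _ _ (x \o h) T j jT).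
Qed.

Lemma face_set_comp T S : face_set (x \o h) T S <-> face_set x (h @: T) (h @: S).
Proof.
split=> -[ST [c [b H]]].
  split; first by move=> _ /imsetP[j jS ->]; apply: imset_f; apply: ST.
  by exists c, b => _ /imsetP[j jT ->]; rewrite mem_imset //; apply: H.
split=> [j jS|].
  by have := ST (h j) (imset_f h jS); rewrite mem_imset.
by exists c, b => j jT; have := H (h j) (imset_f h jT); rewrite mem_imset.
Qed.

Lemma vertex_position_comp T : vertex_position x (h @: T) -> vertex_position (x \o h) T.
Proof.
by move=> pos j jT; apply/face_set_comp; rewrite imset_set1; apply/pos/imset_f.
Qed.

End Reindex.

Lemma card_finset (I : finType) (T : {set I}) : [set` T] #= `I_#|T|.
Proof.
have -> : [set` T] = @enum_val I (mem T) @` [set: 'I_#|T|].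
  apply/seteqP; split=> [i iT|_ [k _ <-]]; last exact: enum_valP.
  by exists (enum_rank_in iT i); rewrite ?enum_rankK_in.
rewrite (card_eqr card_II); apply: inj_card_eq => i j _ _; exact: enum_val_inj.
Qed.

Lemma card_image_finset (U : Type) (I : finType) (T : {set I}) (f : I -> U) :
  (forall i j, i \in T -> j \in T -> f i = f j -> i = j) -> (f @` [set` T]) #= `I_#|T|.
Proof.
move=> finj; rewrite -(card_eqr (card_finset T)).
by apply: inj_card_eq => i j /set_mem iT /set_mem jT; apply: finj.
Qed.

Section Polytope.
Variables (R : realType) (n : nat).

Lemma evalN (v : 'rV[R]_n) c : eval v (- c) = - eval v c.
Proof. by rewrite /eval mulmxN mxE. Qed.

Lemma eval_row1 (v : 'rV[R]_n) (C : 'cV[R]_(n + 1)) :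
  eval (row_mx v (const_mx 1 : 'rV_1)) C = eval v (usubmx C) + dsubmx C 0 0.
Proof.
rewrite /eval -{1}[C]vsubmxK mul_row_col mxE; congr (_ + _).
by rewrite mxE big_ord1 mxE mul1r.
Qed.

(** The Farkas lemma for the points with an additional coordinate 1. *)
Lemma separation (I : finType) (x : I -> 'rV[R]_n) (T : {set I}) (z : 'rV[R]_n) :
  ~ hull x T z -> exists c, forall i, i \in T -> eval (x i) c < eval z c.
Proof.
move=> zT; pose one : 'rV[R]_1 := const_mx 1.
have [[k k0 E]|[C hT hz]] := farkas T (fun i => row_mx (x i) one) (row_mx z one).
  exfalso; apply: zT.
  have E' : row_mx z one = row_mx (\sum_(j in T) k j *: x j)
      (const_mx (\sum_(j in T) k j)) :> 'rV_(n + 1).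
    rewrite E; apply/rowP => l; rewrite summxE.
    case: (splitP l) => j lj.
      have -> : l = lshift 1 j by apply/val_inj.
      rewrite row_mxEl summxE; apply: eq_bigr => i _.
      by rewrite [LHS]mxE row_mxEl [RHS]mxE.
    have -> : l = rshift n j by apply/val_inj.
    rewrite row_mxEr mxE; apply: eq_bigr => i _.
    by rewrite mxE row_mxEr /one mxE mulr1.
  have [Ez /rowP/(_ 0)] := eq_row_mx E'; rewrite !mxE => E1.
  apply/hullP; exists (fun i => if i \in T then k i else 0); split.
  - by move=> i; case: ifP.
  - by move=> i /negPf ->.
  - by rewrite -big_mkcond.
  - rewrite Ez big_mkcond; apply: eq_bigr => i _; case: ifP => //.
    by rewrite scale0r.
exists (- usubmx C) => i iT; rewrite !evalN ltrN2.
have := hT i iT; rewrite !eval_row1 in hz * => hi; lra.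
Qed.

(** In a generating family of minimal size, each point is separated from the
    hull of the others, hence exposed. *)
Lemma polytope_hull d (P : set 'rV[R]_n) : dpolytope d P ->
  exists k (y : 'I_k -> 'rV[R]_n) (T : {set 'I_k}),
    P = hull y T /\ vertex_position y T.
Proof.
move=> [[S0 /finite_seqP[s ->] PE] _].
pose y (i : 'I_(size s)) := nth 0 s i.
have PT : P = hull y [set: 'I_(size s)]%SET.
  rewrite PE /hull; congr conv_hull; apply/seteqP; split=> [z /= zs|_ [i _ <-]].
    have iz : (index z s < size s)%N by rewrite index_mem.
    by exists (Ordinal iz); rewrite ?inE //= /y /= nth_index.
  exact: mem_nth.
have [|T /asboolP TP Tmin] := @arg_minnP _ [set: 'I_(size s)]%SET
  (fun T : {set _} => `[< P = hull y T >]) (fun T : {set _} => #|T|).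
  exact/asboolP.
exists (size s), y, T; split=> // i iT; split; first by move=> j; rewrite inE => /eqP ->.
have nin : ~ hull y (T :\ i)%SET (y i).
  move=> hi; have : (#|T| <= #|T :\ i|)%N.
    apply: Tmin; apply/asboolP; rewrite TP; apply/seteqP; split.
      apply: hull_min; first exact: conv_hull_convex.
      move=> j jT; have [-> //|ji] := eqVneq j i.
      by apply: mem_hull; rewrite !inE ji.
    by apply: hull_mono => j; rewrite !inE => /andP[].
  by rewrite [X in (X <= _)%N](cardsD1 i) iT ltnn.
have [c hc] := separation nin; exists c, (eval (y i) c) => j jT; rewrite inE.
have [->|ji] := eqVneq j i; first by rewrite lexx eqxx.
have lt : eval (y j) c < eval (y i) c by apply: hc; rewrite !inE ji.
by rewrite ltW // lt_eqF.
Qed.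

Lemma polytope_vertices d (P : set 'rV[R]_n) : dpolytope d P ->
  P = conv_hull (vertices P).
Proof.
move=> /polytope_hull[k [y [T [PE pos]]]].
by rewrite {2}PE (vertices_hull pos).
Qed.

Lemma polytope_indexed d N (P : set 'rV[R]_n) : dpolytope d P ->
  vertices P #= `I_N -> exists x : 'I_N -> 'rV[R]_n,
    P = hull x [set: 'I_N]%SET /\ vertex_position x [set: 'I_N]%SET.
Proof.
move=> /polytope_hull[k [y [T [PE pos]]]] cN.
have TN : #|T| = N.
  apply/(@card_eq_II _ _); rewrite -(card_eqr cN) PE vertices_hull //.
  by rewrite card_eq_sym; apply: card_image_finset; apply: position_inj.
subst N; exists (y \o @enum_val _ (mem T)).
have TE : (@enum_val _ (mem T) @: [set: 'I_#|T|]%SET = T)%SET.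
  apply/setP => i; apply/imsetP/idP => [[j _ ->]|iT]; first exact: enum_valP.
  by exists (enum_rank_in iT i); rewrite ?inE ?enum_rankK_in.
split; first by rewrite hull_comp TE.
apply: vertex_position_comp; first exact: enum_val_inj.
by rewrite TE.
Qed.

End Polytope.

(** * Gale duality *)

Section Gale.
Variables (R : realType) (n : nat) (I : finType) (x : I -> 'rV[R]_n).
Implicit Types (T S : {set I}) (p q : I -> R).

(** The affine functions on the points, restricted to T, are the solutions of
    the two equations with coefficients p and q.  Keeping the index type fixed
    and letting T shrink makes it easy to drop the apex of a pyramid. *)
Definition gale T p q : Prop := forall y : I -> R, (forall i, i \notin T -> y i = 0) ->
  ((\sum_i y i * p i = 0 /\ \sum_i y i * q i = 0) <->
   exists c b, forall i, i \in T -> y i = b - eval (x i) c).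

Lemma gale_face T p q S : gale T p q ->
  face_set x T S <-> (forall i, i \in S -> i \in T) /\ coface p q (T :\: S).
Proof.
move=> G; split.
  move=> [ST [c [b h]]]; split=> //.
  pose y i := if i \in T then b - eval (x i) c else 0.
  have [|yp yq] := proj2 (G y (fun i iT => ifN _ _ iT)).
    by exists c, b => i iT; rewrite /y iT.
  exists y; split=> // i; rewrite /y.
    by case: ifP => // iT; rewrite subr_ge0; have [] := h i iT.
  rewrite finset.in_setD; case: ifP => iT; last by rewrite ltxx andbF.
  have [le eqE] := h i iT.
  by rewrite subr_gt0 lt_neqAle le eqE !andbT.
move=> [ST [y [y0 yC yp yq]]]; split=> //.
have yT i : i \notin T -> y i = 0.
  move=> iT; apply/eqP; rewrite eq_le y0 leNgt yC finset.in_setD.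
  by rewrite (negPf iT) andbF.
have [c [b h]] := proj1 (G y yT) (conj yp yq).
exists c, b => i iT; have yE := h i iT.
have -> : eval (x i) c = b - y i by rewrite yE opprB addrC subrK.
split; first by rewrite gerBl.
rewrite -subr_eq0 addrAC subrr add0r oppr_eq0.
have := yC i; rewrite finset.in_setD iT andbT => yS.
by apply/negb_inj; rewrite -yS lt_neqAle y0 andbT eq_sym.
Qed.

(** The value at i does not enter the equations, hence can be chosen to agree
    with an affine function on the other points. *)
Lemma gale_zero T p q i : gale T p q -> i \in T -> zero_vec p q i ->
  gale (T :\ i) p q.
Proof.
move=> G iT /andP[/eqP pi /eqP qi] y yT.
have yT' j : j \notin T -> y j = 0.
  by move=> jT; apply: yT; rewrite !inE (negPf jT) andbF.
split=> [h|[c [b h]]].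
  have [c [b H]] := proj1 (G y yT') h.
  by exists c, b => j; rewrite !inE => /andP[_ /H].
pose z j := if j == i then b - eval (x i) c else y j.
have zT j : j \notin T -> z j = 0.
  move=> jT; rewrite /z; case: eqP => [ji|_]; last exact: yT'.
  by rewrite ji iT in jT.
have [|zp zq] := proj2 (G z zT).
  exists c, b => j jT; rewrite /z; case: eqP => [-> //|/eqP ji].
  by apply: h; rewrite !inE ji.
have E (f : I -> R) : f i = 0 -> \sum_j y j * f j = \sum_j z j * f j.
  move=> fi; apply: eq_bigr => j _; rewrite /z; case: eqP => // ->.
  by rewrite fi !mulr0.
by rewrite !E.
Qed.

End Gale.

Section GaleReindex.
Variables (R : realType) (n : nat) (I J : finType) (x : I -> 'rV[R]_n) (h : J -> I).
Hypothesis hinj : injective h.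

Lemma gale_comp (p q : I -> R) : gale x (h @: [set: J]%SET) p q ->
  gale (x \o h) [set: J]%SET (p \o h) (q \o h).
Proof.
move=> G y _.
pose z i := if [pick j | h j == i] is Some j then y j else 0.
have zh j : z (h j) = y j.
  rewrite /z; case: pickP => [k /eqP/hinj -> //|/(_ j)].
  by rewrite eqxx.
have zT i : i \notin h @: [set: J]%SET -> z i = 0.
  rewrite /z; case: pickP => // j /eqP <-.
  by rewrite imset_f // inE.
have E (f : I -> R) : \sum_j y j * f (h j) = \sum_i z i * f i.
  rewrite (bigID [in h @: [set: J]%SET]) /= [X in _ + X]big1 ?addr0; last first.
    by move=> i /zT ->; rewrite mul0r.
  rewrite big_imset /=; last by move=> i j _ _; apply: hinj.
  rewrite [RHS](eq_bigl xpredT); last by move=> j; rewrite inE.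
  by apply: eq_bigr => j _; rewrite zh.
rewrite !E; have := G z zT => H; split.
  move=> /(proj1 H)[c [b hz]]; exists c, b => j _.
  by rewrite -zh; apply: hz; rewrite imset_f ?inE.
move=> [c [b hy]]; apply/H; exists c, b => _ /imsetP[j _ ->].
by rewrite zh; apply: hy; rewrite inE.
Qed.

End GaleReindex.

Section GaleMatrix.
Variables (R : realType) (n N : nat) (x : 'I_N -> 'rV[R]_n).

(** Its column space consists of the affine functions on the points. *)
Definition homog : 'M[R]_(N, n + 1) := row_mx (\matrix_i x i) (const_mx 1).

Lemma row_homog i : row i homog = row_mx (x i) (const_mx 1).
Proof. by rewrite row_row_mx rowK row_const. Qed.

Definition row_space m k (M : 'M[R]_(m, k)) : {vspace 'rV[R]_k} :=
  limg (linfun (mulmxr (row_base M) : 'rV[R]_(\rank M) -> 'rV[R]_k)).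

Lemma dim_row_space m k (M : 'M[R]_(m, k)) : \dim (row_space M) = \rank M.
Proof.
rewrite limg_dim_eq; first by rewrite dimvf dim_matrix; exact: mul1n.
apply/eqP; rewrite -subv0; apply/subvP => v.
rewrite memv_cap => /andP[_]; rewrite memv_ker lfunE memv0 /=.
move=> /eqP E; apply/eqP; apply: (row_free_inj (row_base_free M)).
by rewrite E mul0mx.
Qed.

Lemma mem_row_space m k (M : 'M[R]_(m, k)) v :
  (v \in row_space M) = (v <= M)%MS.
Proof.
rewrite -(eq_row_base M); apply/idP/idP.
  by move=> /memv_imgP[u _ ->]; rewrite lfunE /= submxMl.
by move=> /submxP[D ->]; apply/memv_imgP; exists D; rewrite ?memvf ?lfunE.
Qed.

(** The row space is spanned by the direction, in the hyperplane where the
    last coordinate is 0, and one point of the hyperplane where it is 1. *)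
Lemma rank_homog (i0 : 'I_N) : \rank homog = (\dim (direction x [set: 'I_N]%SET)).+1.
Proof.
rewrite -dim_row_space.
set V := row_space _; have memV v : (v \in V) = (v <= homog)%MS by exact: mem_row_space.
pose io : 'Hom('rV[R]_n, 'rV[R]_(n + 1)) := linfun (mulmxr (row_mx 1%:M 0) : 'rV[R]_n -> 'rV[R]_(n + 1)).
have ioE v : io v = row_mx v 0 by rewrite lfunE /= mul_mx_row mulmx1 mulmx0.
have rowV i : row_mx (x i) (const_mx 1) \in V by rewrite memV -row_homog row_sub.
have U : (direction x [set: 'I_N]%SET <= io @^-1: V)%VS.
  apply/direction_subP => i j _ _; rewrite -memv_preim ioE.
  rewrite (_ : row_mx _ _ = row_mx (x i) (const_mx 1) - row_mx (x j) (const_mx 1)).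
    by rewrite memvB.
  by rewrite opp_row_mx add_row_mx subrr.
have -> : V = (io @: direction x [set: 'I_N]%SET + <[row_mx (x i0) (const_mx 1)]>)%VS.
  apply/eqP; rewrite eqEsubv; apply/andP; split; last first.
    rewrite subv_add -memvE rowV andbT; apply/subvP => _ /memv_imgP[u /(subvP U) + ->].
    by rewrite -memv_preim.
  apply/subvP => v; rewrite memV => /submxP[D ->].
  rewrite mulmx_sum_row; apply: memv_suml => i _; rewrite memvZ // row_homog.
  have -> : row_mx (x i) (const_mx 1) = io (x i - x i0) + row_mx (x i0) (const_mx 1).
    by rewrite ioE add_row_mx subrK add0r.
  by rewrite memv_add ?memv_line // memv_img // mem_direction ?inE.
rewrite dimv_add_line; last first.
  apply/negP => /memv_imgP[u _]; rewrite ioE => /eq_row_mx[_ /rowP/(_ 0)].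
  by rewrite !mxE => /eqP; rewrite oner_eq0.
rewrite limg_dim_eq //; apply/eqP; rewrite -subv0; apply/subvP => v.
rewrite memv_cap => /andP[_]; rewrite memv_ker ioE memv0 => /eqP E.
by have := congr1 lsubmx E; rewrite row_mxKl => ->; rewrite linear0.
Qed.

Lemma homog_mul (C : 'cV[R]_(n + 1)) i :
  (homog *m C) i 0 = dsubmx C 0 0 - eval (x i) (- usubmx C).
Proof.
rewrite evalN opprK addrC -eval_row1 /eval -row_homog -row_mul.
by rewrite [RHS]mxE.
Qed.

Lemma affine_colspace (y : 'I_N -> R) :
  (exists c b, forall i, i \in [set: 'I_N]%SET -> y i = b - eval (x i) c) <->
  exists C, \col_i y i = homog *m C.
Proof.
split=> [[c [b h]]|[C E]].
  exists (col_mx (- c) (const_mx b)); apply/colP => i.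
  by rewrite mxE homog_mul col_mxKu col_mxKd mxE opprK h ?inE.
exists (- usubmx C), (dsubmx C 0 0) => i _.
by rewrite -homog_mul -E mxE.
Qed.

Definition gale_mx (p q : 'I_N -> R) : 'M[R]_(2, N) :=
  \matrix_(k, j) (if k == 0 then p j else q j).

Lemma gale_mx_mul p q y :
  (\sum_i y i * p i = 0 /\ \sum_i y i * q i = 0) <->
  gale_mx p q *m \col_i y i = 0.
Proof.
have E0 : (gale_mx p q *m \col_i y i) 0 0 = \sum_i y i * p i.
  by rewrite mxE; apply: eq_bigr => i _; rewrite !mxE mulrC.
have E1 : (gale_mx p q *m \col_i y i) 1 0 = \sum_i y i * q i.
  by rewrite mxE; apply: eq_bigr => i _; rewrite !mxE mulrC.
split=> [[h0 h1]|E]; last by rewrite -E0 -E1 E !mxE.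
apply/colP => k; rewrite [RHS]mxE.
by case: (unliftP 0 k) => [j ->|->]; rewrite ?E0 // ord1 -h1 -E1; congr (_ _ _); apply/val_inj.
Qed.

(** Here p and q form a basis of the left kernel of [homog], whose dimension
    is d + 3 - (d + 1) = 2. *)
Lemma gale_exists d : N = (d + 3)%N -> has_dim (hull x [set: 'I_N]%SET) d ->
  exists p q, gale x [set: 'I_N]%SET p q.
Proof.
move=> Nd /has_dim_hull[[i0 _] dimd].
have rkA : \rank homog = d.+1 by rewrite (rank_homog i0) dimd.
have rkK : \rank (kermx homog) = 2 by rewrite mxrank_ker rkA Nd; lia.
move: (row_base (kermx homog)) (eq_row_base (kermx homog)) (row_base_free (kermx homog)).
rewrite rkK => K KE Kfree.
have KA : K *m homog = 0 by apply/sub_kermxP; rewrite KE.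
have AK : (kermx K^T <= homog^T)%MS.
  have sub : (homog^T <= kermx K^T)%MS.
    by apply/sub_kermxP; rewrite -trmx_mul KA trmx0.
  rewrite -(geq_leqif (mxrank_leqif_sup sub)) mxrank_ker !mxrank_tr rkA.
  by move/eqP: Kfree => ->; rewrite Nd; lia.
exists (K 0), (K 1) => y _; rewrite gale_mx_mul affine_colspace.
have -> : gale_mx (K 0) (K 1) = K.
  apply/matrixP => k j; rewrite mxE; case: (unliftP 0 k) => [l ->|-> //].
  by rewrite ord1 /=; congr (K _ _); apply/val_inj.
split=> [E|[C ->]]; last by rewrite mulmxA KA mul0mx.
have yK : ((\col_i y i)^T <= kermx K^T)%MS.
  by apply/sub_kermxP; rewrite -trmx_mul E trmx0.
have /submxP[D /(congr1 trmx)] := submx_trans yK AK; rewrite trmxK trmx_mul trmxK => ->.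
by exists D^T.
Qed.

End GaleMatrix.

(** The points are the rows of a matrix whose columns span the solutions of
    the two equations; the constants are solutions because p and q sum to 0. *)
Lemma gale_realize (R : realType) d (p q : 'I_(d + 3) -> R) :
  \sum_i p i = 0 -> \sum_i q i = 0 -> \rank (gale_mx p q) = 2 ->
  exists x : 'I_(d + 3) -> 'rV[R]_(d + 3),
    gale x [set: 'I_(d + 3)]%SET p q /\ has_dim (hull x [set: 'I_(d + 3)]%SET) d.
Proof.
move=> sp sq rkK; pose K := gale_mx p q.
pose X := kermx K^T; pose x i := (col i X)^T : 'rV_(d + 3).
have xE : \matrix_i x i = X^T by apply/row_matrixP => i; rewrite rowK /x tr_col.
have K1 : K *m (const_mx 1 : 'cV_(d + 3)) = 0.
  have -> : const_mx 1 = \col_(i < d + 3) 1 :> 'cV[R]_(d + 3).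
    by apply/colP => i; rewrite !mxE.
  by apply/(gale_mx_mul p q (fun=> 1)); split;
    [rewrite -[RHS]sp | rewrite -[RHS]sq]; apply: eq_bigr => i _; rewrite mul1r.
have KX : K *m X^T = 0 by rewrite -[K]trmxK -trmx_mul mulmx_ker trmx0.
have KH : K *m homog x = 0 by rewrite mul_mx_row xE KX K1 row_mx0.
exists x; have G : gale x [set: 'I_(d + 3)]%SET p q.
  move=> y _; rewrite gale_mx_mul affine_colspace; split=> [E|[C ->]]; last first.
    by rewrite mulmxA -/K KH mul0mx.
  have /submxP[D /(congr1 trmx)] : ((\col_i y i)^T <= X)%MS.
    by apply/sub_kermxP; rewrite -trmx_mul E trmx0.
  rewrite trmxK trmx_mul => ->; exists (col_mx D^T 0).
  by rewrite mul_row_col mulmx0 addr0 xE.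
split=> //; have i0 : 'I_(d + 3) by rewrite addnS; exact: ord0.
apply/has_dim_hull; split; first by exists i0; rewrite inE.
suff : \rank (homog x) = d.+1 by rewrite (rank_homog x i0) => -[].
have -> : d.+1 = \rank X by rewrite mxrank_ker mxrank_tr -/K rkK; lia.
apply/eqP; rewrite eqn_leq -{1}(mxrank_tr (homog x)); apply/andP; split.
  by apply/mxrankS/sub_kermxP; rewrite -trmx_mul KH trmx0.
have -> : \rank X = \rank (homog x *m col_mx 1%:M 0).
  by rewrite mul_row_col mulmx1 mulmx0 addr0 xE mxrank_tr.
exact: mxrankM_maxl.
Qed.

(** * Combinatorics of a polytope from its Gale vectors *)

Section LatticeIso.
Variables (R : realType) (n m : nat) (I : finType).
Variables (x : I -> 'rV[R]_n) (x' : I -> 'rV[R]_m).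
Local Notation T := [set: I]%SET.
Hypothesis pos : vertex_position x T.
Hypothesis same : forall S, face_set x T S <-> face_set x' T S.

Lemma lattice_iso : exists2 psi, face_lattice_iso (hull x T) (hull x' T) psi &
  forall i, psi [set x i] = [set x' i].
Proof.
pose psi (F : set 'rV[R]_n) := hull x' [set i | `[< F (x i) >]]%SET.
have psiE S : face_set x T S -> psi (hull x S) = hull x' S.
  move=> fS; congr (hull x' _); apply/setP => i; rewrite inE.
  apply/asboolP/idP => [|iS]; last exact: mem_hull.
  by apply: (hull_face_mem fS); rewrite inE.
exists psi; last first.
  by move=> i; rewrite -!hull_set1 psiE //; apply: pos; rewrite inE.
split.
  split.
  - move=> F /faces_hull[S fS ->]; rewrite psiE //; apply/faces_hull.
    by exists S => //; apply/same.
  - move=> F G /set_mem/faces_hull[S fS ->] /set_mem/faces_hull[S' fS' ->].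
    rewrite !psiE // => E.
    by rewrite (face_set_inj (proj1 (same S) fS) (proj1 (same S') fS') E).
  - move=> F /faces_hull[S /same fS ->]; exists (hull x S); rewrite /= ?psiE //.
    by apply/faces_hull; exists S.
move=> F G /faces_hull[S fS ->] /faces_hull[S' fS' ->].
rewrite !psiE // (face_set_le fS fS').
by rewrite (face_set_le (proj1 (same S) fS) (proj1 (same S') fS')).
Qed.

End LatticeIso.

Lemma comb_equiv_refl (R : realType) n (P : set 'rV[R]_n) : comb_equiv P P.
Proof.
exists id; split=> //; split=> // F FP; by exists F.
Qed.

Section Configuration.
Variables (R : realType) (n N : nat) (x : 'I_N -> 'rV[R]_n) (p q : 'I_N -> R).
Local Notation T := [set: 'I_N]%SET.
Hypothesis N2 : (1 < N)%N.
Hypotheses (pos : vertex_position x T) (G : gale x T p q).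

Lemma ord_other (i : 'I_N) : exists j, j != i.
Proof.
have N0 : (0 < N)%N by apply: ltnW.
have [i0|i0] := eqVneq i (Ordinal N0); last by exists (Ordinal N0); rewrite eq_sym.
by exists (Ordinal N2); rewrite i0.
Qed.

Lemma face_coface S : face_set x T S <-> coface p q (~: S).
Proof.
by rewrite (gale_face S G) finset.setTD; split=> [[]//|h]; split.
Qed.

Lemma config_vert i : coface p q (~: [set i]).
Proof. by apply/face_coface; apply: pos; rewrite inE. Qed.

Lemma config_adjacent i j : adjacent (hull x T) (x i) (x j) <->
  (i != j) && ~~ nonadj p q i j.
Proof.
rewrite adjacent_hull ?inE // face_coface; split.
  by move=> [ij /(coface_pair config_vert ord_other ij) ->]; rewrite ij.
by move=> /andP[ij nij]; split=> //; apply/(coface_pair config_vert ord_other ij).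
Qed.

Lemma config_inj i j : x i = x j -> i = j.
Proof. by move=> E; apply: (position_inj pos _ _ E); rewrite inE. Qed.

Lemma config_vertices v : vertices (hull x T) v <-> exists i, v = x i.
Proof.
rewrite vertices_hull //; split=> [[i _ <-]|[i ->]]; first by exists i.
by exists i; rewrite //= inE.
Qed.

Lemma nonadj_irr i : ~~ nonadj p q i i.
Proof. by rewrite /nonadj eqxx. Qed.

(** The d + 2 other vertices are the neighbours and the non-neighbours. *)
Lemma config_simple d i : N = (d + 3)%N ->
  simple_vertex d (hull x T) (x i) <-> branching (nonadj p q) i.
Proof.
move=> Nd; pose A := [set j | (i != j) && ~~ nonadj p q i j]%SET.
have E : [set u | adjacent (hull x T) (x i) u] = x @` [set` A].
  apply/seteqP; split=> [u au|_ [j + <-]]; last first.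
    by rewrite /= inE => /config_adjacent.
  have [_ /config_vertices[j uE] _ _] := au; subst u.
  by exists j => //=; rewrite inE; apply/config_adjacent.
have cA : #|A| + #|[set j | nonadj p q i j]%SET| = N.-1.
  have -> : N.-1 = #|[set~ i]%SET| by rewrite cardsC1 card_ord.
  rewrite -(cardsID [set j | nonadj p q i j]%SET [set~ i]%SET) addnC.
  congr (_ + _)%N; apply: eq_card => j; rewrite !inE.
    by rewrite andbC eq_sym.
  by have [->|] := eqVneq j i; rewrite ?(negPf (nonadj_irr i)).
have cE : ([set u | adjacent (hull x T) (x i) u] #= `I_d) <-> #|A| = d.
  rewrite E; have h : (x @` [set` A]) #= `I_#|A|.
    by apply: card_image_finset => j k _ _; apply: config_inj.
  by rewrite (card_eql h); split=> [/card_eq_II|->].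
rewrite /branching; split=> [[_ /cE h]|/eqP h].
  by apply/eqP; move: cA Nd; rewrite h; lia.
split; first by apply/config_vertices; exists i.
by apply/cE; move: cA Nd; rewrite h; lia.
Qed.

Lemma config_nonsimple d : N = (d + 3)%N -> nonsimple_vertices d (hull x T) =
  x @` [set` [set i | ~~ branching (nonadj p q) i]%SET].
Proof.
move=> Nd; apply/seteqP; split=> [v|_ [i + <-]].
  move=> [/config_vertices[i ->] ns]; exists i => //=; rewrite inE.
  by apply/negP => /(config_simple _ Nd).
rewrite /= inE => bi; split; first by apply/config_vertices; exists i.
by move=> /(config_simple _ Nd); apply/negP.
Qed.

Lemma config_nonsimple_card d : N = (d + 3)%N -> nonsimple_vertices d (hull x T)
  #= `I_#|[set i | ~~ branching (nonadj p q) i]%SET|.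
Proof.
move=> Nd; rewrite config_nonsimple //.
by apply: card_image_finset => j k _ _; apply: config_inj.
Qed.

End Configuration.

Lemma pentagon_or_path_vectors (R : realType) N (p q : 'I_N -> R) : (1 < N)%N ->
  (forall i, coface p q (~: [set i])) ->
  (4 <= #|[set i | branching (nonadj p q) i]%SET|)%N ->
  (exists a b c d e, uniq [:: a; b; c; d; e] /\ pentagon_in a b c d e p q) \/
  (exists p0 p1 p2 p3 p4 p5, uniq [:: p0; p1; p2; p3; p4; p5] /\
    [/\ nonadj p q p0 p1, nonadj p q p1 p2, nonadj p q p2 p3,
       nonadj p q p3 p4 & nonadj p q p4 p5]).
Proof.
move=> N2 vert; have bal := vert_balanced vert (ord_other N2).
apply: pentagon_or_path.
- exact: nonadj_sym.
- exact: nonadj_irr.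
- exact: nonadj_deg2.
- exact: nonadj_triangle.
- exact: nonadj_square.
- move=> a b c d e f U ab cd ef ba bc be y z yz; apply/negPn/negP => yo.
  have ext u v : branching (nonadj p q) u -> nonadj p q u v -> extendable p q u v.
    move=> bu uv; have [w wv uw] := branching_other v bu.
    by exists u, w; rewrite eqxx wv.
  have := nonadj_nz yz; rewrite (matching_zero U) //; exact: ext.
Qed.

Lemma polytope_config (R : realType) n d (P : set 'rV[R]_n) : dpolytope d P ->
  vertices P #= `I_(d + 3) -> exists (x : 'I_(d + 3) -> 'rV[R]_n) p q,
  [/\ P = hull x [set: 'I_(d + 3)]%SET, vertex_position x [set: 'I_(d + 3)]%SET &
      gale x [set: 'I_(d + 3)]%SET p q].
Proof.
move=> dP cP; have [x [PE pos]] := polytope_indexed dP cP.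
have [_ dimP] := dP; rewrite PE in dimP.
have [p [q G]] := gale_exists erefl dimP.
by exists x, p, q.
Qed.

(** When d = 0 the truncated bound d - 1 would leave three vertices only, but
    a polytope of dimension 0 does not have three vertices. *)
Lemma four_branching (R : realType) n d (x : 'I_(d + 3) -> 'rV[R]_n) p q :
  vertex_position x [set: 'I_(d + 3)]%SET -> gale x [set: 'I_(d + 3)]%SET p q ->
  has_dim (hull x [set: 'I_(d + 3)]%SET) d ->
  nonsimple_vertices d (hull x [set: 'I_(d + 3)]%SET) #<= `I_(d - 1) ->
  (4 <= #|[set i | branching (nonadj p q) i]%SET|)%N.
Proof.
move=> pos G /has_dim_hull[_ dimd].
have N2 : (1 < d + 3)%N by rewrite addnC.
rewrite (card_le_eql (config_nonsimple_card N2 pos G erefl)) card_le_II => le.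
have [d0|d0] := posnP d.
  have i0 : 'I_(d + 3) by exact: (Ordinal (ltnW N2)).
  have [j ji] := ord_other N2 i0; exfalso; move/negP: ji; apply; apply/eqP.
  apply: (config_inj pos); apply/eqP; rewrite -subr_eq0 -memv0.
  have /eqP : \dim (direction x [set: 'I_(d + 3)]%SET) = 0%N by rewrite dimd.
  by rewrite dimv_eq0 => /eqP <-; apply: mem_direction; rewrite inE.
have : #|[set i | branching (nonadj p q) i]%SET| +
   #|[set i | ~~ branching (nonadj p q) i]%SET| = (d + 3)%N.
  rewrite -[RHS]card_ord -(cardsC [set i | branching (nonadj p q) i]%SET).
  by congr (_ + _)%N; apply: eq_card => i; rewrite !inE.
lia.
Qed.

(** * Reconstruction from the graph *)

Section Rigidity.
Variables (R : realType) (N : nat).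
Local Notation T := [set: 'I_N]%SET.
Hypothesis N2 : (1 < N)%N.

(** The cofaces are given by a rule that depends only on the nonadjacent
    pairs. *)
Lemma coface_rigid (p q p' q' : 'I_N -> R) :
  (forall i, coface p q (~: [set i])) -> (forall i, coface p' q' (~: [set i])) ->
  nonadj p q =2 nonadj p' q' ->
  (4 <= #|[set i | branching (nonadj p q) i]%SET|)%N ->
  forall C, coface p q C <-> coface p' q' C.
Proof.
move=> vert vert' nn four C.
have [|] := pentagon_or_path_vectors N2 vert four.
  move=> [a [b [c [d [e [U pin]]]]]].
  have pin' : pentagon_in a b c d e p' q' by case: pin => *; split; rewrite -nn.
  split; first exact: (pentagon_coface U vert vert' nn pin).
  by apply: (pentagon_coface U vert' vert _ pin') => i j; rewrite nn.
move=> [p0 [p1 [p2 [p3 [p4 [p5 [U [h1 h2 h3 h4 h5]]]]]]]].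
rewrite (path_cofaceP U h1 h2 h3 h4 h5).
rewrite nn in h1; rewrite nn in h2; rewrite nn in h3; rewrite nn in h4.
by rewrite nn in h5; rewrite (path_cofaceP U h1 h2 h3 h4 h5) nn.
Qed.

End Rigidity.

Lemma vertices_position (R : realType) n (I : finType) (x : I -> 'rV[R]_n) :
  injective x -> (forall i, vertices (hull x [set: I]%SET) (x i)) ->
  vertex_position x [set: I]%SET.
Proof.
move=> xinj vx i _; have [S fS E] := proj1 (faces_hull _ _ _) (vx i).
suff -> : [set i]%SET = S by [].
have Si j : j \in S -> j = i.
  by move=> jS; have := mem_hull (x := x) jS; rewrite -E => /xinj.
have [j jS] : exists j, j \in S by apply: (hull_nonempty (x := x)); rewrite -E; exists (x i).
apply/setP => k; rewrite inE; apply/eqP/idP => [->|/Si //].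
by rewrite -(Si j jS).
Qed.

Lemma few_nonsimple_reconstructible (R : realType) n d (P : set 'rV[R]_n) :
  dpolytope d P -> vertices P #= `I_(d + 3) ->
  nonsimple_vertices d P #<= `I_(d - 1) -> reconstructible d P.
Proof.
move=> dP cP nP m P' phi dP' [[phiV phi_inj phi_surj] adj].
have N2 : (1 < d + 3)%N by rewrite addnC.
have [x [p [q [PE pos G]]]] := polytope_config dP cP.
have vx i : vertices P (x i) by rewrite PE; apply/(config_vertices pos); exists i.
pose x' i := phi (x i).
have x'inj : injective x'.
  move=> i j /phi_inj E; apply: (config_inj pos); apply: E; exact/mem_set.
have VP' : vertices P' = x' @` [set` [set: 'I_(d + 3)]%SET].
  apply/seteqP; split=> [v /phi_surj[u + <-]|_ [i _ <-]]; last exact: phiV.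
  by rewrite PE => /(config_vertices pos)[i ->]; exists i; rewrite /= ?inE.
have P'E : P' = hull x' [set: 'I_(d + 3)]%SET.
  by rewrite (polytope_vertices dP') VP'.
have pos' : vertex_position x' [set: 'I_(d + 3)]%SET.
  by apply: vertices_position => // i; rewrite -P'E; apply: phiV.
have [_ dim'] := dP'; rewrite P'E in dim'.
have [p' [q' G']] := gale_exists erefl dim'.
have nn : nonadj p q =2 nonadj p' q'.
  move=> i j; have [<-|ij] := eqVneq i j; first by rewrite /nonadj eqxx.
  have := adj (x i) (x j) (vx i) (vx j); rewrite PE P'E.
  rewrite (config_adjacent N2 pos G) (config_adjacent N2 pos' G') ij /= => h.
  by apply/idP/idP; apply: contraTT => /h.
have [_ dim] := dP; rewrite PE in dim nP.
have four := four_branching pos G dim nP.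
have vert := config_vert pos G; have vert' := config_vert pos' G'.
have same S : face_set x [set: 'I_(d + 3)]%SET S <-> face_set x' [set: 'I_(d + 3)]%SET S.
  rewrite (face_coface G) (face_coface G'); exact: coface_rigid.
have [psi iso psiE] := lattice_iso pos same.
rewrite PE P'E; exists psi => // v; rewrite (config_vertices pos) => -[i ->].
exact: psiE.
Qed.

(** * Iterated pyramids *)

Section Pyramids.
Variables (R : realType) (n : nat) (I : finType) (x : I -> 'rV[R]_n).
Implicit Types (T S L : {set I}).

Lemma face_set_restrict T T' S : (forall i, i \in T' -> i \in T) ->
  (forall i, i \in S -> i \in T') -> face_set x T S -> face_set x T' S.
Proof.
move=> TT ST [_ [c [b h]]]; split=> //; exists c, b => i /TT; exact: h.
Qed.

Lemma vertex_position_restrict T T' : (forall i, i \in T' -> i \in T) ->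
  vertex_position x T -> vertex_position x T'.
Proof.
move=> TT pos i iT; apply: (face_set_restrict TT); last exact/pos/TT.
by move=> j; rewrite inE => /eqP ->.
Qed.

Lemma hull_dpolytope T d : has_dim (hull x T) d -> dpolytope d (hull x T).
Proof.
by move=> dT; split=> //; exists (x @` [set` T]) => //; apply/finite_image/finite_finset.
Qed.

Lemma apex_pyramid T i d : vertex_position x T -> i \in T ->
  face_set x T (T :\ i) -> (exists j, j \in (T :\ i)%SET) -> has_dim (hull x T) d ->
  pyramid_with_basis (hull x (T :\ i)) (hull x T) /\
  exists2 e, d = e.+1 & has_dim (hull x (T :\ i)) e.
Proof.
move=> pos iT fB [k kB] /has_dim_hull[_ dT].
have [BT [c [b h]]] := fB.
have iB : i \notin (T :\ i)%SET by rewrite !inE eqxx.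
have dE : d = (\dim (direction x (T :\ i))).+1.
  rewrite -dT -{1}(finset.setD1K iT); apply: (@direction_cone _ _ _ _ _ c b _ k) => //.
    by move=> j jB; apply/eqP; have [_ ->] := h j (BT j jB).
  by have [_ ->] := h i iT.
have dB : has_dim (hull x (T :\ i)) (\dim (direction x (T :\ i))).
  by apply/has_dim_hull; split=> //; exists k.
split; last by exists (\dim (direction x (T :\ i))).
split.
  split; first by apply/faces_hull; exists (T :\ i)%SET.
  exists (\dim (direction x (T :\ i))) => //; rewrite -dE.
  by apply/has_dim_hull; split=> //; exists i.
exists (x i).
  split; first by rewrite vertices_hull //; exists i.
  by move=> /(hull_face_mem fB iT); rewrite (negPf iB).
apply/seteqP; split.
  apply: hull_min; first exact: conv_hull_convex.
  move=> j jT; have [->|ji] := eqVneq j i; first by apply: sub_conv_hull; right.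
  by apply: sub_conv_hull; left; apply: mem_hull; rewrite !inE ji.
apply: conv_hull_min; first exact: conv_hull_convex.
move=> z [|->]; last exact: mem_hull.
by apply: hull_mono => j; rewrite !inE => /andP[].
Qed.

Lemma coface_set1 (p q : I -> R) i : zero_vec p q i -> coface p q [set i].
Proof.
move=> /andP[/eqP pi /eqP qi]; exists (fun j => (j == i)%:R); split.
- by move=> j; rewrite ler0n.
- by move=> j; rewrite ltr0n lt0b inE.
- by rewrite (bigD1 i) //= pi mulr0 add0r big1 // => j /negPf ->; rewrite mul0r.
- by rewrite (bigD1 i) //= qi mulr0 add0r big1 // => j /negPf ->; rewrite mul0r.
Qed.

(** The vertices outside L are removed one at a time: a zero vector is a
    coface by itself, so the other vertices form a facet. *)
Lemma fold_pyramid_core (p q : I -> R) L : (exists i, i \in L) ->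
  forall k T d, (forall i, i \in L -> i \in T) -> #|T| = (#|L| + k)%N ->
  vertex_position x T -> gale x T p q -> has_dim (hull x T) d ->
  (forall i, i \in T -> i \notin L -> zero_vec p q i) ->
  [/\ vertex_position x L, gale x L p q, exists2 e, d = (e + k)%N & has_dim (hull x L) e &
      forall m (Q : set 'rV[R]_m), comb_equiv (hull x L) Q -> fold_pyramid k Q (hull x T)].
Proof.
move=> [i0 i0L]; elim=> [|k IH] T d LT cT pos G dT z.
  rewrite addn0 in cT.
  have TE : T = L.
    apply/esym/eqP; rewrite eqEcard cT leqnn andbT.
    by apply/fintype.subsetP => i /LT.
  by subst T; split=> //; exists d; rewrite ?addn0.
have [i /andP[iT iL]] : exists i, (i \in T) && (i \notin L).
  apply/existsP; apply: contraT; rewrite negb_exists => /forallP no.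
  have : (#|T| <= #|L|)%N.
    apply: subset_leq_card; apply/fintype.subsetP => i iT; have := no i.
    by rewrite iT negbK.
  by rewrite cT -[X in (_ <= X)%N]addn0 leq_add2l.
have zi := z i iT iL.
have LT' j : j \in L -> j \in (T :\ i)%SET.
  by move=> jL; rewrite !inE LT // andbT; apply: contraNneq iL => <-.
have fB : face_set x T (T :\ i).
  apply/(gale_face _ G); split; first by move=> j; rewrite !inE => /andP[].
  suff -> : (T :\: (T :\ i) = [set i])%SET by apply: coface_set1.
  apply/setP => j; rewrite !inE; case: eqVneq => [->|_] //=.
  by rewrite andNb.
have [pyr [e dE dB]] := apex_pyramid pos iT fB (ex_intro _ i0 (LT' i0 i0L)) dT.
have TT' j : j \in (T :\ i)%SET -> j \in T by rewrite !inE => /andP[].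
have [] := IH (T :\ i)%SET e LT' _ (vertex_position_restrict TT' pos) (gale_zero G iT zi) dB.
- by move: cT; rewrite (cardsD1 i) iT addnS => -[].
- by move=> j /TT' jT; apply: z.
move=> posL GL [e' eE dL] fold; split=> //; first by exists e'; rewrite // dE eE addnS.
by move=> m Q /fold; exists (hull x (T :\ i)%SET).
Qed.

End Pyramids.

(** Otherwise, by [not_cofaceP], a nonzero covector is nonnegative outside
    i. *)
Lemma balanced_vert (R : realFieldType) (I : finType) (p q : I -> R) :
  balanced p q -> forall i, coface p q (~: [set i]).
Proof.
move=> bal i; apply: contrapT => /not_cofaceP[c [cC [k kC ck]]].
have [|u [v [uv cu cv]]] := bal c; first by exists k; rewrite gt_eqF.
have only l : cval p q c l < 0 -> l = i.
  move=> cl; apply/eqP; apply: contraTT cl => li; rewrite -leNgt; apply: cC.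
  by rewrite !inE.
by rewrite (only u cu) (only v cv) eqxx in uv.
Qed.

(** The coordinates of the points are affine functions. *)
Lemma gale_relation (R : realType) n (I : finType) (x : I -> 'rV[R]_n) (p q : I -> R) :
  gale x [set: I]%SET p q -> \sum_i p i *: x i = 0 /\ \sum_i q i *: x i = 0.
Proof.
move=> G; suff h l : \sum_i x i 0 l * p i = 0 /\ \sum_i x i 0 l * q i = 0.
  split; apply/rowP => l; rewrite summxE mxE; [rewrite -[RHS](proj1 (h l)) |
    rewrite -[RHS](proj2 (h l))]; apply: eq_bigr => i _; by rewrite mxE mulrC.
apply/G => [i|]; first by rewrite inE.
exists (- delta_mx l 0), 0 => i _; rewrite evalN opprK add0r /eval.
rewrite mxE (bigD1 l) //= mxE !eqxx mulr1 big1 ?addr0 // => j jl.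
by rewrite mxE (negPf jl) mulr0.
Qed.

Lemma gale_mx_rank (R : realType) N (p q : 'I_N -> R) i j :
  p i * q j - p j * q i != 0 -> \rank (gale_mx p q) = 2.
Proof.
move=> D; apply/eqP; rewrite -[_ == _]/(row_free _) -kermx_eq0 -submx0.
apply/rV_subP => v /sub_kermxP E; rewrite submx0.
have ev k : v 0 0 * p k + v 0 1 * q k = 0.
  have /rowP/(_ k) := E; rewrite [RHS]mxE mxE !big_ord_recl big_ord0 addr0 !mxE /= => <-.
  by congr (_ * _ + v 0 _ * _); apply/val_inj.
have E0 : v 0 0 * (p i * q j - p j * q i) = 0.
  transitivity (q j * (v 0 0 * p i + v 0 1 * q i) - q i * (v 0 0 * p j + v 0 1 * q j)).
    by ring.
  by rewrite !ev !mulr0 subrr.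
have E1 : v 0 1 * (p i * q j - p j * q i) = 0.
  transitivity (p i * (v 0 0 * p j + v 0 1 * q j) - p j * (v 0 0 * p i + v 0 1 * q i)).
    by ring.
  by rewrite !ev !mulr0 subrr.
apply/eqP/rowP => k; rewrite mxE.
move/eqP: E0; move/eqP: E1; rewrite !mulf_eq0 (negPf D) !orbF => /eqP E1 /eqP E0.
case: (unliftP 0 k) => [l ->|-> //]; rewrite ord1 -[RHS]E1.
by congr (v 0 _); apply/val_inj.
Qed.

(** * The prism *)

Section Six.
Variable R : realType.
Local Notation T := [set: 'I_6]%SET.
Local Notation o k := (@Ordinal 6 k isT).

Lemma ord6_case (P : 'I_6 -> Prop) :
  P (o 0) -> P (o 1) -> P (o 2) -> P (o 3) -> P (o 4) -> P (o 5) -> forall i, P i.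
Proof.
move=> h0 h1 h2 h3 h4 h5 [[|[|[|[|[|[|//]]]]]] k6].
- by have -> : Ordinal k6 = o 0 by apply/val_inj.
- by have -> : Ordinal k6 = o 1 by apply/val_inj.
- by have -> : Ordinal k6 = o 2 by apply/val_inj.
- by have -> : Ordinal k6 = o 3 by apply/val_inj.
- by have -> : Ordinal k6 = o 4 by apply/val_inj.
- by have -> : Ordinal k6 = o 5 by apply/val_inj.
Qed.

Lemma sum_ord6 (V : nmodType) (F : 'I_6 -> V) :
  \sum_i F i = F (o 0) + (F (o 1) + (F (o 2) + (F (o 3) + (F (o 4) + F (o 5))))).
Proof.
rewrite !big_ord_recl big_ord0 addr0.
by congr (F _ + (F _ + (F _ + (F _ + (F _ + F _))))); apply/val_inj.
Qed.

Definition path_from (p q : 'I_6 -> R) : Prop :=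
  [/\ nonadj p q (o 0) (o 1), nonadj p q (o 1) (o 2), nonadj p q (o 2) (o 3),
      nonadj p q (o 3) (o 4) & nonadj p q (o 4) (o 5)].

Lemma six_coface p q : path_from p q -> forall C, coface p q C <->
  path_rule (nonadj p q (o 0) (o 5)) (o 0 \in C) (o 1 \in C) (o 2 \in C)
    (o 3 \in C) (o 4 \in C) (o 5 \in C).
Proof. by move=> [h1 h2 h3 h4 h5]; apply: path_cofaceP. Qed.

(** Three pairs of opposite vectors, (0, 3), (1, 4) and (2, 5): the equality
    of the vectors x3 - x0, x1 - x4 and x5 - x2 follows from the two
    dependencies. *)
Definition prism_p (i : 'I_6) : R := nth 0 [:: -1; -1; 0; 1; 1; 0] i.
Definition prism_q (i : 'I_6) : R := nth 0 [:: 0; 1; 1; 0; -1; -1] i.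

Lemma prism_cval c i :
  cval prism_p prism_q c i = nth 0 [:: - c.1; c.2 - c.1; c.2; c.1; c.1 - c.2; - c.2] i.
Proof.
by move: i; apply: ord6_case; rewrite /cval /prism_p /prism_q /=; ring.
Qed.

Lemma prism_balanced : balanced prism_p prism_q.
Proof.
move=> [a b] [i vi].
have neg j k : j != k -> cval prism_p prism_q (a, b) j < 0 ->
   cval prism_p prism_q (a, b) k < 0 -> exists i j, [/\ i != j,
   cval prism_p prism_q (a, b) i < 0 & cval prism_p prism_q (a, b) j < 0].
  by exists j, k.
have [a0|a0|a0] := ltgtP a 0; have [b0|b0|b0] := ltgtP b 0.
- by apply: (neg (o 2) (o 3)); rewrite // !prism_cval /=; lra.
- by apply: (neg (o 3) (o 5)); rewrite // !prism_cval /=; lra.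
- by apply: (neg (o 3) (o 4)); rewrite // !prism_cval /=; lra.
- by apply: (neg (o 0) (o 2)); rewrite // !prism_cval /=; lra.
- by apply: (neg (o 0) (o 5)); rewrite // !prism_cval /=; lra.
- by apply: (neg (o 0) (o 1)); rewrite // !prism_cval /=; lra.
- by apply: (neg (o 1) (o 2)); rewrite // !prism_cval /=; lra.
- by apply: (neg (o 4) (o 5)); rewrite // !prism_cval /=; lra.
- move: vi; rewrite prism_cval a0 b0 /= subrr oppr0.
  by move: i; apply: ord6_case; rewrite /= eqxx.
Qed.

Lemma prism_nonadj c i j : i != j -> cval prism_p prism_q c i < 0 ->
  cval prism_p prism_q c j < 0 ->
  (forall k, (k == i) || (k == j) || (0 <= cval prism_p prism_q c k)) ->
  nonadj prism_p prism_q i j.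
Proof.
move=> ij ci cj h; apply: (cuts_nonadj ij (c := c)); split=> // k ki kj.
by have := h k; rewrite (negPf ki) (negPf kj).
Qed.

Lemma prism_path : path_from prism_p prism_q /\ nonadj prism_p prism_q (o 0) (o 5).
Proof.
split; first split.
- apply: (@prism_nonadj (1, 0)); rewrite ?prism_cval //=; try lra.
  by apply: ord6_case; rewrite prism_cval //=; lra.
- apply: (@prism_nonadj (0, -1)); rewrite ?prism_cval //=; try lra.
  by apply: ord6_case; rewrite prism_cval //=; lra.
- apply: (@prism_nonadj (-1, -1)); rewrite ?prism_cval //=; try lra.
  by apply: ord6_case; rewrite prism_cval //=; lra.
- apply: (@prism_nonadj (-1, 0)); rewrite ?prism_cval //=; try lra.
  by apply: ord6_case; rewrite prism_cval //=; lra.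
- apply: (@prism_nonadj (0, 1)); rewrite ?prism_cval //=; try lra.
  by apply: ord6_case; rewrite prism_cval //=; lra.
- apply: (@prism_nonadj (1, 1)); rewrite ?prism_cval //=; try lra.
  by apply: ord6_case; rewrite prism_cval //=; lra.
Qed.

Lemma gale_position n (I : finType) (x : I -> 'rV[R]_n) (p q : I -> R) :
  gale x [set: I]%SET p q -> balanced p q -> vertex_position x [set: I]%SET.
Proof.
move=> G bal i _; apply/(gale_face _ G); split; first by move=> j; rewrite inE.
by rewrite finset.setTD; apply: balanced_vert.
Qed.

Lemma prism_points : exists x : 'I_6 -> 'rV[R]_6,
  [/\ gale x T prism_p prism_q, vertex_position x T & simplicial_3prism (hull x T)].
Proof.
have [] := @gale_realize R 3 prism_p prism_q.
- by rewrite sum_ord6 /prism_p /=; ring.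
- by rewrite sum_ord6 /prism_q /=; ring.
- apply: (@gale_mx_rank _ _ _ _ (o 0) (o 2)); rewrite /prism_p /prism_q /=.
  by rewrite mulr0 subr0 mulr1 oppr_eq0 oner_eq0.
move=> x [G dx]; have pos := gale_position G prism_balanced.
exists x; split=> //.
pose S := [set o 0; o 2; o 4]%SET; pose w := x (o 3) - x (o 0).
have [r1 r2] := gale_relation G.
rewrite !sum_ord6 /prism_p /prism_q /= in r1 r2.
have e1 : x (o 1) = x (o 4) + w.
  apply/rowP => l; have /rowP/(_ l) := r1; rewrite /w !mxE; lra.
have e5 : x (o 5) = x (o 2) + w.
  apply/rowP => l; have /rowP/(_ l) := r1; have /rowP/(_ l) := r2.
  rewrite /w !mxE; lra.
have e3 : x (o 3) = x (o 0) + w by rewrite /w addrC subrK.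
have fS : face_set x T S.
  apply/(gale_face _ G); split; first by move=> j; rewrite inE.
  apply/(six_coface (proj1 prism_path)).
  by rewrite (proj2 prism_path) /S !inE.
have posS : vertex_position x S.
  by apply: vertex_position_restrict pos => i; rewrite inE.
have [_ [c [b h]]] := fS.
have hS j : j \in S -> eval (x j) c = b.
  by move=> jS; apply/eqP; have [_ ->] := h j (finset.in_setT _).
have h3 : eval (x (o 3)) c != b by have [_ ->] := h (o 3) (finset.in_setT _); rewrite /S !inE.
have S0 : o 0 \in S by rewrite /S !inE.
have dS : \dim (direction x S) = 2%N.
  have [_ dT] := proj1 (has_dim_hull _ _ _) dx.
  have := direction_cone hS h3 S0.
  have -> : direction x (o 3 |: S)%SET = direction x T.
    apply/eqP; rewrite eqEsubv direction_mono /=; last by move=> i _; rewrite inE.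
    have mem0 i : x i - x (o 0) \in direction x (o 3 |: S)%SET.
      have mw : w \in direction x (o 3 |: S)%SET.
        by apply: mem_direction; rewrite /S !inE.
      have m2 : x (o 2) - x (o 0) \in direction x (o 3 |: S)%SET.
        by apply: mem_direction; rewrite /S !inE.
      have m4 : x (o 4) - x (o 0) \in direction x (o 3 |: S)%SET.
        by apply: mem_direction; rewrite /S !inE.
      move: i; apply: ord6_case => //; first by rewrite subrr mem0v.
        by rewrite e1 addrAC memvD.
      by rewrite e5 addrAC memvD.
    apply/direction_subP => i j _ _.
    have -> : x i - x j = (x i - x (o 0)) - (x j - x (o 0)).
      by rewrite opprB addrA subrK.
    by rewrite memvB.
  by rewrite dT => -[].
exists (hull x S), (direction x S), w; split.
- split; first by apply/hull_dpolytope/has_dim_hull; split=> //; exists (o 0).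
  rewrite vertices_hull //.
  have cS : #|S| = 3%N by rewrite /S -finset.setUA !cardsU1 cards1 !inE.
  have : x @` [set` S] #= `I_#|S|.
    by apply: card_image_finset => i j iS jS; apply: (position_inj posS).
  by rewrite cS.
- exact: direction_hull.
- apply/negP => /(face_direction hS); rewrite /w evalB (hS _ S0) => /eqP.
  by rewrite subr_eq0 (negPf h3).
apply/seteqP; split.
  apply: hull_min; first exact: conv_hull_convex.
  have inS i : i \in S -> conv_hull (hull x S `|` [set z + w | z in hull x S]) (x i).
    by move=> iS; apply: sub_conv_hull; left; apply: mem_hull.
  have inw i : i \in S -> conv_hull (hull x S `|` [set z + w | z in hull x S]) (x i + w).
    by move=> iS; apply: sub_conv_hull; right; exists (x i) => //; apply: mem_hull.
  move=> i _; move: i; apply: ord6_case; rewrite ?e1 ?e3 ?e5;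
    by [apply: inS; rewrite /S !inE | apply: inw; rewrite /S !inE].
apply: conv_hull_min; first exact: conv_hull_convex.
move=> z [|[u uS <-]]; first by apply: hull_mono => i; rewrite inE.
have cw : convex_set [set v | hull x T (v + w)].
  apply/convex_setE => v v' t t0 t1 /= hv hv'.
  have -> : t *: v + (1 - t) *: v' + w = t *: (v + w) + (1 - t) *: (v' + w).
    by apply/rowP => l; rewrite !mxE; ring.
  have /convex_setE cT := @conv_hull_convex R 6 [set x i | i in [set` T]].
  exact: cT.
apply: (hull_min cw _ uS) => i; rewrite /S !inE -orbA.
by case/or3P => /eqP -> /=; rewrite -?e1 -?e3 -?e5; apply: mem_hull; rewrite inE.
Qed.

End Six.

(** * The tetragonal antiwedge *)

Section Antiwedge.
Variable R : realType.
Local Notation T := [set: 'I_6]%SET.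
Local Notation o k := (@Ordinal 6 k isT).
Variables (n : nat) (x : 'I_6 -> 'rV[R]_n) (p q : 'I_6 -> R).
Hypotheses (pos : vertex_position x T) (G : gale x T p q) (dx : has_dim (hull x T) 3).
Hypothesis pth : path_from p q.
Hypothesis open_path : ~~ nonadj p q (o 0) (o 5).

Let N2 : (1 < 6)%N := isT.

(** The endpoints of the path have one non-neighbour each. *)
Lemma antiwedge_nonsimple : nonsimple_vertices 3 (hull x T) #= `I_2.
Proof.
have := config_nonsimple_card N2 pos G (d := 3) erefl.
suff -> : [set i | ~~ branching (nonadj p q) i]%SET = [set o 0; o 5]%SET.
  by rewrite cards2.
have [h01 h12 h23 h34 h45] := pth.
have sym := nonadj_sym p q.
have irr := nonadj_irr p q.
have deg (v a b c : 'I_6) : a != b -> b != c -> a != c ->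
    nonadj p q v a -> nonadj p q v b -> nonadj p q v c = false.
  by move=> ab bc ac va vb; apply/negP; exact: nonadj_deg2 ab bc ac va vb.
have h10 : nonadj p q (o 1) (o 0) by rewrite sym.
have h21 : nonadj p q (o 2) (o 1) by rewrite sym.
have h32 : nonadj p q (o 3) (o 2) by rewrite sym.
have h43 : nonadj p q (o 4) (o 3) by rewrite sym.
have h54 : nonadj p q (o 5) (o 4) by rewrite sym.
have inner (v a b : 'I_6) : a != b -> nonadj p q v a -> nonadj p q v b ->
    branching (nonadj p q) v.
  move=> ab va vb; rewrite /branching.
  suff -> : [set j | nonadj p q v j]%SET = [set a; b]%SET by rewrite cards2 ab.
  apply/setP => j; rewrite !inE; apply/idP/idP => [vj|/orP[] /eqP -> //].
  apply/negPn/negP; rewrite negb_or => /andP[ja jb].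
  by move: vj; rewrite (deg v a b j) // eq_sym.
have one (v a : 'I_6) : (forall j, j != a -> ~~ nonadj p q v j) ->
    ~~ branching (nonadj p q) v.
  move=> h; rewrite /branching neq_ltn; apply/orP; left; rewrite ltnS.
  apply: (@leq_trans #|[set a]%SET|); last by rewrite cards1.
  apply: subset_leq_card; apply/fintype.subsetP => j.
  by rewrite !inE; apply: contraTT => /h.
apply/setP; apply: ord6_case; rewrite !inE.
- apply: (one (o 0) (o 1)); apply: ord6_case => // _.
  + by rewrite sym (deg (o 2) (o 1) (o 3)).
  + by rewrite sym (deg (o 3) (o 2) (o 4)).
  + by rewrite sym (deg (o 4) (o 3) (o 5)).
- by rewrite (inner (o 1) (o 0) (o 2)).
- by rewrite (inner (o 2) (o 1) (o 3)).
- by rewrite (inner (o 3) (o 2) (o 4)).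
- by rewrite (inner (o 4) (o 3) (o 5)).
- apply: (one (o 5) (o 4)); apply: ord6_case => // _.
  + by rewrite sym.
  + by rewrite sym (deg (o 1) (o 0) (o 2)).
  + by rewrite sym (deg (o 2) (o 1) (o 3)).
  + by rewrite sym (deg (o 3) (o 2) (o 4)).
Qed.

(** A proper face has dimension at most 2, and three vertices are not
    collinear. *)
Lemma face_dim2 S : face_set x T S ->
  has_dim (hull x S) 2 <-> (2 < #|S|)%N && (S != T).
Proof.
move=> fS; have [_ dT] := proj1 (has_dim_hull _ _ _) dx; split.
  move=> /has_dim_hull[[i iS] dS]; apply/andP; split; last first.
    by apply/eqP => E; rewrite E dT in dS.
  rewrite ltnNge; apply/negP => S2.
  have [j [jS Sj]] : exists j, j \in S /\ forall k, k \in S -> (k == i) || (k == j).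
    have [E|[j]] := set_0Vmem (S :\ i)%SET.
      exists i; split=> // k kS; have : k \notin (S :\ i)%SET by rewrite E finset.in_set0.
      by rewrite !inE kS andbT negbK => ->.
    rewrite in_setD1 => /andP[ji jS]; exists j; split=> // k kS.
    apply/negPn/negP; rewrite negb_or => /andP[ki kj].
    have : (size [:: i; j; k] <= size (enum S))%N.
      apply: uniq_leq_size.
        by rewrite /= !inE !negb_or eq_sym ji eq_sym ki eq_sym kj.
      by move=> l; rewrite mem_enum !inE => /or3P[] /eqP ->.
    by rewrite -cardE /= leqNgt ltnS S2.
  have sub : (direction x S <= <[x i - x j]>)%VS.
    apply/direction_subP => k l /Sj/orP[] /eqP -> /Sj/orP[] /eqP ->;
      rewrite ?subrr ?mem0v ?memv_line //.
    by rewrite -opprB memvN memv_line.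
  by have := dimvS sub; rewrite dS dim_vline; case: (_ != _).
move=> /andP[S3 ST].
have [i iS] : exists i, i \in S by apply/set0Pn; rewrite -card_gt0; apply: leq_trans S3.
have [j jS] : exists j, j \in (S :\ i)%SET.
  by apply/set0Pn; rewrite -card_gt0; move: S3; rewrite (cardsD1 i) iS; lia.
have [k kS] : exists k, k \in (S :\ i :\ j)%SET.
  apply/set0Pn; rewrite -card_gt0; move: S3.
  by rewrite (cardsD1 i) iS (cardsD1 j (S :\ i)%SET) jS; lia.
move: jS kS; rewrite !in_setD1 => /andP[ji jS] /and3P[kj ki kS].
apply/has_dim_hull; split; first by exists i.
apply/eqP; rewrite eqn_leq; apply/andP; split.
  have [l lS] : exists l, l \notin S.
    apply/existsP; rewrite -negb_forall; apply: contra ST => /forallP al.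
    by apply/eqP/setP => l; rewrite inE al.
  have := face_dim_lt fS (ex_intro _ i iS); rewrite dT; apply.
  by exists l; rewrite ?inE.
rewrite ltnNge; apply/negP => d1.
have nz : x i - x j != 0.
  rewrite subr_eq0; apply/eqP => /(config_inj pos) E; rewrite E eqxx in ji.
  by [].
have sub : (<[x i - x j]> <= direction x S)%VS by rewrite -memvE mem_direction.
have := eqEdim <[x i - x j]>%VS (direction x S).
rewrite sub dim_vline nz d1 => /eqP Eq.
have := mem_direction x kS jS; rewrite -Eq => /vlineP[t Et].
apply: (@position_not_collinear _ _ _ x T i j k t pos) => //; rewrite ?inE //.
by rewrite eq_sym.
Qed.

Lemma card_ord6 (S : {set 'I_6}) : #|S| = ((o 0 \in S) + ((o 1 \in S) + ((o 2 \in S) +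
  ((o 3 \in S) + ((o 4 \in S) + (o 5 \in S))))))%N.
Proof.
rewrite -sum1_card big_mkcond /= sum_ord6.
by do 6![case: (_ \in _)].
Qed.

(** Membership of the vertices 0, ..., 5: the complements of the two opposite
    pairs (0, 3) and (2, 5), which are quadrilaterals, then four triangles. *)
Definition antiwedge_facets : seq (seq bool) :=
  [:: [:: false; true; true; false; true; true];
      [:: true; true; false; true; true; false];
      [:: true; false; false; true; false; true];
      [:: true; false; true; false; false; true];
      [:: false; true; false; true; false; true];
      [:: true; false; true; false; true; false]].

Lemma antiwedge_facet_rule b0 b1 b2 b3 b4 b5 :
  path_rule false (~~ b0) (~~ b1) (~~ b2) (~~ b3) (~~ b4) (~~ b5) &&
  (2 < b0 + (b1 + (b2 + (b3 + (b4 + b5)))) < 6)%N =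
  ([:: b0; b1; b2; b3; b4; b5] \in antiwedge_facets).
Proof. by move: b0 b1 b2 b3 b4 b5 => [] [] [] [] [] []. Qed.

Definition facet_set (k : 'I_6) : {set 'I_6} :=
  [set i : 'I_6 | nth false (nth [::] antiwedge_facets k) i]%SET.

Lemma facet_row (k : 'I_6) : [:: o 0 \in facet_set k; o 1 \in facet_set k;
    o 2 \in facet_set k; o 3 \in facet_set k; o 4 \in facet_set k; o 5 \in facet_set k]
  = nth [::] antiwedge_facets k.
Proof. by rewrite !inE; move: k; apply: ord6_case. Qed.

Lemma facet_set_inj : injective facet_set.
Proof.
move=> i j E; have /eqP R0 : nth [::] antiwedge_facets i = nth [::] antiwedge_facets j.
  by rewrite -!facet_row E.
apply/val_inj/eqP; move: R0.
by rewrite (@nth_uniq _ [::] antiwedge_facets i j (ltn_ord i) (ltn_ord j) isT).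
Qed.

Lemma facet_setP S : (face_set x T S /\ has_dim (hull x S) 2) <->
  exists k, S = facet_set k.
Proof.
have E : (face_set x T S /\ has_dim (hull x S) 2) <->
    [:: o 0 \in S; o 1 \in S; o 2 \in S; o 3 \in S; o 4 \in S; o 5 \in S]
      \in antiwedge_facets.
  rewrite -antiwedge_facet_rule -card_ord6.
  have fE : face_set x T S <-> path_rule false (o 0 \notin S) (o 1 \notin S)
      (o 2 \notin S) (o 3 \notin S) (o 4 \notin S) (o 5 \notin S).
    rewrite (face_coface G) (six_coface pth) (negPf open_path).
    by rewrite !finset.in_setC.
  have cT : (S != T) = (#|S| < 6)%N.
    have [le eqT] := subset_leqif_cards (finset.subsetT S).
    rewrite cardsT card_ord in le eqT.
    by rewrite ltn_neqAle le andbT eqT.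
  split=> [[fS /(face_dim2 fS)]|/andP[/fE fS]].
    by rewrite cT => ->; rewrite andbT; apply/fE.
  by rewrite -cT => h; split=> //; apply/face_dim2.
rewrite E; split=> [/(nthP [::])[k k6 kE]|[k ->]].
  exists (Ordinal k6); apply/setP; apply: ord6_case; rewrite inE /= kE //.
by rewrite facet_row mem_nth.
Qed.

Lemma antiwedge_facets_card : facets (hull x T) #= `I_6.
Proof.
have -> : facets (hull x T) = (fun k => hull x (facet_set k)) @` [set` [set: 'I_6]%SET].
  apply/seteqP; split=> [F [/faces_hull[S fS ->] [d dT dF]]|_ [k _ <-]].
    have [_ e1] := proj1 (has_dim_hull _ _ _) dT.
    have [_ e2] := proj1 (has_dim_hull _ _ _) dx; rewrite e1 in e2; case: e2 => e2.
    rewrite e2 in dF; have [k ->] := proj1 (facet_setP S) (conj fS dF).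
    by exists k; rewrite //= inE.
  have [fS dS] := proj2 (facet_setP (facet_set k)) (ex_intro _ k erefl).
  by split; [apply/faces_hull; exists (facet_set k) | exists 2%N].
rewrite -[X in _ #= `I_X]card_ord -cardsT; apply: card_image_finset => i j _ _ E.
have [fi _] := proj2 (facet_setP (facet_set i)) (ex_intro _ i erefl).
have [fj _] := proj2 (facet_setP (facet_set j)) (ex_intro _ j erefl).
exact/facet_set_inj/(face_set_inj fi fj E).
Qed.

Lemma antiwedge_hull : tetragonal_antiwedge (hull x T).
Proof.
split; [exact: hull_dpolytope | | exact: antiwedge_facets_card |
  exact: antiwedge_nonsimple].
rewrite vertices_hull // -[X in _ #= `I_X]card_ord -cardsT.
by apply: card_image_finset => i j _ _; apply: (config_inj pos).
Qed.

End Antiwedge.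

Lemma nonadj_comp (R : realFieldType) (I J : finType) (p q : I -> R) (h : J -> I) i j :
  injective h -> nonadj p q (h i) (h j) -> nonadj (p \o h) (q \o h) i j.
Proof.
move=> hinj /nonadjP[hij [c [ci cj ck]]].
have ij : i != j by apply: contraNneq hij => ->.
apply: (cuts_nonadj ij (c := c)); split=> // k ki kj.
by apply: ck; rewrite (inj_eq hinj).
Qed.

Lemma uniq_set_card (I : finType) (s : seq I) : uniq s -> #|[set i in s]%SET| = size s.
Proof. by move=> /card_uniqP <-; apply: eq_card => i; rewrite inE. Qed.

(** * Classification *)

(** With r zero vectors, d + 3 is r + 5 or r + 6, which gives the dimension of
    the core. *)
Lemma few_nonsimple_shape (R : realType) n d (P : set 'rV[R]_n) :
  dpolytope d P -> vertices P #= `I_(d + 3) ->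
  nonsimple_vertices d P #<= `I_(d - 1) ->
     [\/ exists2 r : nat, d = (r + 3)%N &
           exists (m : nat) (Q : set 'rV[R]_m),
             simplicial_3prism Q /\ fold_pyramid r Q P,
         exists2 r : nat, d = (r + 3)%N &
           exists (m : nat) (Q : set 'rV[R]_m),
             tetragonal_antiwedge Q /\ fold_pyramid r Q P |
         exists2 r : nat, d = (r + 2)%N &
           exists (m : nat) (Q : set 'rV[R]_m),
             pentagon Q /\ fold_pyramid r Q P].
Proof.
move=> dP cP nP.
have N2 : (1 < d + 3)%N by rewrite addnC.
have [x [p [q [PE pos G]]]] := polytope_config dP cP.
have [_ dim] := dP; rewrite PE in dim nP; rewrite PE {PE dP cP}.
have four := four_branching pos G dim nP.
have core (s : seq 'I_(d + 3)) : uniq s -> s != [::] ->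
    (forall i, i \notin s -> zero_vec p q i) ->
    exists2 r, (d + 3 = size s + r)%N &
    [/\ vertex_position x [set i in s], gale x [set i in s] p q,
        exists2 e, d = (e + r)%N & has_dim (hull x [set i in s]) e &
      forall m (Q : set 'rV[R]_m), comb_equiv (hull x [set i in s]) Q ->
        fold_pyramid r Q (hull x [set: 'I_(d + 3)]%SET)].
  move=> Us s0 zs; have sd : (size s <= d + 3)%N.
    by rewrite -(card_uniqP Us) -[X in (_ <= X)%N]card_ord max_card.
  exists (d + 3 - size s)%N; first by rewrite subnKC.
  have ne : exists i, i \in [set i in s]%SET.
    by case: s s0 {Us zs sd} => // i s _; exists i; rewrite !inE eqxx.
  apply: (fold_pyramid_core ne) => //.
  - by rewrite uniq_set_card // cardsT card_ord subnKC.
  - by move=> i _; rewrite inE; apply: zs.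
have [|] := pentagon_or_path_vectors N2 (config_vert pos G) four.
  move=> [a [b [c [a' [b' [U pin]]]]]].
  have [|r rE [posL GL [e dE dimL] fold]] := core _ U isT.
    by move=> i il; rewrite (pentagon_zeroE U pin).
  have e2 : e = 2%N by move: rE dE => /=; lia.
  subst e; apply: Or33; exists r; first by rewrite addnC.
  exists n, (hull x [set i in [:: a; b; c; a'; b']]); split; last first.
    exact/fold/comb_equiv_refl.
  split; first exact: hull_dpolytope.
  rewrite vertices_hull // -[5%N]/(size [:: a; b; c; a'; b']) -(uniq_set_card U).
  by apply: card_image_finset => i j iL jL; apply: (position_inj posL).
move=> [p0 [p1 [p2 [p3 [p4 [p5 [U [h1 h2 h3 h4 h5]]]]]]]].
pose pp := [:: p0; p1; p2; p3; p4; p5].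
have [|r rE [posL GL [e dE dimL] fold]] := core pp U isT.
  by move=> i il; apply: (path_zero U h1 h2 h3 h4 h5).
have e3 : e = 3%N by move: rE dE => /=; lia.
subst e; pose h (k : 'I_6) := nth p0 pp k.
have hinj : injective h.
  move=> i j /eqP; rewrite nth_uniq // => /eqP E; exact/val_inj.
have hT : (h @: [set: 'I_6]%SET = [set i in pp])%SET.
  apply/setP => i; rewrite inE; apply/imsetP/idP => [[k _ ->]|ip].
    by rewrite /h mem_nth //=; apply: ltn_ord.
  have k6 : (index i pp < 6)%N by rewrite index_mem.
  by exists (Ordinal k6); rewrite ?inE // /h nth_index.
have hullE : hull (x \o h) [set: 'I_6]%SET = hull x [set i in pp].
  by rewrite hull_comp hT.
have pos6 : vertex_position (x \o h) [set: 'I_6]%SET.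
  by apply: vertex_position_comp => //; rewrite hT.
have G6 : gale (x \o h) [set: 'I_6]%SET (p \o h) (q \o h).
  by apply: gale_comp => //; rewrite hT.
have path6 : path_from (p \o h) (q \o h).
  by split; apply: nonadj_comp.
have dim6 : has_dim (hull (x \o h) [set: 'I_6]%SET) 3 by rewrite hullE.
have [cl|op] := boolP (nonadj (p \o h) (q \o h) (@Ordinal 6 0 isT) (@Ordinal 6 5 isT)).
  apply: Or31; exists r; first by rewrite addnC.
  have [z [Gz posz prism]] := prism_points R.
  exists 6, (hull z [set: 'I_6]%SET); split=> //; apply: fold; rewrite -hullE.
  have same S : face_set (x \o h) [set: 'I_6]%SET S <-> face_set z [set: 'I_6]%SET S.
    rewrite (face_coface G6) (face_coface Gz) (six_coface path6).
    by rewrite (six_coface (proj1 (prism_path R))) cl (proj2 (prism_path R)).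
  by have [psi iso _] := lattice_iso pos6 same; exists psi.
apply: Or32; exists r; first by rewrite addnC.
exists n, (hull (x \o h) [set: 'I_6]%SET); split.
  exact: (antiwedge_hull pos6 G6 dim6 path6 op).
by apply: fold; rewrite hullE; apply: comb_equiv_refl.
Qed.

(** * A polytope that is not determined by its graph *)

(** All vertices but the apex lie in the basis, so the apex alone is a
    coface. *)
Lemma pyramidal_zero (R : realType) n (I : finType) (x : I -> 'rV[R]_n) (p q : I -> R) :
  vertex_position x [set: I]%SET -> gale x [set: I]%SET p q ->
  pyramidal (hull x [set: I]%SET) -> exists i, zero_vec p q i.
Proof.
move=> pos G [B [[/faces_hull[S fS ->] _] [v [vv vS]]]].
move: vv; rewrite vertices_hull // => -[i _ vE] PE; subst v.
have iS : i \notin S by apply/negP => /(mem_hull (x := x)).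
have SE : S = (~: [set i])%SET.
  apply/setP => j; rewrite !inE; apply/idP/idP => [jS|ji].
    by apply: contraNneq iS => <-.
  have [_ [c [b h]]] := pos j (finset.in_setT j).
  have hj : hull x (i |: S) (x j).
    have : hull x [set: I]%SET (x j) by apply: mem_hull; rewrite inE.
    rewrite PE; apply: conv_hull_min; first exact: conv_hull_convex.
    move=> z [|->]; last by apply: mem_hull; rewrite !inE eqxx.
    by apply: hull_mono => k kS; rewrite !inE kS orbT.
  have [_ hjj] := h j (finset.in_setT j).
  have jb : eval (x j) c = b by apply/eqP; rewrite hjj inE.
  have le k : k \in (i |: S)%SET -> eval (x k) c <= b.
    by move=> _; have [] := h k (finset.in_setT k).
  have [k] := hull_nonempty (ex_intro _ _ (hull_face le hj jb)).
  rewrite inE => /andP[+ kb]; have [_ hk] := h k (finset.in_setT k).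
  by move: kb; rewrite hk inE => /eqP ->; rewrite !inE (negPf ji).
have /(gale_face _ G)[_] := fS; rewrite finset.setTD SE finset.setCK.
move=> [y [y0 yC yp yq]]; exists i.
have only j : j != i -> y j = 0.
  by move=> ji; apply/eqP; rewrite eq_le y0 leNgt yC inE (negPf ji).
have yi : y i != 0 by rewrite gt_eqF // yC inE.
rewrite /zero_vec; apply/andP; split.
  move/eqP: yp; rewrite (bigD1 i) //= big1 ?addr0; last by move=> j /only ->; rewrite mul0r.
  by rewrite mulf_eq0 (negPf yi).
move/eqP: yq; rewrite (bigD1 i) //= big1 ?addr0; last by move=> j /only ->; rewrite mul0r.
by rewrite mulf_eq0 (negPf yi).
Qed.

Section Example.
Variables (R : realType) (m : nat).
Hypothesis m2 : (2 <= m)%N.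
Local Notation N := (m + 2 + 3)%N.
Local Notation T := [set: 'I_N]%SET.

(** Clockwise around the origin, the vectors numbered 0, ..., 4 follow the
    repeated vector (-1, 0), which is the default value of the lists and is
    opposite to vector 2.  The vectors 1 and 4 are opposite, whereas 0 and 3
    are not; the entry m + 1 makes the sum vanish. *)
Definition ex_p (i : 'I_N) : R := nth (-1) [:: -2; 0; m.+1%:R; 1; 0] i.
Definition ex_q (i : 'I_N) : R := nth 0 [:: 1; 1; 0; -1; -1] i.

Lemma ex_lt k : (k < 7)%N -> (k < N)%N. Proof. by move=> k7; lia. Qed.
Definition ex_ord k (k7 : (k < 7)%N) : 'I_N := Ordinal (ex_lt k7).
Local Notation o k := (@ex_ord k isT).

Lemma ex_cval c i : cval ex_p ex_q c i =
  nth (- c.1) [:: c.2 - 2 * c.1; c.2; m.+1%:R * c.1; c.1 - c.2; - c.2] i.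
Proof.
rewrite /cval /ex_p /ex_q.
by case: i => [[|[|[|[|[|i]]]]] iN] /=; rewrite ?nth_nil; ring.
Qed.

Lemma m1_gt0 : 0 < m.+1%:R :> R. Proof. by rewrite ltr0n. Qed.

Lemma ex_sum (F : nat -> R) : \sum_(i < N) F i =
  F 0 + (F 1 + (F 2 + (F 3 + (F 4 + \sum_(5 <= i < m + 5) F i)))).
Proof.
have -> : N = (m + 5)%N by lia.
rewrite -(big_mkord xpredT F); do 5![rewrite big_ltn; last by lia].
by [].
Qed.

Lemma ex_sum_p : \sum_i ex_p i = 0.
Proof.
rewrite (ex_sum (fun i => nth (-1) [:: -2; 0; m.+1%:R; 1; 0] i)) /=.
rewrite (eq_big_nat _ _ (F2 := fun=> -1)); last first.
  by move=> [|[|[|[|[|i]]]]] // _; rewrite /= nth_nil.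
by rewrite sumr_const_nat addnK -natr1 mulNrn; ring.
Qed.

Lemma ex_sum_q : \sum_i ex_q i = 0.
Proof.
rewrite (ex_sum (fun i => nth 0 [:: 1; 1; 0; -1; -1] i)) /=.
rewrite (eq_big_nat _ _ (F2 := fun=> 0)); last first.
  by move=> [|[|[|[|[|i]]]]] // _; rewrite /= nth_nil.
by rewrite big1 //; ring.
Qed.

Lemma ex_neg c : (exists i, cval ex_p ex_q c i != 0) ->
  [\/ cval ex_p ex_q c (o 5) < 0 /\ cval ex_p ex_q c (o 6) < 0,
      cval ex_p ex_q c (o 0) < 0 /\ cval ex_p ex_q c (o 1) < 0,
      cval ex_p ex_q c (o 1) < 0 /\ cval ex_p ex_q c (o 2) < 0 |
      cval ex_p ex_q c (o 2) < 0 /\ cval ex_p ex_q c (o 3) < 0] \/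
  cval ex_p ex_q c (o 3) < 0 /\ cval ex_p ex_q c (o 4) < 0.
Proof.
case: c => a b [i]; rewrite !ex_cval /=; have := m1_gt0; set M := m.+1%:R => M0 vi.
have [a0|a0|a0] := ltgtP a 0; last 1 first.
- have [b0|b0|b0] := ltgtP b 0.
  + by left; apply: Or42; rewrite a0; lra.
  + by right; rewrite a0; lra.
  + case/negP: vi; rewrite a0 b0 mulr0 subrr oppr0 mulr0.
    by case: i => [[|[|[|[|[|i]]]]] iN] /=; rewrite ?nth_nil ?subr0 ?eqxx.
- have Ma : M * a < 0 by rewrite pmulr_rlt0.
  have [b0|b0] := ltP b 0; first by left; apply: Or43; lra.
  by left; apply: Or44; lra.
- by left; apply: Or41; lra.
Qed.

Lemma ex_balanced : balanced ex_p ex_q.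
Proof.
move=> c /ex_neg[[]|] [ci cj].
- by exists (o 5), (o 6).
- by exists (o 0), (o 1).
- by exists (o 1), (o 2).
- by exists (o 2), (o 3).
- by exists (o 3), (o 4).
Qed.

Definition ex_edge (i j : nat) : bool :=
  [&& j == i.+1 & (i < 4)%N] || [&& i == j.+1 & (j < 4)%N].

(** The repetition of (-1, 0) prevents a half-plane from containing exactly
    that vector and a neighbouring one. *)
Lemma ex_nonadj i j : nonadj ex_p ex_q i j = ex_edge i j.
Proof.
apply/idP/idP.
  move=> /nonadjP[ij [c [ci cj ck]]].
  have pair u v : u != v -> cval ex_p ex_q c u < 0 -> cval ex_p ex_q c v < 0 ->
      (i == u) && (j == v) || (i == v) && (j == u).
    move=> uv cu cv.
    have inij w : cval ex_p ex_q c w < 0 -> (w == i) || (w == j).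
      move=> cw; apply/negPn/negP; rewrite negb_or => /andP[wi wj].
      by have := ck w wi wj; rewrite leNgt cw.
    case/orP: (inij u cu) => /eqP ui; case/orP: (inij v cv) => /eqP vj; subst u v;
      by rewrite ?eqxx ?orbT // in uv *.
  have [||] := @ex_neg c; first by exists i; rewrite lt_eqF.
    case=> -[h1 h2]; have := pair _ _ _ h1 h2 => /(_ isT).
    + (* vectors 0 and 4 cannot both be nonnegative for a covector negative at 5 *)
      move=> h; exfalso; move: h1; rewrite ex_cval /= oppr_lt0 => a0.
      have far (k : 'I_N) : (k < 5)%N -> 0 <= cval ex_p ex_q c k.
        by move=> k5; apply: ck; case/orP: h => /andP[/eqP iE /eqP jE];
          rewrite ?iE ?jE -val_eqE /= neq_ltn; lia.
      by have := far (o 0) isT; have := far (o 4) isT; rewrite !ex_cval /=; lra.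
    + by case/orP => /andP[/eqP -> /eqP ->].
    + by case/orP => /andP[/eqP -> /eqP ->].
    + by case/orP => /andP[/eqP -> /eqP ->].
  move=> [h1 h2]; have := pair _ _ _ h1 h2 => /(_ isT).
  by case/orP => /andP[/eqP -> /eqP ->].
wlog : i j / (j == i.+1 :> nat) && (i < 4)%N.
  move=> W /orP[h|h]; first by apply: W; rewrite // /ex_edge h.
  by rewrite nonadj_sym; apply: W => //; rewrite /ex_edge h.
move=> /andP[/eqP ji i4] _.
have ij : i != j by rewrite -val_eqE /= ji neq_ltn ltnSn.
have := m1_gt0; set M := m.+1%:R => M0.
have all c : (forall k : 'I_N, (k < 5)%N -> k != i -> k != j -> 0 <= cval ex_p ex_q c k) ->
    c.1 <= 0 -> cval ex_p ex_q c i < 0 -> cval ex_p ex_q c j < 0 -> nonadj ex_p ex_q i j.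
  move=> hc c0 ci cj; apply: (cuts_nonadj ij (c := c)); split=> // k ki kj.
  have [k5|k5] := ltnP k 5; first exact: hc.
  by rewrite ex_cval nth_default // oppr_ge0.
have ne (k : 'I_N) (l : 'I_N) : k != l -> (k : nat) <> l.
  by move=> /eqP kl E; apply: kl; apply/val_inj.
case: i i4 ij ji all => [[|[|[|[|//]]]] iN] _ ij /= ji all.
- apply: (all (0, -1)); rewrite ?ex_cval /= ?ji /= //; try lra.
  move=> [[|[|[|[|[|k]]]]] kN] // _ /ne /= k1 /ne; rewrite ji /= => k2; rewrite ?ex_cval /= //; lra.
- apply: (all (-1, -1)); rewrite ?ex_cval /= ?ji /= -/M //; try lra.
  move=> [[|[|[|[|[|k]]]]] kN] // _ /ne /= k1 /ne; rewrite ji /= => k2; rewrite ?ex_cval /= //; lra.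
- apply: (all (-1, 0)); rewrite ?ex_cval /= ?ji /= -/M //; try lra.
  move=> [[|[|[|[|[|k]]]]] kN] // _ /ne /= k1 /ne; rewrite ji /= => k2; rewrite ?ex_cval /= //; lra.
- apply: (all (0, 1)); rewrite ?ex_cval /= ?ji /= -/M //; try lra.
  move=> [[|[|[|[|[|k]]]]] kN] // _ /ne /= k1 /ne; rewrite ji /= => k2; rewrite ?ex_cval /= //; lra.
Qed.

Lemma ex_branching i : branching (nonadj ex_p ex_q) i = (0 < i < 4)%N.
Proof.
rewrite /branching; have E j : (j \in [set j | nonadj ex_p ex_q i j]%SET) = ex_edge i j.
  by rewrite inE ex_nonadj.
apply/idP/idP => [/cards2P[a [b [ab S]]]|i4].
  have := set21 a b; rewrite -S E; have := set22 a b; rewrite -S E.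
  have : (a : nat) <> b by move=> /val_inj ab'; rewrite ab' eqxx in ab.
  rewrite /ex_edge; lia.
have a7 : (i.-1 < 7)%N by lia.
have b7 : (i.+1 < 7)%N by lia.
suff -> : [set j | nonadj ex_p ex_q i j]%SET = [set ex_ord a7; ex_ord b7]%SET.
  by rewrite cards2 -val_eqE /=; case: eqP => //; lia.
by apply/setP => j; rewrite E !inE -!val_eqE /= /ex_edge; lia.
Qed.

Lemma ex_count : #|[set i | ~~ branching (nonadj ex_p ex_q) i]%SET| = (m + 2)%N.
Proof.
have B : [set i | branching (nonadj ex_p ex_q) i]%SET = [set o 1; o 2; o 3]%SET.
  by apply/setP => i; rewrite !inE ex_branching -!val_eqE /=; lia.
have c3 : #|[set i | branching (nonadj ex_p ex_q) i]%SET| = 3%N.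
  by rewrite B -finset.setUA !cardsU1 cards1 !inE -!val_eqE.
have := cardsC [set i | branching (nonadj ex_p ex_q) i]%SET.
rewrite c3 card_ord.
have -> : (~: [set i | branching (nonadj ex_p ex_q) i])%SET
  = [set i | ~~ branching (nonadj ex_p ex_q) i]%SET.
  by apply/setP => i; rewrite !inE.
lia.
Qed.

(** The reversal of the path 0, ..., 4. *)
Definition ex_flip (i : 'I_N) : 'I_N :=
  if (i < 5)%N then ex_ord (leq_ltn_trans (leq_subr i 4) (isT : (4 < 7)%N)) else i.

Lemma ex_flipE i : ex_flip i = (if (i < 5)%N then 4 - i else i)%N :> nat.
Proof. by rewrite /ex_flip; case: ifP. Qed.

Lemma ex_flipK : involutive ex_flip.
Proof.
move=> i; apply/val_inj; rewrite /= !ex_flipE.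
by case: (ltnP i 5) => i5; case: ltnP; lia.
Qed.

Lemma ex_flip_edge i j : ex_edge (ex_flip i) (ex_flip j) = ex_edge i j.
Proof.
rewrite !ex_flipE /ex_edge; case: (ltnP i 5) => i5; case: (ltnP j 5) => j5; lia.
Qed.

(** The flip preserves the graph.  A lattice isomorphism that it induces would
    turn the face with coface {1, 4} into a face with coface {3, 0}; but the
    vectors 3 and 0 are not opposite. *)
Lemma nonreconstructible_example : exists (P : set 'rV[R]_N),
       [/\ dpolytope (m + 2) P,
           ~ pyramidal P,
           vertices P #= `I_N,
           nonsimple_vertices (m + 2) P #= `I_(m + 2) &
           ~ reconstructible (m + 2) P].
Proof.
have [] := @gale_realize R (m + 2) ex_p ex_q ex_sum_p ex_sum_q.
  apply: (@gale_mx_rank _ _ _ _ (o 0) (o 1)); rewrite /ex_p /ex_q /=.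
  by rewrite mul0r subr0 mulr1 oppr_eq0 pnatr_eq0.
move=> x [G dx]; have pos := gale_position G ex_balanced.
have N2 : (1 < N)%N by lia.
exists (hull x T); split.
- exact: hull_dpolytope.
- move=> /(pyramidal_zero pos G)[i] /andP[]; rewrite /ex_p /ex_q.
  case: i => [[|[|[|[|[|i]]]]] iN] /=; rewrite ?nth_nil ?oppr_eq0 ?oner_eq0 ?pnatr_eq0 //.
- rewrite vertices_hull // -[X in _ #= `I_X]card_ord -cardsT.
  by apply: card_image_finset => i j _ _; apply: (config_inj pos).
- by have := config_nonsimple_card N2 pos G erefl; rewrite ex_count.
pose phi v := if [pick i | x i == v] is Some i then x (ex_flip i) else v.
have phiE i : phi (x i) = x (ex_flip i).
  rewrite /phi; case: pickP => [j /eqP/(config_inj pos) -> //|/(_ i)].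
  by rewrite eqxx.
move=> /(_ _ _ phi (hull_dpolytope dx))[].
  split; first split.
  - move=> _ /(config_vertices pos)[i ->]; rewrite phiE.
    by apply/(config_vertices pos); exists (ex_flip i).
  - move=> _ _ /set_mem/(config_vertices pos)[i ->] /set_mem/(config_vertices pos)[j ->].
    by rewrite !phiE => /(config_inj pos)/(inv_inj ex_flipK) ->.
  - move=> _ /(config_vertices pos)[i ->]; exists (x (ex_flip i)).
      by apply/(config_vertices pos); exists (ex_flip i).
    by rewrite phiE ex_flipK.
  move=> _ _ /(config_vertices pos)[i ->] /(config_vertices pos)[j ->].
  rewrite !phiE !(config_adjacent N2 pos G) !ex_nonadj ex_flip_edge.
  by rewrite (inj_eq (inv_inj ex_flipK)).
move=> psi [[psi_fun psi_inj psi_surj] psi_le] psiV.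
pose S := (~: [set o 1; o 4])%SET.
have fS : face_set x T S.
  apply/(face_coface G); rewrite finset.setCK.
  exists (fun i => (i \in [set o 1; o 4]%SET)%:R); split.
  - by move=> i; rewrite ler0n.
  - by move=> i; rewrite ltr0n lt0b.
  - rewrite (bigD1 (o 1)) //= (bigD1 (o 4)) //= big1 ?addr0.
      by rewrite !inE ?eqxx ?orbT /ex_p /=; ring.
    by move=> i /andP[i1 i4]; rewrite !inE (negPf i1) (negPf i4) mul0r.
  - rewrite (bigD1 (o 1)) //= (bigD1 (o 4)) //= big1 ?addr0.
      by rewrite !inE ?eqxx ?orbT /ex_q /=; ring.
    by move=> i /andP[i1 i4]; rewrite !inE (negPf i1) (negPf i4) mul0r.
have FS : faces (hull x T) (hull x S) by apply/faces_hull; exists S.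
have [S' fS' SE'] := proj1 (faces_hull _ _ _) (psi_fun _ FS).
have face1 i : face_set x T [set i]%SET by apply: pos; rewrite inE.
have F1 i : faces (hull x T) [set x i].
  by apply/faces_hull; exists [set i]%SET; rewrite ?hull_set1.
have key i : (i \in S) = (ex_flip i \in S').
  have := psi_le _ _ (F1 i) FS.
  rewrite psiV ?phiE; last by apply/(config_vertices pos); exists i.
  rewrite SE' -!hull_set1 (face_set_le (face1 i) fS) (face_set_le (face1 (ex_flip i)) fS').
  move=> h; apply/idP/idP => hi.
    by apply: (proj2 h _ (ex_flip i)); rewrite ?inE // => k; rewrite inE => /eqP ->.
  by apply: (proj1 h _ i); rewrite ?inE // => k; rewrite inE => /eqP ->.
have S'E : S' = (~: [set o 0; o 3])%SET.
  apply/setP => i; rewrite -[i in LHS]ex_flipK -key !inE -!val_eqE /= ex_flipE.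
  by case: ifP => i5; lia.
have := proj1 (face_coface G S') fS'; rewrite S'E finset.setCK => -[y [y0 yC yp yq]].
have yz i : i \notin [set o 0; o 3]%SET -> y i = 0.
  by move=> iS; apply/eqP; rewrite eq_le y0 leNgt yC iS.
have two (f : 'I_N -> R) : \sum_i y i * f i = y (o 0) * f (o 0) + y (o 3) * f (o 3).
  rewrite (bigD1 (o 0)) //= (bigD1 (o 3)) //= big1 ?addr0 // => i /andP[i0 i3].
  by rewrite yz ?mul0r // !inE negb_or i0 i3.
move: yp yq; rewrite !two /ex_p /ex_q /= => e1 e2.
have : 0 < y (o 0) by rewrite yC !inE eqxx.
lra.
Qed.

End Example.

Theorem theorem14 (R : realType) :
  (forall (d n : nat) (P : set 'rV[R]_n),
     dpolytope d P ->
     vertices P #= `I_(d + 3) ->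
     nonsimple_vertices d P #<= `I_(d - 1) ->
     [\/ exists2 r : nat, d = (r + 3)%N &
           exists (m : nat) (Q : set 'rV[R]_m),
             simplicial_3prism Q /\ fold_pyramid r Q P,
         exists2 r : nat, d = (r + 3)%N &
           exists (m : nat) (Q : set 'rV[R]_m),
             tetragonal_antiwedge Q /\ fold_pyramid r Q P |
         exists2 r : nat, d = (r + 2)%N &
           exists (m : nat) (Q : set 'rV[R]_m),
             pentagon Q /\ fold_pyramid r Q P] /\
     reconstructible d P) /\
  (forall d : nat, (4 <= d)%N ->
     exists (n : nat) (P : set 'rV[R]_n),
       [/\ dpolytope d P,
           ~ pyramidal P,
           vertices P #= `I_(d + 3),
           nonsimple_vertices d P #= `I_d &
           ~ reconstructible d P]).
Proof.
split=> [d n P dP cP nP|d d4].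
  split; first exact: few_nonsimple_shape.
  exact: few_nonsimple_reconstructible.
have m2 : (2 <= d - 2)%N by lia.
have [P ex] := nonreconstructible_example R m2.
by rewrite subnK in P ex; [exists (d + 3)%N, P | lia].
Qed.
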